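(* For every language $L\in NP$ there exists a finite set of colors $C$ and a finite set $\mathcal{F}'$ of finite $C$-colored undirected graphs such that $L$ is polynomially equivalent to the $\mathcal{F}'$-free coloring problem.
   Context: A $C$-colored graph ${\bf G}'$ is a finite undirected graph ${\bf G}$ with a fixed assignment of a color from $C$ to each vertex. For a fixed finite set of colors $C$ and set $\mathcal{F}'$ of $C$-colored graphs, the $\mathcal{F}'$-free coloring problem is: given a finite graph ${\bf G}$, does there exist a $C$-coloring of its vertices such that the resulting colored graph contains no colored subgraph (not necessarily induced) isomorphic, as a colored graph, to some ${\bf F}'\in\mathcal{F}'$? Two languages are polynomially equivalent if each has a polynomial-time reduction to the other. *)

(* Defs.v *)
From Stdlib Require List.
From mathcomp Require Import all_boot.
Set Implicit Arguments. Unset Strict Implicit. Unset Printing Implicit Defensive.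

Inductive dir := MoveL | MoveR | Stay.

Record TM := {
  tm_Q : finType;
  tm_G : finType;
  tm_blank : tm_G;
  tm_bit : bool -> tm_G;
  tm_start : tm_Q;
  tm_halt : pred tm_Q;
  tm_delta : tm_Q -> tm_G -> tm_Q * tm_G * dir }.

(* configuration: state, (reversed left part of tape, head symbol, right part) *)
Definition config (M : TM) : Type :=
  (tm_Q M * (seq (tm_G M) * tm_G M * seq (tm_G M)))%type.

Definition tm_init (M : TM) (x : seq bool) : config M :=
  let s := map (@tm_bit M) x in
  (@tm_start M, ([::], head (@tm_blank M) s, behead s)).

Definition tm_step (M : TM) (c : config M) : config M :=
  let: (q, (l, h, r)) := c in
  if @tm_halt M q then c else
  let: (q', g, d) := @tm_delta M q h in
  match d with
  | Stay => (q', (l, g, r))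
  | MoveL => (q', (behead l, head (@tm_blank M) l, g :: r))
  | MoveR => (q', (g :: l, head (@tm_blank M) r, behead r))
  end.

Definition tm_run (M : TM) (t : nat) (x : seq bool) : config M :=
  iter t (@tm_step M) (@tm_init M x).

Definition tm_decode (M : TM) (g : tm_G M) : option bool :=
  if g == @tm_bit M true then Some true
  else if g == @tm_bit M false then Some false else None.

Fixpoint read_bits (M : TM) (s : seq (tm_G M)) : seq bool :=
  match s with
  | [::] => [::]
  | g :: s' => match @tm_decode M g with
               | Some b => b :: @read_bits M s'
               | None => [::]
               end
  end.

Definition tm_output (M : TM) (c : config M) : seq bool :=
  let: (_, (_, h, r)) := c in @read_bits M (h :: r).

Definition tm_halted (M : TM) (c : config M) : bool := @tm_halt M c.1.

Definition poly_time_computable (f : seq bool -> seq bool) : Prop :=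
  exists (M : TM) (c k : nat), forall x : seq bool,
    let cfg := tm_run M (c * size x ^ k + c) x in
    tm_halted cfg /\ tm_output cfg = f x.

Definition language := seq bool -> Prop.

Definition in_P (L : language) : Prop :=
  exists f, poly_time_computable f /\ forall x, L x <-> f x = [:: true].

Definition pair_enc (x y : seq bool) : seq bool :=
  flatten (map (fun b => [:: true; b]) x) ++ [:: false; false] ++ y.

Definition in_NP (L : language) : Prop :=
  exists (V : language) (c k : nat), in_P V /\
    forall x, L x <-> exists y, size y <= c * size x ^ k + c /\ V (pair_enc x y).

Definition poly_reduces (L1 L2 : language) : Prop :=
  exists f, poly_time_computable f /\ forall x, L1 x <-> L2 (f x).

Definition poly_equivalent (L1 L2 : language) : Prop :=
  poly_reduces L1 L2 /\ poly_reduces L2 L1.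

(* Every string x encodes a graph: it has N = floor(sqrt |x|) + 1 vertices
   0..N-1 and, for i < j, {i,j} is an edge iff bit number 'C(j,2)+i of x is 1
   (missing bits are 0). Every finite graph with N >= 1 vertices is encoded by
   a string of length (N-1)^2. *)
Definition gr_n (x : seq bool) : nat := (Nat.sqrt (size x)).+1.

Definition gr_adj (x : seq bool) (i j : 'I_(gr_n x)) : bool :=
  (i != j) && nth false x ('C(maxn i j, 2) + minn i j).

Record cgraph (k : nat) := {
  cg_n : nat;
  cg_adj : rel 'I_cg_n;
  cg_col : 'I_cg_n -> 'I_k }.

Definition cgraph_wf k (F : cgraph k) : Prop :=
  0 < cg_n F /\ symmetric (@cg_adj k F) /\ irreflexive (@cg_adj k F).

Definition contains_colored (x : seq bool) k (c : 'I_(gr_n x) -> 'I_k)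
    (F : cgraph k) : Prop :=
  exists phi : 'I_(cg_n F) -> 'I_(gr_n x),
    injective phi /\
    (forall u v, @cg_adj k F u v -> gr_adj (phi u) (phi v)) /\
    (forall u, c (phi u) = @cg_col k F u).

Definition free_coloring k (Fs : seq (cgraph k)) : language :=
  fun x => exists c : 'I_(gr_n x) -> 'I_k,
    forall F, List.In F Fs -> ~ contains_colored c F.

(* Main.v *)
Require Import Defs.
From Stdlib Require List.
From Stdlib Require Import FunctionalExtensionality Classical ClassicalEpsilon.
From mathcomp Require Import all_boot zify.
Set Implicit Arguments. Unset Strict Implicit. Unset Printing Implicit Defensive.

(* A language in NP has a verifier [M1]; a second machine [M2] checks that the witness is short.
   The forbidden coloured graphs are those that match one of finitely many patterns of vertices,
   edges and colours, every pattern containing a rigid gadget of hubs. A vertex gets one of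
   finitely many sorts from the hubs that it is joined to. In the intended graphs the sorted
   vertices are a directed path of [B = |x| + 2] numbers that carries the bits of [x], and one
   cell for each [K]-tuple of numbers, joined to its digits through ports; patterns thus see
   when two cells have consecutive codes, or codes that differ by the length of a row. Colours of
   cells hold the tableaux of [M1] and [M2] on [x] and a guessed witness, and patterns forbid
   every local error.

   Arbitrary graphs must be handled as well. Without the gadget there is no pattern, so every
   colouring is free. If the hubs or the structure read off them are ambiguous, a pattern that
   does not mention colours occurs, so no colouring is free. If cells are missing, an escape
   colour may be used up to the first gap. Otherwise the graph encodes some [x], and has a free
   colouring if and only if [x] is in the language. These cases are distinguished in polynomial
   time, which gives the reduction back to the language. *)

(** * Structured programs for Turing machines *)

(** The language may lie anywhere in NP, so the reduction back to it cannot rest on hardness: every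
    graph must be decided outright or turned into one instance with the same answer. Hence only
    tableaux and witness are left to colours, while sorts, numbers and codes are encoded by edges
    and can be read in polynomial time. Forbidden subgraphs need not be induced, so a pattern can
    punish an edge that is present but never one that is missing; gaps in the chain must therefore
    be harmless, which is what the escape colour is for. Finitely many patterns suffice because
    adding a power of [B] to a code turns a run of maximal digits into zeros and advances one more
    digit: only the place where the carry stops varies, and [K] is constant. For the same reason
    exhaustive search over cells and over embeddings of the gadget is polynomial. The second machine
    is there because digits can only delimit a zone whose length is a power of [B], which may exceed
    the bound on the witness. Computability is handled by unary registers and bounded recursion, so
    that bounds concern values. *)

Section Programs.
Variables (G : finType) (blank : G).

Definition tape : Type := (seq G * G * seq G)%type.

Definition mv (tp : tape) (g : G) (d : dir) : tape :=
  let: (l, _, r) := tp in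
  match d with
  | Stay => (l, g, r)
  | MoveL => (behead l, head blank l, g :: r)
  | MoveR => (g :: l, head blank r, behead r)
  end.

Inductive prog :=
  | Act of (G -> G * dir)
  | Seq of prog & prog
  | If of pred G & prog & prog
  | While of pred G & prog.

(** The extra state [None] of [If] and [While] performs the test; it neither writes nor moves and
    costs one step. *)
Fixpoint st (p : prog) : finType :=
  match p with
  | Act _ => unit
  | Seq p q => (st p + st q)%type
  | If _ p q => option (st p + st q)
  | While _ p => option (st p)
  end.

Fixpoint entry (p : prog) : st p :=
  match p with
  | Act _ => tt
  | Seq p q => inl (entry p)
  | If _ p q => None
  | While _ p => None
  end.

(* The component [None] of the result means that the program exits. *)
Fixpoint trans (p : prog) : st p -> G -> option (st p) * G * dir :=
  match p with
  | Act w => fun _ g => (None, (w g).1, (w g).2)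
  | Seq p q => fun s g =>
      match s with
      | inl s => let: (o, g', d) := trans s g in
                 (Some (if o is Some s' then inl s' else inr (entry q)), g', d)
      | inr s => let: (o, g', d) := trans s g in (omap inr o, g', d)
      end
  | If P p q => fun s g =>
      match s with
      | None => (Some (Some (if P g then inl (entry p) else inr (entry q))), g, Stay)
      | Some (inl s) => let: (o, g', d) := trans s g in
                        (omap (fun s => Some (inl s)) o, g', d)
      | Some (inr s) => let: (o, g', d) := trans s g in
                        (omap (fun s => Some (inr s)) o, g', d)
      end
  | While P p => fun s g =>
      match s with
      | None => (if P g then Some (Some (entry p)) else None, g, Stay)
      | Some s => let: (o, g', d) := trans s g in (Some o, g', d)
      end
  end.

Inductive exits (p : prog) : st p -> tape -> nat -> tape -> Prop :=
  | exits_now s l h r g d :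
      trans s h = (None, g, d) -> exits s (l, h, r) 1 (mv (l, h, r) g d)
  | exits_later s l h r s' g d t tp' :
      trans s h = (Some s', g, d) -> exits s' (mv (l, h, r) g d) t tp' ->
      exits s (l, h, r) t.+1 tp'.

Definition runs p tp tp' t := exits (entry p) tp t tp'.

Lemma exits_lift (p q : prog) (f : st p -> st q) :
  (forall s g, trans (f s) g =
     ((let: (o, g', d) := trans s g in (omap f o, g', d)) : option (st q) * G * dir)) ->
  forall s tp t tp', exits s tp t tp' -> exits (f s) tp t tp'.
Proof.
move=> Hf s tp t tp'; elim => {s tp t tp'} [s l h r g d e|s l h r s' g d t tp' e _ IH].
  by apply: exits_now; rewrite Hf e.
by apply: exits_later IH; rewrite Hf e.
Qed.

Lemma exits_seql p q (s : st p) tp t tp' t2 tp2 :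
  exits s tp t tp' -> exits (entry q) tp' t2 tp2 ->
  exits (p := Seq p q) (inl s) tp (t + t2) tp2.
Proof.
move=> H /(@exits_lift q (Seq p q) inr) H2.
have {}H2 := H2 (fun s g => erefl).
elim: H H2 => {s tp t tp'} [s l h r g d e|s l h r s' g d t tp' e _ IH] H2.
  by rewrite add1n; apply: (@exits_later (Seq p q) _ _ _ _ _ g d) H2; rewrite /= e.
by rewrite addSn; apply: (@exits_later (Seq p q) _ _ _ _ _ g d) (IH H2); rewrite /= e.
Qed.

Lemma exits_while P p (s : st p) tp t tp' t2 tp2 :
  exits s tp t tp' -> exits (entry (While P p)) tp' t2 tp2 ->
  exits (p := While P p) (Some s) tp (t + t2) tp2.
Proof.
move=> H H2; elim: H H2 => {s tp t tp'} [s l h r g d e|s l h r s' g d t tp' e _ IH] H2.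
  by rewrite add1n; apply: (@exits_later (While P p) _ _ _ _ _ g d) H2; rewrite /= e.
by rewrite addSn; apply: (@exits_later (While P p) _ _ _ _ _ g d) (IH H2); rewrite /= e.
Qed.

Lemma runs_act w l h r : runs (Act w) (l, h, r) (mv (l, h, r) (w h).1 (w h).2) 1.
Proof. exact: (@exits_now (Act w)). Qed.

Lemma runs_seq p q a b c t u :
  runs p a b t -> runs q b c u -> runs (Seq p q) a c (t + u).
Proof. exact: exits_seql. Qed.

Lemma mv_stay l h r : mv (l, h, r) h Stay = (l, h, r). Proof. by []. Qed.

Lemma runs_if (P : pred G) p q l h r b t :
  runs (if P h then p else q) (l, h, r) b t -> runs (If P p q) (l, h, r) b t.+1.
Proof.
move=> H.
apply: (@exits_later (If P p q) _ _ _ _ (Some (if P h then inl (entry p) else inr (entry q)))) => /=.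
  by [].
rewrite -/(mv (l, h, r) h Stay) mv_stay; case: (P h) H => H.
- by apply: (@exits_lift p (If P p q) (fun s => Some (inl s))) H => s g /=; case: trans => [[]].
- by apply: (@exits_lift q (If P p q) (fun s => Some (inr s))) H => s g /=; case: trans => [[]].
Qed.

Lemma runs_while_stop (P : pred G) p l h r : ~~ P h -> runs (While P p) (l, h, r) (l, h, r) 1.
Proof.
by move=> H; apply: (@exits_now (While P p) None l h r h Stay); rewrite /= (negbTE H).
Qed.

Lemma runs_while_step (P : pred G) p l h r b c t u : P h ->
  runs p (l, h, r) b t -> runs (While P p) b c u -> runs (While P p) (l, h, r) c (t + u).+1.
Proof.
move=> H H1 H2; apply: (@exits_later (While P p) None l h r (Some (entry p)) h Stay).
  by rewrite /= H.
exact: (exits_while H1 H2).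
Qed.

(* Positions to the left of the visible part of the tape hold blanks. *)
Definition view (tp : tape) (k : nat) (F : nat -> G) : Prop :=
  let: (l, h, r) := tp in
  (forall i, i < k -> F (k.-1 - i) = nth blank l i) /\
  (forall i, F (k + i) = nth blank (h :: r) i).

Definition upd (T : Type) (F : nat -> T) (k : nat) (g : T) : nat -> T :=
  fun i => if i == k then g else F i.

Definition mvpos (k : nat) (d : dir) : nat :=
  match d with MoveL => k.-1 | MoveR => k.+1 | Stay => k end.

Lemma view_head l h r k F : view (l, h, r) k F -> F k = h.
Proof. by case=> _ /(_ 0); rewrite addn0. Qed.

Lemma view_mv l h r k F g d : (d = MoveL -> 0 < k) ->
  view (l, h, r) k F -> view (mv (l, h, r) g d) (mvpos k d) (upd F k g).
Proof.
move=> kd [Hl Hr]; rewrite /mv /upd; case: d kd => /= kd; split.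
- move=> i ik; rewrite nth_behead -Hl; last by lia.
  by rewrite ifN; [congr F; lia|apply/eqP; lia].
- have k0 := kd erefl.
  case=> [|[|i]] /=.
  + by rewrite ifN ?addn0 -?nth0 -?Hl ?subn0 //; apply/eqP; lia.
  + by rewrite ifT //; apply/eqP; lia.
  + rewrite ifN; last by apply/eqP; lia.
    by rewrite -[nth _ r i]/(nth blank (h :: r) i.+1) -Hr; congr F; lia.
- case=> [|i] ik /=; first by rewrite subn0 eqxx.
  by rewrite ifN -?Hl; [congr F; lia|lia|apply/eqP; lia].
- move=> i; rewrite ifN; last by apply/eqP; lia.
  have -> : k.+1 + i = k + i.+1 by lia.
  by rewrite Hr /=; case: i => [|i] /=; rewrite ?nth0 ?nth_behead.
- move=> i ik; rewrite ifN; last by apply/eqP; lia.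
  exact: Hl.
- case=> [|i] /=; first by rewrite addn0 eqxx.
  by rewrite ifN ?Hr //; apply/eqP; lia.
Qed.

(** Lists with different numbers of trailing blanks show the same tape; quantifying over all [tp]
    with the given view makes such blanks irrelevant when programs are chained. *)
Definition fruns p k F k' F' t :=
  forall tp, view tp k F -> exists tp', runs p tp tp' t /\ view tp' k' F'.

Lemma fruns_act w k F : ((w (F k)).2 = MoveL -> 0 < k) ->
  fruns (Act w) k F (mvpos k (w (F k)).2) (upd F k (w (F k)).1) 1.
Proof.
move=> H [[l h] r] V; exists (mv (l, h, r) (w h).1 (w h).2); split; first exact: runs_act.
by have E := view_head V; rewrite -E in V *; apply: view_mv.
Qed.

Lemma fruns_seq p q k F k1 F1 k2 F2 t u :
  fruns p k F k1 F1 t -> fruns q k1 F1 k2 F2 u -> fruns (Seq p q) k F k2 F2 (t + u).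
Proof.
move=> H1 H2 tp /H1[tp1 [R1 /H2[tp2 [R2 V2]]]].
by exists tp2; split=> //; apply: runs_seq R1 R2.
Qed.

Lemma fruns_if (P : pred G) p q k F k' F' t :
  fruns (if P (F k) then p else q) k F k' F' t -> fruns (If P p q) k F k' F' t.+1.
Proof.
move=> H [[l h] r] V; have [tp' [R V']] := H _ V; exists tp'; split=> //.
by apply: runs_if; rewrite (view_head V) in R.
Qed.

Lemma fruns_while_stop (P : pred G) p k F : ~~ P (F k) -> fruns (While P p) k F k F 1.
Proof.
move=> H [[l h] r] V; exists (l, h, r); split=> //.
by apply: runs_while_stop; rewrite -(view_head V).
Qed.

Lemma fruns_while_step (P : pred G) p k F k1 F1 k2 F2 t u : P (F k) ->
  fruns p k F k1 F1 t -> fruns (While P p) k1 F1 k2 F2 u ->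
  fruns (While P p) k F k2 F2 (t + u).+1.
Proof.
move=> HP H1 H2 [[l h] r] V; have [tp1 [R1 V1]] := H1 _ V; have [tp2 [R2 V2]] := H2 _ V1.
by exists tp2; split=> //; apply: runs_while_step R1 R2; rewrite -(view_head V).
Qed.

Definition prog_tm (bit : bool -> G) (p : prog) : TM := {|
  tm_Q := option (st p);
  tm_G := G;
  tm_blank := blank;
  tm_bit := bit;
  tm_start := Some (entry p);
  tm_halt := fun q => ~~ q;
  tm_delta := fun q g => if q is Some s then trans s g else (None, g, Stay) |}.

Lemma tm_step_mv (M : TM) q l h r : @tm_step M (q, (l, h, r)) =
  if @tm_halt M q then (q, (l, h, r)) else
  let: (q', g, d) := @tm_delta M q h in
  (q', match d with
  | Stay => (l, g, r)
  | MoveL => (behead l, head (@tm_blank M) l, g :: r)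
  | MoveR => (g :: l, head (@tm_blank M) r, behead r)
  end).
Proof. by rewrite /tm_step; case: tm_halt => //; case: tm_delta => [[q' g] []]. Qed.

Lemma exits_tm bit p (s : st p) tp t tp' : exits s tp t tp' ->
  iter t (@tm_step (prog_tm bit p)) (Some s, tp) = (None, tp').
Proof.
elim=> {s tp t tp'} [s l h r g d e|s l h r s' g d t tp' e _ IH].
  by rewrite /= /tm_step /= e; case: d e.
by rewrite iterSr tm_step_mv /= e; case: d e IH.
Qed.

Lemma iter_halted (M : TM) t (c : config M) : tm_halted c -> iter t (@tm_step M) c = c.
Proof.
move=> H; elim: t => //= t ->; move: H; case: c => q [[l h] r].
by rewrite /tm_halted /tm_step /= => ->.
Qed.

End Programs.

(** * Unary registers on tape tracks *)

Section Registers.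
Variable R : nat.

(* A cell carries one input bit, one output bit and, for every register, whether its
   index is below the value of the register; [None] is the wall left of cell 0. *)
Definition rsym : finType := option (option bool * option bool * {ffun 'I_R -> bool}).

Definition rblank : rsym := Some (None, None, [ffun => false]).

Definition getr (r : nat) (g : rsym) : bool :=
  if g is Some (_, f) then [exists i : 'I_R, (i == r :> nat) && f i] else false.

Definition setr (r : nat) (b : bool) (g : rsym) : rsym :=
  if g is Some (ao, f) then Some (ao, [ffun i : 'I_R => if i == r :> nat then b else f i])
  else None.

Definition geti (g : rsym) : option bool := if g is Some (a, _, _) then a else None.
Definition geto (g : rsym) : option bool := if g is Some (_, o, _) then o else None.
Definition seto (b : bool) (g : rsym) : rsym :=
  if g is Some (a, _, f) then Some (a, Some b, f) else None.
Definition out_cell (g : rsym) : rsym := Some (geto g, None, [ffun => false]).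

Definition enc (x o : seq bool) (v : nat -> nat) (k : nat) : rsym :=
  if k is i.+1 then Some (onth x i, onth o i, [ffun r : 'I_R => i < v r]) else None.

Lemma getr_enc r x o v i : r < R -> getr r (enc x o v i.+1) = (i < v r).
Proof.
move=> rR; apply/existsP/idP => [[j /andP[/eqP <-]]|H]; first by rewrite ffunE.
by exists (Ordinal rR); rewrite eqxx ffunE.
Qed.

Lemma enc_eq x o v v' i :
  (forall r, r < R -> (i < v r) = (i < v' r)) -> enc x o v i.+1 = enc x o v' i.+1.
Proof. by move=> H; congr (Some (_, _)); apply/ffunP=> r; rewrite !ffunE H. Qed.

Lemma setr_enc r b x o v v' i :
  (forall j, j < R -> (if j == r then b else i < v j) = (i < v' j)) ->
  setr r b (enc x o v i.+1) = enc x o v' i.+1.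
Proof. by move=> H; congr (Some (_, _)); apply/ffunP=> j; rewrite !ffunE H. Qed.

Local Notation fr := (@fruns rsym rblank).
Local Notation "p ;; q" := (Seq p q) (at level 60, right associativity).

Lemma upd_id (T : Type) (F : nat -> T) k : upd F k (F k) = F.
Proof. by apply: functional_extensionality => i; rewrite /upd; case: eqP => // ->. Qed.

(** The wall is the only place where [None] occurs, so the return to position 1 needs no counter. *)
Definition back : prog rsym := While isSome (Act (fun g => (g, MoveL))) ;; Act (fun g => (g, MoveR)).

Lemma fruns_back k (F : nat -> rsym) : F 0 = None -> (forall i, 0 < i <= k -> F i) ->
  fr back k F 1 F (k.*2).+2.
Proof.
move=> F0 FS; have -> : (k.*2).+2 = (k.*2).+1 + 1 by rewrite addn1.
apply: (@fruns_seq _ _ _ _ _ _ 0 F).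
  elim: k FS => [|k IH] FS; first by apply: fruns_while_stop; rewrite F0.
  rewrite doubleS; apply: (@fruns_while_step _ _ _ _ _ _ k F _ _ 1 (k.*2).+1).
  - by apply: FS; rewrite leqnn.
  - by have := @fruns_act _ rblank (fun g : rsym => (g, MoveL)) k.+1 F; rewrite /= upd_id; apply.
  - by apply: IH => i ik; apply: FS; lia.
by have := @fruns_act _ rblank (fun g : rsym => (g, MoveR)) 0 F; rewrite /= upd_id; apply.
Qed.

Definition sweep (P : pred rsym) (phi : rsym -> rsym) : prog rsym :=
  While P (Act (fun g => (phi g, MoveR))).

Lemma fruns_sweep (P : pred rsym) phi m k (F F' : nat -> rsym) :
  (forall i, i < m -> P (F (k + i)) /\ F' (k + i) = phi (F (k + i))) -> ~~ P (F (k + m)) ->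
  (forall i, i < k \/ k + m <= i -> F' i = F i) -> fr (sweep P phi) k F (k + m) F' (m.*2).+1.
Proof.
elim: m k F => [|m IH] k F HP HN HF.
  rewrite addn0 in HN *.
  have -> : F' = F by apply: functional_extensionality => i; apply: HF; lia.
  exact: fruns_while_stop.
have [P0 F'0] := HP 0 isT; rewrite addn0 in P0 F'0.
rewrite -addSnnS doubleS.
apply: (@fruns_while_step _ _ _ _ _ _ k.+1 (upd F k (phi (F k))) _ _ 1 (m.*2).+1) => //.
  exact: (@fruns_act _ rblank (fun g : rsym => (phi g, MoveR)) k F).
apply: IH => [i im||i Hi].
- by rewrite /upd ifN ?addSnnS; [apply: HP|apply/eqP; lia].
- by rewrite /upd ifN ?addSnnS //; apply/eqP; lia.
- by rewrite /upd; case: eqP => [->//|?]; apply: HF; lia.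
Qed.

(** Every register program starts and ends right of the wall, so such programs compose freely; [T]
    is only an upper bound on the time. *)
Definition hruns p F F' T := exists2 t, t <= T & fr p 1 F 1 F' t.

Lemma hruns_leq p F F' T T' : T <= T' -> hruns p F F' T -> hruns p F F' T'.
Proof. by move=> H [t tT]; exists t => //; apply: leq_trans H. Qed.

Lemma hruns_seq p q F1 F2 F3 T U :
  hruns p F1 F2 T -> hruns q F2 F3 U -> hruns (p ;; q) F1 F3 (T + U).
Proof.
by move=> [t tT H] [u uU K]; exists (t + u); [lia|apply: fruns_seq H K].
Qed.

Lemma hruns_if (P : pred rsym) p q (F F' : nat -> rsym) T :
  hruns (if P (F 1) then p else q) F F' T -> hruns (If P p q) F F' T.+1.
Proof. by move=> [t tT H]; exists t.+1 => //; apply: fruns_if. Qed.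

Lemma hruns_sweep (P : pred rsym) phi m p (F F1 F' : nat -> rsym) T :
  (forall i, i < m -> P (F i.+1) /\ F1 i.+1 = phi (F i.+1)) -> ~~ P (F m.+1) ->
  F1 0 = F 0 -> (forall i, m <= i -> F1 i.+1 = F i.+1) ->
  (exists2 t, t <= T & fr p m.+1 F1 1 F' t) ->
  hruns (sweep P phi ;; p) F F' ((m.*2).+1 + T).
Proof.
move=> HP HN H0 HF [t tT H]; exists ((m.*2).+1 + t); first by rewrite leq_add2l.
apply: fruns_seq H; rewrite -[m.+1]add1n; apply: fruns_sweep => //.
by case=> [|i] H //; apply: HF; lia.
Qed.

Definition inc r := sweep (getr r) id ;; Act (fun g => (setr r true g, Stay)) ;; back.
Definition dec r := sweep (getr r) id ;; Act (fun g => (g, MoveL)) ;;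
  Act (fun g => (setr r false g, Stay)) ;; back.
Definition clear r := sweep (getr r) (setr r false) ;; back.
Definition copy r d := sweep (getr r) (setr d true) ;; back.
(** One sweep over the larger of the two registers copies [r] to [d] and erases [r] at once. *)
Definition move r d :=
  sweep (fun g => getr r g || getr d g) (fun g => setr r false (setr d (getr r g) g)) ;; back.
Definition sizeto d := sweep (fun g => geti g != None) (setr d true) ;; back.
(** The sweep erases the index that led to the input bit. The bit then survives the way back only in
    the state, hence one copy of [back] in each branch. *)
Definition bitto d := sweep (getr d) (setr d false) ;;
  If (fun g => geti g == Some true) (back ;; Act (fun g => (setr d true g, Stay))) back.
Definition push b := sweep (fun g => geto g != None) id ;; Act (fun g => (seto b g, Stay)) ;; back.
(** Output must be written in the coding of the input, so the output track is moved to the input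
    track. *)
Definition finish := sweep (fun g => g != rblank) out_cell ;; back.
(** The machine starts on the first input symbol, which counts as position 1; the blank to its left
    becomes the wall. *)
Definition mkwall := Act (fun g : rsym => (g, MoveL)) ;; Act (fun _ => (None, MoveR)).

Lemma upd_enc x o v v' i m :
  (forall j, j <> i -> enc x o v j.+1 = enc x o v' j.+1) -> enc x o v' i.+1 = m ->
  upd (enc x o v) i.+1 m = enc x o v'.
Proof.
move=> H <-; apply: functional_extensionality; case=> [//|j].
by rewrite /upd eqSS; case: eqP => [->//|]; apply: H.
Qed.

Lemma back_enc m x o v : exists2 t, t <= (m.*2).+4 & fr back m.+1 (enc x o v) 1 (enc x o v) t.
Proof.
exists (m.+1.*2).+2; first by lia.
by apply: fruns_back => // -[|i].
Qed.

Lemma inc_runs r x o v : r < R ->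
  hruns (inc r) (enc x o v) (enc x o (upd v r (v r).+1)) (4 * v r + 6).
Proof.
move=> rR; apply: (@hruns_leq _ _ _ (((v r).*2).+1 + (1 + ((v r).*2).+4))); first by lia.
apply: hruns_sweep => [i ir|||i _|] //; rewrite ?getr_enc ?ltnn //.
have [t tT H] := back_enc (v r) x o (upd v r (v r).+1).
exists (1 + t); first by lia.
apply: fruns_seq H.
have := @fruns_act _ rblank (fun g => (setr r true g, Stay)) (v r).+1 (enc x o v).
rewrite (@upd_enc _ _ _ (upd v r (v r).+1)); first by apply.
- move=> j jr; apply: enc_eq => s _; rewrite /upd; case: eqP => [->|//]; lia.
- symmetry; apply: setr_enc => j _; rewrite /upd; case: eqP => // _; lia.
Qed.

Lemma dec_runs r x o v : r < R -> 0 < v r ->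
  hruns (dec r) (enc x o v) (enc x o (upd v r (v r).-1)) (4 * v r + 6).
Proof.
move=> rR v0; have [m vm] : exists m, v r = m.+1 by exists (v r).-1; lia.
apply: (@hruns_leq _ _ _ (((v r).*2).+1 + (1 + (1 + (m.*2).+4)))); first by lia.
apply: hruns_sweep => [i ir|||i _|] //; rewrite ?getr_enc ?ltnn //.
have [t tT H] := back_enc m x o (upd v r (v r).-1).
exists (1 + (1 + t)); first by lia.
apply: (@fruns_seq _ _ _ _ _ _ m.+1 (enc x o v)).
  have := @fruns_act _ rblank (fun g => (g, MoveL)) (v r).+1 (enc x o v).
  by rewrite /= upd_id vm; apply.
apply: fruns_seq H.
have := @fruns_act _ rblank (fun g => (setr r false g, Stay)) m.+1 (enc x o v).
rewrite (@upd_enc _ _ _ (upd v r (v r).-1)); first by apply.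
- move=> j jr; apply: enc_eq => s _; rewrite /upd; case: eqP => [->|//]; lia.
- symmetry; apply: setr_enc => j _; rewrite /upd; case: eqP => // _; lia.
Qed.

Lemma sweep_back_runs (P : pred rsym) phi m x o v v' :
  (forall i, i < m -> P (enc x o v i.+1) /\ enc x o v' i.+1 = phi (enc x o v i.+1)) ->
  ~~ P (enc x o v m.+1) ->
  (forall i r, m <= i -> r < R -> (i < v' r) = (i < v r)) ->
  hruns (sweep P phi ;; back) (enc x o v) (enc x o v') (4 * m + 6).
Proof.
move=> H1 H2 H3; apply: (@hruns_leq _ _ _ ((m.*2).+1 + (m.*2).+4)); first by lia.
apply: hruns_sweep (back_enc _ _ _ _) => // i im; apply: enc_eq => r; exact: H3.
Qed.

Lemma clear_runs r x o v : r < R ->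
  hruns (clear r) (enc x o v) (enc x o (upd v r 0)) (4 * v r + 6).
Proof.
move=> rR; apply: sweep_back_runs => [i ir||i s H _]; rewrite ?getr_enc ?ltnn //.
  by split=> //; symmetry; apply: setr_enc => j _; rewrite /upd; case: eqP.
rewrite /upd; case: eqP => // ->; lia.
Qed.

Lemma copy_runs r d x o v : r < R -> v d = 0 ->
  hruns (copy r d) (enc x o v) (enc x o (upd v d (v r))) (4 * v r + 6).
Proof.
move=> rR d0; apply: sweep_back_runs => [i ir||i s H _]; rewrite ?getr_enc ?ltnn //.
  by split=> //; symmetry; apply: setr_enc => j _; rewrite /upd; case: eqP => //; rewrite ir.
rewrite /upd; case: eqP => // ->; lia.
Qed.

Lemma move_runs r d x o v : r < R -> d < R -> r != d ->
  hruns (move r d) (enc x o v) (enc x o (upd (upd v d (v r)) r 0)) (4 * (v r + v d) + 6).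
Proof.
move=> rR dR /eqP rd.
have -> : 4 * (v r + v d) + 6 = 4 * maxn (v r) (v d) + 6 + 4 * minn (v r) (v d) by lia.
apply: hruns_leq (leq_addr _ _) _.
apply: sweep_back_runs => [i ir||i s H _]; rewrite ?getr_enc //; try lia.
  split; first by lia.
  symmetry; rewrite (@setr_enc _ _ _ _ _ (upd v d (v r))).
    apply: setr_enc => j _; rewrite /upd; case: eqP => // jr; case: eqP => //; lia.
  by move=> j _; rewrite /upd; case: eqP.
rewrite /upd; case: eqP => [->|jr]; first by lia.
by case: eqP => [->|//]; lia.
Qed.

Lemma sizeto_runs d x o v : v d = 0 ->
  hruns (sizeto d) (enc x o v) (enc x o (upd v d (size x))) (4 * size x + 6).
Proof.
move=> d0; apply: sweep_back_runs => [i ir||i s H _].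
- split; first by rewrite /= (onthE) (nth_map false).
  by symmetry; apply: setr_enc => j _; rewrite /upd; case: eqP => //; rewrite ir.
- by rewrite /= onthE nth_default // size_map.
- rewrite /upd; case: eqP => // ->; lia.
Qed.

Lemma bitto_runs d x o v : d < R ->
  hruns (bitto d) (enc x o v) (enc x o (upd v d (nth false x (v d)))) (4 * v d + 8).
Proof.
move=> dR; have -> : 4 * v d + 8 = ((v d).*2).+1 + (((v d).*2).+4 + 3) by lia.
apply: (@hruns_sweep _ _ _ _ _ (enc x o (upd v d 0))) => [i ir|||i id|] //; rewrite ?getr_enc ?ltnn //.
- by split=> //; symmetry; apply: setr_enc => j _; rewrite /upd; case: eqP.
- by apply: enc_eq => s _; rewrite /upd; case: eqP => // ->; lia.
have [t tT H] := back_enc (v d) x o (upd v d 0).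
have E : (onth x (v d) == Some true) = nth false x (v d).
  rewrite onthE; case: (ltnP (v d) (size x)) => L; last by rewrite !nth_default ?size_map.
  by rewrite (nth_map false) //; case: nth.
case B : (nth false x (v d)) E => E.
- exists (t + 1).+1; first by lia.
  apply: fruns_if; rewrite /= E; apply: fruns_seq H _.
  have := @fruns_act _ rblank (fun g => (setr d true g, Stay)) 1 (enc x o (upd v d 0)).
  rewrite (@upd_enc _ _ _ (upd v d 1)); first by apply.
  + move=> j j0; apply: enc_eq => s _; rewrite /upd; case: eqP => //; lia.
  + by symmetry; apply: setr_enc => j _; rewrite /upd; case: eqP.
- exists t.+1; first by lia.
  by apply: fruns_if; rewrite /= E.
Qed.

Lemma push_runs b x o v :
  hruns (push b) (enc x o v) (enc x (rcons o b) v) (4 * size o + 6).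
Proof.
apply: (@hruns_leq _ _ _ (((size o).*2).+1 + (1 + ((size o).*2).+4))); first by lia.
apply: hruns_sweep => [i ir|||i _|] //.
- by rewrite /= onthE (nth_map false).
- by rewrite /= onthE nth_default // size_map.
have [t tT H] := back_enc (size o) x (rcons o b) v.
exists (1 + t); first by lia.
apply: fruns_seq H.
have := @fruns_act _ rblank (fun g => (seto b g, Stay)) (size o).+1 (enc x o v).
rewrite (_ : upd _ _ _ = enc x (rcons o b) v); first by apply.
apply: functional_extensionality => -[//|i]; rewrite /upd eqSS /=.
have [-> | io] := eqVneq i (size o); congr (Some (_, _, _)); rewrite !onthE map_rcons nth_rcons size_map.
  by rewrite ltnn eqxx.
case: (ltngtP i (size o)) io => // io _.
by rewrite nth_default ?size_map // ltnW.
Qed.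

Lemma finish_runs x o v M : size x <= M -> size o <= M -> (forall r, v r = 0) ->
  hruns finish (enc x o v) (enc o [::] v) (4 * M + 6).
Proof.
move=> xM oM v0; set m := maxn (size x) (size o).
have H i : (onth x i == None) && (onth o i == None) = (m <= i).
  have E (s : seq bool) : (onth s i == None) = (size s <= i).
    rewrite onthE; case: leqP => L; first by rewrite nth_default ?size_map.
    by rewrite (nth_map false).
  by rewrite !E /m geq_max.
have Hb i : (enc x o v i.+1 == rblank) = (m <= i).
  rewrite -H /enc /rblank; apply/eqP/idP => [[-> -> //]|/andP[/eqP-> /eqP->]].
  by congr (Some (_, _)); apply/ffunP => r; rewrite !ffunE v0.
have Ho i : onth ([::] : seq bool) i = None by case: i.
have [t tT B] := back_enc m o [::] v.
apply: (@hruns_leq _ _ _ ((m.*2).+1 + (m.*2).+4)); first by rewrite /m; lia.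
apply: (@hruns_sweep _ _ m _ _ (enc o [::] v)) => [i im|||i im|] //; last by exists t.
- rewrite Hb -ltnNge; split=> //; rewrite /out_cell /= Ho; congr (Some (_, _)).
  by apply/ffunP => r; rewrite !ffunE v0.
- by rewrite Hb leqnn.
- move: (im); rewrite -H => /andP[/eqP a /eqP b]; rewrite /= a b Ho; congr (Some (_, _)).
Qed.

End Registers.

(** * Polynomial-time number functions *)

Arguments enc {R} x o v k.

(** The summand 2 keeps the base of all bounds at least 2, so that constants and sums are absorbed
    by a larger exponent. *)
Definition isz (x : seq bool) (e : seq nat) : nat := 2 + size x + sumn e.

Definition nfun := seq bool -> seq nat -> nat.

Definition bnd (f : nfun) := exists k, forall x e, f x e <= isz x e ^ k.

Lemma expn_mono a b k : a <= b -> a ^ k <= b ^ k.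
Proof. by case: k => // k; rewrite leq_exp2r. Qed.

Lemma leq_isz_pow x e a b : a <= b -> isz x e ^ a <= isz x e ^ b.
Proof. by move=> H; rewrite leq_exp2l. Qed.

Lemma bnd_leq (f g : nfun) : (forall x e, f x e <= g x e) -> bnd g -> bnd f.
Proof. by move=> H [k K]; exists k => x e; apply: leq_trans (H _ _) (K _ _). Qed.

Lemma bnd_isz : bnd isz. Proof. by exists 1 => x e; rewrite expn1. Qed.

Lemma bnd_const c : bnd (fun _ _ => c).
Proof.
by exists c => x e; apply: leq_trans (ltnW (ltn_expl c (isT : 1 < 2))) (expn_mono _ _).
Qed.

Lemma bnd_add f g : bnd f -> bnd g -> bnd (fun x e => f x e + g x e).
Proof.
move=> [a A] [b B]; exists (a + b).+1 => x e; rewrite expnS.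
have H1 := leq_trans (A x e) (leq_isz_pow x e (leq_addr b a)).
have H2 := leq_trans (B x e) (leq_isz_pow x e (leq_addl a b)).
apply: leq_trans (leq_add H1 H2) _; rewrite addnn -mul2n leq_mul2r.
by apply/orP; right; rewrite /isz; lia.
Qed.

Lemma bnd_mul f g : bnd f -> bnd g -> bnd (fun x e => f x e * g x e).
Proof. by move=> [a A] [b B]; exists (a + b) => x e; rewrite expnD leq_mul. Qed.

Lemma bnd_pow f k : bnd f -> bnd (fun x e => f x e ^ k).
Proof.
move=> H; elim: k => [|k IH]; first exact: bnd_const.
by apply: bnd_leq (bnd_mul H IH) => x e; rewrite expnS.
Qed.

Lemma bnd_let f h : bnd f -> bnd h -> bnd (fun x e => f x (h x e :: e)).
Proof.
move=> [k K] H; apply: (@bnd_leq _ (fun x e => (h x e + isz x e) ^ k)).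
  by move=> x e; apply: leq_trans (K _ _) _; rewrite /isz /= (addnCA _ (h x e)).
exact/bnd_pow/bnd_add/bnd_isz.
Qed.

Lemma bnd_behead f : bnd f -> bnd (fun x e => f x (behead e)).
Proof.
move=> [k K]; apply: (@bnd_leq _ (fun x e => isz x e ^ k)).
  move=> x e; apply: leq_trans (K _ _) _; apply: expn_mono.
  by rewrite leq_add2l; case: e => //= a e; apply: leq_addl.
exact/bnd_pow/bnd_isz.
Qed.

Ltac bnds := repeat first
  [ exact: bnd_const | exact: bnd_isz | assumption
  | apply: bnd_add | apply: bnd_mul | apply: bnd_pow | apply: bnd_let | apply: bnd_behead ].

(* Given that the registers from [d] on are empty, [p] stores in register [d] the value of [f] at
   the contents of the registers [rho], and empties its scratch registers. *)
Definition PF (f : nfun) : Prop := exists need (T : nfun),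
  [/\ bnd f, bnd T & forall R d rho, d + need <= R -> all (fun i => i < d) rho ->
    exists p : prog (rsym R), forall x o v, (forall j, d <= j -> v j = 0) ->
    hruns p (enc x o v) (enc x o (upd v d (f x (map v rho)))) (T x (map v rho))].

Definition PFb (P : seq bool -> seq nat -> bool) := PF (fun x e => P x e).

Lemma PF_ext f g : (forall x e, f x e = g x e) -> PF g -> PF f.
Proof.
move=> E [need [T [Hg HT H]]]; exists need, T; split=> //.
  by apply: bnd_leq Hg => x e; rewrite E.
move=> R d rho H1 H2; have [p Hp] := H R d rho H1 H2; exists p => x o v v0.
by rewrite E; apply: Hp.
Qed.

Lemma PF_bnd f : PF f -> bnd f. Proof. by case=> ? [? []]. Qed.

Lemma leq_nth_isz x e i : nth 0 e i <= isz x e.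
Proof.
rewrite /isz; elim: e i => [|a e IH] [|i] //=; first by lia.
by apply: leq_trans (IH i) _; lia.
Qed.

Lemma all_map_upd (v : nat -> nat) d n rho :
  all (fun i => i < d) rho -> map (upd v d n) rho = map v rho.
Proof.
move=> /allP H; apply/eq_in_map => i /H; rewrite /upd => id.
by rewrite ifN //; apply/eqP; lia.
Qed.

Lemma PF_nth i : PF (fun _ e => nth 0 e i).
Proof.
exists 1, (fun x e => 4 * isz x e + 6); split; last 1 first.
- move=> R d rho dR rd; case: (ltnP i (size rho)) => ir; last first.
    exists (clear R d) => x o v v0.
    rewrite nth_default ?size_map //.
    by apply: hruns_leq (clear_runs _ _ _ _); [rewrite v0 //; lia|lia].
  exists (copy R (nth 0 rho i) d) => x o v v0.
  rewrite (nth_map 0) //; apply: hruns_leq (copy_runs _ _ _ _) => //.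
  + by have := leq_nth_isz x (map v rho) i; rewrite (nth_map 0) //; lia.
  + have : nth 0 rho i < d by apply: (allP rd); apply: mem_nth.
    by lia.
  + exact: v0.
- apply: bnd_leq bnd_isz => x e; exact: leq_nth_isz.
- by bnds.
Qed.

Lemma PF_behead f : PF f -> PF (fun x e => f x (behead e)).
Proof.
move=> [need [T [Hf HT H]]]; exists need, (fun x e => T x (behead e)); split; [by bnds|by bnds|].
move=> R d rho dR rd; have [|p Hp] := H R d (behead rho) dR.
  by apply/allP => i /mem_behead; apply: (allP rd).
by exists p => x o v v0; have := Hp x o v v0; rewrite behead_map.
Qed.

(** Variables are stated with [head] and [behead] because this is the form in which nested binders
    leave them. *)
Lemma PF_var i : PF (fun _ e => head 0 (iter i behead e)).
Proof.
elim: i => [|i IH]; first by apply: PF_ext (PF_nth 0) => x e; rewrite nth0.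
by apply: PF_ext (PF_behead IH) => x e; rewrite iterSr.
Qed.

Lemma PF_size : PF (fun x _ => size x).
Proof.
exists 1, (fun x e => 4 * isz x e + 6); split; [|by bnds|].
  by apply: bnd_leq bnd_isz => x e; rewrite /isz; lia.
move=> R d rho dR rd; exists (sizeto R d) => x o v v0.
by apply: hruns_leq (sizeto_runs _ _ _ _); rewrite ?v0 // /isz; lia.
Qed.

Lemma PF_const0 : PF (fun _ _ => 0).
Proof.
exists 1, (fun x e => 6); split; [by bnds|by bnds|].
move=> R d rho dR rd; exists (clear R d) => x o v v0.
by apply: hruns_leq (clear_runs _ _ _ _); [rewrite v0 //; lia|lia].
Qed.

Lemma PF_succ f : PF f -> PF (fun x e => (f x e).+1).
Proof.
move=> [n1 [T1 [H1 B1 K1]]].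
exists n1.+1, (fun x e => T1 x e + (4 * f x e + 6)); split; [|by bnds|].
  apply: (@bnd_leq _ (fun x e => f x e + 1)); last by bnds.
  by move=> x e; rewrite addn1.
move=> R d rho dR rd; have [|p1 Hp1] := K1 R d rho _ rd; first by lia.
exists (Seq p1 (inc R d)) => x o v v0; apply: hruns_seq (Hp1 _ _ _ v0) _.
set u := upd v d _; have -> : f x (map v rho) = u d by rewrite /u /upd eqxx.
rewrite (_ : upd v d (u d).+1 = upd u d (u d).+1); first by apply: inc_runs; lia.
by apply: functional_extensionality => j; rewrite /u /upd; case: eqP.
Qed.

Lemma PF_bit f : PF f -> PFb (fun x e => nth false x (f x e)).
Proof.
move=> [n1 [T1 [H1 B1 K1]]].
exists n1.+1, (fun x e => T1 x e + (4 * f x e + 8)); split; [|by bnds|].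
  by apply: bnd_leq (bnd_const 1) => x e; case: nth.
move=> R d rho dR rd; have [|p1 Hp1] := K1 R d rho _ rd; first by lia.
exists (Seq p1 (bitto R d)) => x o v v0; apply: hruns_seq (Hp1 _ _ _ v0) _.
set u := upd v d _; have -> : f x (map v rho) = u d by rewrite /u /upd eqxx.
rewrite (_ : upd v d (nth false x (u d)) = upd u d (nth false x (u d))); first by apply: bitto_runs; lia.
by apply: functional_extensionality => j; rewrite /u /upd; case: eqP.
Qed.

Lemma loop_runs R r (body : prog (rsym R)) n T (F : nat -> nat -> rsym R) :
  (forall i, i < n -> getr r (F i 1) /\ hruns body (F i) (F i.+1) T) -> ~~ getr r (F n 1) ->
  hruns (While (getr r) body) (F 0) (F n) (n * T.+1 + 1).
Proof.
elim: n F => [|n IH] F H HN; first by exists 1 => //; apply: fruns_while_stop.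
have [G0 [t tT Ht]] := H 0 isT.
have [|//|u uT Hu] := IH (fun i => F i.+1).
  by move=> i ni; apply: H.
exists (t + u).+1; last exact: fruns_while_step G0 Ht Hu.
by rewrite mulSn; lia.
Qed.

Definition prec (n z s : nfun) : nfun := fun x e =>
  iteri (n x e) (fun i a => s x (i :: a :: e)) (z x e).

(** Iterating a polynomially bounded step may grow exponentially; the polynomial bound [A] on all
    intermediate values prevents this, as in bounded recursion. *)
Lemma PF_rec n z s A : PF n -> PF z -> PF s -> bnd A ->
  (forall x e i, i <= n x e -> iteri i (fun i a => s x (i :: a :: e)) (z x e) <= A x e) ->
  PF (prec n z s).
Proof.
move=> [n1 [T1 [H1 B1 K1]]] [n2 [T2 [H2 B2 K2]]] [n3 [T3 [H3 B3 K3]]] HA HP.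
have [k HT3] := B3.
pose TT := fun x e => (n x e + A x e + isz x e) ^ k +
  ((4 * A x e + 6) + ((4 * (A x e + A x e) + 6) + ((4 * n x e + 6) + (4 * n x e + 6)))).
exists (n1 + n2 + n3 + 4), (fun x e => T1 x e + (T2 x e + ((n x e * (TT x e + 1) + 1) +
   ((4 * n x e + 6) + (4 * (A x e) + 6))))).
have bTT : bnd TT by rewrite /TT; bnds.
split; [by apply: bnd_leq HA => x e; apply: HP|by bnds|].
move=> R d rho dR rd; have [|p1 Hp1] := K1 R d rho _ rd; first by lia.
have [||p2 Hp2] := K2 R d.+1 rho; [by lia|by apply: sub_all rd => i; lia|].
have [||p3 Hp3] := K3 R d.+3 [:: d.+2, d.+1 & rho]; first by lia.
  by rewrite /= !ltnS !leqnn leqnSn /=; apply: sub_all rd => i; lia.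
(* Register [d] counts the remaining rounds, [d.+1] holds the accumulator, [d.+2] the index, and
   [d.+3] the new value until it replaces the accumulator. *)
exists (Seq p1 (Seq p2 (Seq (While (getr d) (Seq p3 (Seq (clear R d.+1)
  (Seq (move R d.+3 d.+1) (Seq (inc R d.+2) (dec R d))))))
  (Seq (clear R d.+2) (move R d.+1 d))))) => x o v v0.
set e := map v rho.
pose acc i := iteri i (fun i a => s x (i :: a :: e)) (z x e).
have accS i : acc i.+1 = s x [:: i, acc i & e] by [].
pose I i j := if j == d then n x e - i else if j == d.+1 then acc i
              else if j == d.+2 then i else v j.
have mapI i : map (I i) rho = e.
  apply/eq_in_map => j /(allP rd) jd; rewrite /I !ifN //; apply/eqP; lia.
apply: hruns_seq (Hp1 _ _ _ v0) _.
apply: (@hruns_seq _ _ _ _ (enc x o (I 0))).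
  have := Hp2 x o (upd v d (n x e)); rewrite all_map_upd // -/e.
  rewrite (_ : upd (upd v d (n x e)) d.+1 (z x e) = I 0).
    by apply => j dj; rewrite /upd ifN ?v0 //; [lia|apply/eqP; lia].
  apply: functional_extensionality => j; rewrite /upd /I subn0.
  do ! case: eqP => ? //; try lia.
  by rewrite v0 //; lia.
apply: (@hruns_seq _ _ _ _ (enc x o (I (n x e)))).
  have -> : TT x e + 1 = (TT x e).+1 by rewrite addn1.
  apply: (@loop_runs _ _ _ _ _ (fun i => enc x o (I i))); last first.
    by rewrite getr_enc ?/I ?eqxx ?subnn //; lia.
  move=> i ni; rewrite getr_enc; last by lia.
  split; first by rewrite /I eqxx; lia.
  rewrite /TT; have Ai : acc i <= A x e by apply: HP (ltnW ni).
  have AiS : acc i.+1 <= A x e by apply: HP ni.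
  apply: (@hruns_seq _ _ _ _ (enc x o (upd (I i) d.+3 (acc i.+1)))).
    have := Hp3 x o (I i); rewrite /= mapI.
    have -> : I i d.+2 = i by rewrite /I !eqxx !ifN //; apply/eqP; lia.
    have -> : I i d.+1 = acc i by rewrite /I !eqxx !ifN //; apply/eqP; lia.
    move=> H; apply: hruns_leq (H _).
      apply: leq_trans (HT3 _ _) _; apply: expn_mono; rewrite /isz /=; lia.
    by move=> j dj; rewrite /I !ifN ?v0 //; [lia|apply/eqP; lia..].
  apply: (@hruns_seq _ _ _ _ (enc x o (upd (upd (I i) d.+3 (acc i.+1)) d.+1 0))).
    apply: hruns_leq (clear_runs _ _ _ _); last by lia.
    by rewrite /upd ifN /I ?eqxx ?ifN //; [lia|apply/eqP; lia..].
  apply: (@hruns_seq _ _ _ _ (enc x o (upd (I i) d.+1 (acc i.+1)))).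
    set u := upd _ d.+1 0.
    have u3 : u d.+3 = acc i.+1 by rewrite /u /upd eqxx ifN //; apply/eqP; lia.
    have u1 : u d.+1 = 0 by rewrite /u /upd eqxx.
    have := @move_runs R d.+3 d.+1 x o u; rewrite u1 u3.
    rewrite (_ : upd (upd u _ _) _ _ = upd (I i) d.+1 (acc i.+1)).
      by move=> H; apply: hruns_leq (H _ _ _); [lia..|apply/eqP; lia].
    apply: functional_extensionality => j; rewrite /u /upd /I.
    do ! case: eqP => ? //; try lia.
    by rewrite v0 //; lia.
  set u := upd (I i) d.+1 (acc i.+1).
  have u2 : u d.+2 = i by rewrite /u /upd /I; do ! case: eqP => ? //; lia.
  have u0 : upd u d.+2 i.+1 d = n x e - i by rewrite /u /upd /I; do ! case: eqP => ? //; lia.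
  apply: (@hruns_seq _ _ _ _ (enc x o (upd u d.+2 i.+1))).
    have := @inc_runs R d.+2 x o u; rewrite u2 => H; apply: hruns_leq (H _); lia.
  have := @dec_runs R d x o (upd u d.+2 i.+1); rewrite u0.
  rewrite (_ : upd (upd u d.+2 i.+1) d _ = I i.+1).
    by move=> H; apply: hruns_leq (H _ _); lia.
  apply: functional_extensionality => j; rewrite /u /upd /I.
  do ! case: eqP => ? //; lia.
have AN : acc (n x e) <= A x e by apply: HP.
apply: (@hruns_seq _ _ _ _ (enc x o (upd (I (n x e)) d.+2 0))).
  have := @clear_runs R d.+2 x o (I (n x e)).
  have -> : I (n x e) d.+2 = n x e by rewrite /I !eqxx !ifN //; apply/eqP; lia.
  by apply; lia.
set u := upd _ d.+2 0.
have u1 : u d.+1 = acc (n x e) by rewrite /u /upd /I; do ! case: eqP => ? //; lia.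
have u0 : u d = 0 by rewrite /u /upd /I subnn; do ! case: eqP => ? //; lia.
have := @move_runs R d.+1 d x o u; rewrite u1 u0.
rewrite (_ : upd (upd u _ _) _ _ = upd v d (prec n z s x e)).
  by move=> H; apply: hruns_leq (H _ _ _); [lia..|apply/eqP; lia].
apply: functional_extensionality => j; rewrite /u /upd /I.
do ! case: eqP => ? //; try lia.
- by rewrite v0 //; lia.
- by rewrite v0 //; lia.
Qed.

(** The step of a recursion sees the index, the accumulator and the environment; this removes the
    accumulator for predicates that do not depend on it. *)
Lemma PF_sel f : PF f -> PF (fun x e => f x (head 0 e :: behead (behead e))).
Proof.
move=> [n1 [T1 [H1 B1 K1]]].
have bs g : bnd g -> bnd (fun x e => g x (head 0 e :: behead (behead e))).
  move=> [k K]; apply: (@bnd_leq _ (fun x e => isz x e ^ k)); last by bnds.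
  move=> x e; apply: leq_trans (K _ _) _; apply: expn_mono.
  by rewrite leq_add2l; case: e => [|a [|b e]] //=; lia.
exists n1.+2, (fun x e => T1 x (head 0 e :: behead (behead e)) +
   (4 * f x (head 0 e :: behead (behead e)) + 6)); split; [exact: bs| |].
  apply: bnd_add; first exact: bs.
  by apply: bnd_add; [apply: bnd_mul; [exact: bnd_const|exact: bs]|exact: bnd_const].
move=> R d rho dR rd; have [||p Hp] := K1 R d.+1 (head d rho :: behead (behead rho)).
- by lia.
- case: rho rd => [|a [|b rho]] /=; rewrite ?ltnSn // => /andP[ad]; first by rewrite ltnS ltnW.
  by move=> /andP[_ rd]; rewrite ltnS ltnW //=; apply: sub_all rd => i; lia.
exists (Seq p (move R d.+1 d)) => x o v v0.
set e' := _ :: _.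
have E : map v (head d rho :: behead (behead rho)) = e'.
  by rewrite /e' !behead_map /=; congr cons; case: (rho) => //=; exact: v0.
have := Hp x o v; rewrite E => H.
apply: hruns_seq (H _) _; first by move=> j dj; apply: v0; lia.
set u := upd v d.+1 _.
have u1 : u d.+1 = f x e' by rewrite /u /upd eqxx.
have u0 : u d = 0 by rewrite /u /upd; case: eqP => [|_]; [lia|exact: v0].
have := @move_runs R d.+1 d x o u; rewrite u1 u0 addn0.
rewrite (_ : upd (upd u _ _) _ _ = upd v d (f x e')).
  by apply; rewrite ?neq_ltn ?ltnSn ?orbT //; lia.
apply: functional_extensionality => j; rewrite /u /upd.
do ! case: eqP => ? //; try lia.
by rewrite v0 //; lia.
Qed.

(** * Closure properties of polynomial-time number functions *)

Definition rbit R (b : bool) : rsym R := Some (Some b, None, [ffun => false]).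

Lemma enc0_bit R x i :
  @enc R x [::] (fun=> 0) i.+1 = if onth x i is Some b then rbit R b else rblank R.
Proof. by rewrite /= onth0n; case: onth => [b|]; congr (Some (_, _)); apply/ffunP => r; rewrite !ffunE. Qed.

Lemma read_bits_enc R p (s : seq (rsym R)) o :
  (forall i, nth (rblank R) s i = enc o [::] (fun=> 0) i.+1) ->
  @read_bits (prog_tm (rblank R) (@rbit R) p) s = o.
Proof.
elim: s o => [|g s IH] o H.
  by case: o H => // b o /(_ 0); rewrite enc0_bit.
have /= := H 0; rewrite -/(enc o [::] (fun=> 0) 1) enc0_bit.
case: o H => [|b o] H /= ->; first by [].
have -> : tm_decode (rbit R b : tm_G (prog_tm (rblank R) (@rbit R) p)) = Some b.
  by case: b {H} => //; rewrite /tm_decode /= eqxx.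
by congr cons; apply: IH => i; have := H i.+1; rewrite !enc0_bit.
Qed.

Lemma mkwall_runs R x tp : view (rblank R) tp 1 (fun k => if k is i.+1 then enc x [::] (fun=> 0) k else rblank R) ->
  exists tp', runs (rblank R) (mkwall R) tp tp' 2 /\ view (rblank R) tp' 1 (enc x [::] (fun=> 0)).
Proof.
set F := fun k => _.
suff H : fruns (rblank R) (mkwall R) 1 F 1 (enc x [::] (fun=> 0)) 2 by apply: H.
have H1 := @fruns_act _ (rblank R) (fun g => (g, MoveL)) 1 F (fun _ => isT).
have H2 := @fruns_act _ (rblank R) (fun=> (None, MoveR)) 0 (upd F 1 (F 1)).
have := fruns_seq H1 (H2 _); rewrite /= upd_id.
rewrite (_ : upd F 0 None = enc x [::] (fun=> 0)); first by apply.
by apply: functional_extensionality; case.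
Qed.

Lemma bnd_poly f : bnd f -> exists c k, forall x, f x [::] <= c * size x ^ k + c.
Proof.
case=> k H; exists (3 ^ k), k => x; apply: leq_trans (H x [::]) _; rewrite /isz /= addn0.
(* For positive length [2 + size x <= 3 * size x]; the empty input is covered by the additive
   constant. *)
case: (posnP (size x)) => [->|n0].
  by apply: leq_trans (leq_addl _ _); apply: expn_mono.
by apply: leq_trans (leq_addr _ _); rewrite -expnMn; apply: expn_mono; lia.
Qed.

(** Each output bit is recomputed from its index alone, so a polynomial-time function on strings may
    be given by a length and a predicate. *)
Theorem PF_output len bit : PF len -> PFb bit ->
  poly_time_computable (fun x => mkseq (fun i => bit x [:: i]) (len x [::])).
Proof.
move=> [n1 [T1 [H1 B1 K1]]] [n2 [T2 [_ B2 K2]]]; have [k Hk] := B2.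
pose R := (n1 + n2).+3.
have [||p1 Hp1] := K1 R 0 [::] => //; first by rewrite /R; lia.
have [||p2 Hp2] := K2 R 2 [:: 1] => //; first by rewrite /R; lia.
(* Register 0 counts the bits still to be written, register 1 is the index of the current bit and
   register 2 its value. *)
pose body := Seq p2 (Seq (If (getr 2) (Seq (clear R 2) (push R true)) (push R false))
   (Seq (inc R 1) (dec R 0))).
pose p := Seq (mkwall R) (Seq p1 (Seq (While (getr 0) body) (Seq (clear R 1) (finish R)))).
pose TB x e := (len x e + isz x e) ^ k + ((10 + (4 * len x e + 6) + 1) + ((4 * len x e + 6) + (4 * len x e + 6))).
pose T x e := 2 + (T1 x e + ((len x e * (TB x e + 1) + 1) + ((4 * len x e + 6) + (4 * (len x e + isz x e) + 6)))).
have bT : bnd T by rewrite /T /TB; bnds.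
have [c [k' Hc]] := bnd_poly bT.
exists (prog_tm (rblank R) (@rbit R) p), c, k' => x.
set o := mkseq _ _; pose n := len x [::].
pose I i j := if j == 0 then n - i else if j == 1 then i else 0.
pose F i := @enc R x (mkseq (fun i => bit x [:: i]) i) (I i).
have mainH : hruns (Seq p1 (Seq (While (getr 0) body) (Seq (clear R 1) (finish R))))
    (@enc R x [::] (fun=> 0)) (@enc R o [::] (fun=> 0)) (T x [::] - 2).
  rewrite /T addKn; apply: (@hruns_seq _ _ _ _ (F 0)).
    rewrite (_ : F 0 = enc x [::] (upd (fun=> 0) 0 n)); first exact: Hp1.
    congr enc; apply: functional_extensionality => j; rewrite /I /upd.
    by case: eqP => _; [rewrite subn0|case: eqP].
  apply: (@hruns_seq _ _ _ _ (F n)).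
    have -> : TB x [::] + 1 = (TB x [::]).+1 by rewrite addn1.
    apply: loop_runs; last by rewrite getr_enc // /I subnn.
    move=> i ni; rewrite getr_enc // /I /= subn_gt0; split=> //.
    have I1 : map (I i) [:: 1] = [:: i] by [].
    pose b := bit x [:: i]; pose oi := mkseq (fun i => bit x [:: i]) i.
    apply: (@hruns_seq _ _ _ _ (enc x oi (upd (I i) 2 b))).
      have := Hp2 x oi (I i); rewrite I1 => H; apply: hruns_leq (H _); last by case=> [|[|j]].
      apply: leq_trans (Hk _ _) _; apply: expn_mono; rewrite /isz /=; lia.
    apply: (@hruns_seq _ _ _ _ (enc x (rcons oi b) (I i))).
      rewrite addn1; apply: hruns_if; rewrite getr_enc // {1}/upd eqxx.
      have E : upd (upd (I i) 2 b) 2 0 = I i.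
        by apply: functional_extensionality => j; rewrite /upd; case: eqP => // ->.
      have Es : size oi = i by rewrite size_mkseq.
      have := @push_runs R b x oi (I i); rewrite Es => PR.
      case: b E PR => E PR.
        apply: (@hruns_seq _ _ _ _ (enc x oi (I i))); last by apply: hruns_leq PR; lia.
        by have := @clear_runs R 2 x oi (upd (I i) 2 true) erefl; rewrite E.
      rewrite (_ : upd (I i) 2 false = I i); first by apply: hruns_leq PR; lia.
      by apply: functional_extensionality => j; rewrite /upd; case: eqP => // ->.
    rewrite -/(F i.+1) (_ : F i.+1 = enc x (rcons oi b) (upd (upd (I i) 1 i.+1) 0 (n - i).-1)); last first.
      rewrite /F /oi mkseqS; congr enc; apply: functional_extensionality => j.
      by rewrite /upd /I; do ! case: eqP => ? //; lia.
    apply: (@hruns_seq _ _ _ _ (enc x (rcons oi b) (upd (I i) 1 i.+1))).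
      by have := @inc_runs R 1 x (rcons oi b) (I i) erefl; apply: hruns_leq; rewrite /I /=; lia.
    have := @dec_runs R 0 x (rcons oi b) (upd (I i) 1 i.+1) erefl.
    have -> : upd (I i) 1 i.+1 0 = n - i by [].
    by move=> H; apply: hruns_leq (H _); rewrite -/n; lia.
  apply: (@hruns_seq _ _ _ _ (enc x o (fun=> 0))).
    rewrite (_ : (fun=> 0) = upd (I n) 1 0); first exact: clear_runs.
    by apply: functional_extensionality => j; rewrite /upd /I subnn; do ! case: eqP.
  apply: finish_runs => //; last by rewrite size_mkseq; lia.
  by rewrite /isz; lia.
have [t tT Hr] := mainH.
have V0 : view (rblank R) ([::], head (rblank R) (map (@rbit R) x), behead (map (@rbit R) x)) 1
   (fun k => if k is i.+1 then enc x [::] (fun=> 0) k else rblank R).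
  split=> [[|i]//|i]; rewrite add1n enc0_bit.
  case: x {mainH Hr Hc tT o n I F} => [|a x]; first by case: i => [|[|i]].
  rewrite -[X in nth _ X]/(map (@rbit R) (a :: x)) onthE.
  case: (ltnP i (size (a :: x))) => ix; first by rewrite !(nth_map false).
  by rewrite !nth_default ?size_map.
have [tp1 [R1 V1]] := mkwall_runs V0; have [tp2 [R2 V2]] := Hr _ V1.
have RR := exits_tm (@rbit R) (runs_seq R1 R2).
have E : tm_run (prog_tm (rblank R) (@rbit R) p) (c * size x ^ k' + c) x = (None, tp2).
  have TL : 2 + t <= c * size x ^ k' + c.
    by apply: leq_trans (Hc x); rewrite -(@subnKC 2 (T x [::])) ?leq_add2l // /T leq_addr.
  by rewrite /tm_run -(subnK TL) iterD [iter (2 + t) _ _]RR iter_halted.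
rewrite /= E; split=> //; case: tp2 {R2 E RR} V2 => [[l h] r] [_ V2].
by apply: read_bits_enc => i; rewrite -V2 add1n.
Qed.

Lemma PF_const c : PF (fun _ _ => c).
Proof. by elim: c => [|c IH]; [exact: PF_const0|exact: PF_succ]. Qed.

Lemma PFb_const (b : bool) : PFb (fun _ _ => b). Proof. exact: PF_const. Qed.

Lemma PF_add f g : PF f -> PF g -> PF (fun x e => f x e + g x e).
Proof.
move=> Hf Hg; apply: (@PF_ext _ (prec f g (fun x e => (head 0 (behead e)).+1))).
  by move=> x e; rewrite /prec /=; elim: (f x e) => //= n <-.
apply: (@PF_rec _ _ _ (fun x e => f x e + g x e)) => //.
- exact/PF_succ/(PF_var 1).
- by apply: bnd_add; apply: PF_bnd.
- move=> x e i /= H; apply: (@leq_trans (i + g x e)); last by rewrite leq_add2r.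
  by elim: i {H} => //= i IH; rewrite addSn ltnS.
Qed.

Lemma PF_pred f : PF f -> PF (fun x e => (f x e).-1).
Proof.
move=> Hf; apply: (@PF_ext _ (prec f (fun _ _ => 0) (fun x e => head 0 e))).
  by move=> x e; rewrite /prec /=; case: (f x e).
apply: (@PF_rec _ _ _ f) => //; [exact: PF_const|exact: (PF_var 0)|exact: PF_bnd|].
by move=> x e [|i] //= /ltnW.
Qed.

Lemma PF_sub f g : PF f -> PF g -> PF (fun x e => f x e - g x e).
Proof.
move=> Hf Hg; apply: (@PF_ext _ (prec g f (fun x e => (head 0 (behead e)).-1))).
  by move=> x e; rewrite /prec /=; elim: (g x e) => /= [|n <-]; rewrite ?subn0 ?subnS.
apply: (@PF_rec _ _ _ f) => //; [exact/PF_pred/(PF_var 1)|exact: PF_bnd|].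
by move=> x e i _; elim: i => //= i; apply: leq_trans; rewrite leq_pred.
Qed.

Lemma PF_mul f g : PF f -> PF g -> PF (fun x e => f x e * g x e).
Proof.
move=> Hf Hg; apply: (@PF_ext _ (prec f (fun _ _ => 0)
    (fun x e => g x (behead (behead e)) + head 0 (behead e)))).
  by move=> x e; rewrite /prec /=; elim: (f x e) => //= n <-; rewrite mulSn.
apply: (@PF_rec _ _ _ (fun x e => f x e * g x e)) => //; first exact: PF_const.
- by apply: PF_add; [exact: (PF_behead (PF_behead Hg))|exact: (PF_var 1)].
- by apply: bnd_mul; apply: PF_bnd.
- move=> x e i /= H; apply: (@leq_trans (i * g x e)); last by rewrite leq_mul2r H orbT.
  by elim: i {H} => //= i IH; rewrite mulSn leq_add2l.
Qed.

Lemma PF_is0 f : PF f -> PFb (fun x e => f x e == 0).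
Proof.
move=> Hf; apply: (@PF_ext _ (prec f (fun _ _ => 1) (fun x e => 0))).
  by move=> x e; rewrite /prec /=; case: (f x e).
apply: (@PF_rec _ _ _ (fun _ _ => 1)) => //; try exact: PF_const; first exact: bnd_const.
by move=> x e [|i].
Qed.

Lemma PFb_ext P Q : (forall x e, P x e = Q x e) -> PFb Q -> PFb P.
Proof. by move=> H; apply: PF_ext => x e; rewrite H. Qed.

Lemma PFb_not P : PFb P -> PFb (fun x e => ~~ P x e).
Proof. by move=> H; apply: PFb_ext (PF_is0 H) => x e; case: (P x e). Qed.

Lemma PFb_and P Q : PFb P -> PFb Q -> PFb (fun x e => P x e && Q x e).
Proof. by move=> H K; apply: PF_ext (PF_mul H K) => x e; case: (P x e); case: (Q x e). Qed.

Lemma PFb_or P Q : PFb P -> PFb Q -> PFb (fun x e => P x e || Q x e).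
Proof.
move=> H K; apply: PFb_ext (PFb_not (PFb_and (PFb_not H) (PFb_not K))) => x e.
by rewrite negb_and !negbK.
Qed.

Lemma PFb_leq f g : PF f -> PF g -> PFb (fun x e => f x e <= g x e).
Proof. by move=> H K; apply: PFb_ext (PF_is0 (PF_sub H K)). Qed.

Lemma PFb_eq f g : PF f -> PF g -> PFb (fun x e => f x e == g x e).
Proof.
by move=> H K; apply: PFb_ext (PFb_and (PFb_leq H K) (PFb_leq K H)) => x e; rewrite eqn_leq.
Qed.

Lemma PF_if P f g : PFb P -> PF f -> PF g -> PF (fun x e => if P x e then f x e else g x e).
Proof.
move=> HP Hf Hg; apply: (@PF_ext _ (prec P g (fun x e => f x (behead (behead e))))).
  by move=> x e; rewrite /prec /=; case: (P x e).
apply: (@PF_rec _ _ _ (fun x e => f x e + g x e)) => //.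
- exact: (PF_behead (PF_behead Hf)).
- by apply: bnd_add; apply: PF_bnd.
- by move=> x e [|i] _ /=; rewrite ?leq_addr ?leq_addl.
Qed.

Lemma PFb_if P Q R : PFb P -> PFb Q -> PFb R ->
  PFb (fun x e => if P x e then Q x e else R x e).
Proof. by move=> H K L; apply: PF_ext (PF_if H K L) => x e; case: (P x e). Qed.

Lemma iotaSr m : iota 0 m.+1 = rcons (iota 0 m) m.
Proof. by rewrite -addn1 iotaD cats1. Qed.

Lemma PFb_has (P : seq bool -> nat -> seq nat -> bool) n :
  PF n -> PFb (fun x e => P x (head 0 e) (behead e)) ->
  PFb (fun x e => has (fun i => P x i e) (iota 0 (n x e))).
Proof.
move=> Hn HP; apply: (@PF_ext _ (prec n (fun _ _ => 0)
   (fun x e => (head 0 (behead e) != 0) || P x (head 0 e) (behead (behead e))))).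
  move=> x e; rewrite /prec; elim: (n x e) => [//|m IH].
  by rewrite iotaSr has_rcons orbC [iteri _ _ _]/= -IH; case: has.
apply: (@PF_rec _ _ _ (fun _ _ => 1)) => //; [exact: PF_const| |exact: bnd_const|].
- apply: PFb_or; first exact/PFb_not/PF_is0/(PF_var 1).
  exact: (PF_sel HP).
- by move=> x e [|i] //= _; case: (_ || _).
Qed.

Lemma PFb_all (P : seq bool -> nat -> seq nat -> bool) n :
  PF n -> PFb (fun x e => P x (head 0 e) (behead e)) ->
  PFb (fun x e => all (fun i => P x i e) (iota 0 (n x e))).
Proof.
move=> Hn HP.
apply: PFb_ext (PFb_not (PFb_has (P := fun x i e => ~~ P x i e) Hn (PFb_not HP))) => x e.
by rewrite -all_predC; apply: eq_all => i /=; rewrite negbK.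
Qed.

Lemma PF_iter (s : seq bool -> nat -> seq nat -> nat) n z A : PF n -> PF z ->
  PF (fun x e => s x (head 0 e) (behead e)) -> bnd A ->
  (forall x e i, i <= n x e -> iter i (fun a => s x a e) (z x e) <= A x e) ->
  PF (fun x e => iter (n x e) (fun a => s x a e) (z x e)).
Proof.
move=> Hn Hz Hs HA HP.
have E x e i : iteri i (fun _ a => s x a e) (z x e) = iter i (fun a => s x a e) (z x e).
  by elim: i => //= i ->.
apply: (@PF_ext _ (prec n z (fun x e => s x (head 0 (behead e)) (behead (behead e))))).
  by move=> x e; rewrite -E.
apply: (PF_rec Hn Hz (PF_behead Hs) HA) => x e i /= H.
by rewrite E; apply: HP.
Qed.

(** The accumulator keeps pace with the loop index until the first hit and then stays behind for
    good. *)
Lemma PF_find (P : seq bool -> nat -> seq nat -> bool) n :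
  PF n -> PFb (fun x e => P x (head 0 e) (behead e)) ->
  PF (fun x e => find (fun i => P x i e) (iota 0 (n x e))).
Proof.
move=> Hn HP.
have E x e i : iteri i (fun j a => if (a == j) && ~~ P x j e then a.+1 else a) 0 =
    find (fun i => P x i e) (iota 0 i).
  elim: i => [//|i IH]; rewrite iotaSr -cats1 find_cat size_iota [iteri _ _ _]/= IH.
  have [H|/hasNfind ->] := boolP (has _ _); last by rewrite size_iota eqxx /=; case: (P x i e) => /=; lia.
  by rewrite ifN // negb_and ltn_eqF //; move: H; rewrite has_find size_iota.
apply: (@PF_ext _ (prec n (fun _ _ => 0) (fun x e =>
   if (head 0 (behead e) == head 0 e) && ~~ P x (head 0 e) (behead (behead e))
   then (head 0 (behead e)).+1 else head 0 (behead e)))).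
  by move=> x e; rewrite -E.
apply: (PF_rec Hn (PF_const 0) _ (PF_bnd Hn)) => [|x e i /= H].
  apply: PF_if; [|exact/PF_succ/(PF_var 1)|exact: (PF_var 1)].
  apply: PFb_and; first exact: (PFb_eq (PF_var 1) (PF_var 0)).
  exact: PFb_not (PF_sel HP).
by rewrite E; apply: leq_trans (find_size _ _) _; rewrite size_iota.
Qed.

Lemma PF_divn f g : PF f -> PF g -> PF (fun x e => f x e %/ g x e).
Proof.
move=> Hf Hg; apply: (@PF_ext _ (fun x e => if g x e == 0 then 0 else
    find (fun q => f x e < q.+1 * g x e) (iota 0 (f x e)))).
  move=> x e; have [-> | g0] := eqVneq (g x e) 0; first by rewrite divn0.
  set a := f x e; set b := g x e in g0 *; have b0 : 0 < b by rewrite lt0n.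
  have [a0|a0] := posnP a; first by rewrite a0 div0n.
  have Q q : (a < q.+1 * b) = (a %/ b <= q) by rewrite -ltn_divLR // ltnS.
  rewrite (eq_find Q).
  case: (ltnP (a %/ b) a) => L.
    have -> : iota 0 a = iota 0 (a %/ b) ++ iota (a %/ b) (a - a %/ b).
      by rewrite -{2}[a %/ b]add0n -iotaD subnKC // ltnW.
    rewrite find_cat size_iota.
    rewrite ifN; last first.
      by apply/hasPn => q; rewrite mem_iota add0n /= => H; rewrite -ltnNge.
    have -> : a - a %/ b = (a - a %/ b).-1.+1 by lia.
    by rewrite /= leqnn addn0.
  have -> : a %/ b = a by apply/eqP; rewrite eqn_leq leq_div.
  rewrite hasNfind ?size_iota //.
  by apply/hasPn => q; rewrite mem_iota add0n /= => H; rewrite -ltnNge.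
apply: PF_if; [exact: PF_is0|exact: PF_const|].
apply: PF_find => //; apply: PFb_leq; first exact: PF_succ (PF_behead Hf).
exact: PF_mul (PF_succ (PF_var 0)) (PF_behead Hg).
Qed.

Lemma PF_modn f g : PF f -> PF g -> PF (fun x e => f x e %% g x e).
Proof.
move=> Hf Hg; apply: PF_ext (PF_sub Hf (PF_mul (PF_divn Hf Hg) Hg)) => x e.
by rewrite {2}(divn_eq (f x e) (g x e)) addKn.
Qed.

Lemma PF_bin2 f : PF f -> PF (fun x e => 'C(f x e, 2)).
Proof.
move=> Hf; apply: PF_ext (PF_divn (PF_mul Hf (PF_pred Hf)) (PF_const 2)) => x e.
by rewrite bin2 divn2.
Qed.

Lemma PF_expn f k : PF f -> PF (fun x e => f x e ^ k).
Proof.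
move=> Hf; elim: k => [|k IH]; first exact: PF_const.
by apply: PF_ext (PF_mul Hf IH) => x e; rewrite expnS.
Qed.

Lemma PFb_nth_const (s : seq bool) f : PF f -> PFb (fun x e => nth false s (f x e)).
Proof.
elim: s f => [|b s IH] f Hf; first by apply: PFb_ext (PFb_const false) => x e; rewrite nth_nil.
apply: PFb_ext (PFb_if (PF_is0 Hf) (PFb_const b) (IH _ (PF_pred Hf))) => x e.
by case: (f x e).
Qed.

(** * Forbidden patterns *)

Section Patterns.
Variables (NM C : finType).

(** Non-adjacency is not expressible, since copies need not be induced. Distinct names may denote
    the same vertex unless [ANeq] separates them. *)
Inductive atom := AAdj of NM & NM | ANeq of NM & NM | AEq of NM & NM | ACol of NM & C.

Definition asat (V : eqType) (adj : rel V) (c : V -> C) (t : NM -> V) (a : atom) : bool :=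
  match a with
  | AAdj n m => adj (t n) (t m)
  | ANeq n m => t n != t m
  | AEq n m => t n == t m
  | ACol n k => c (t n) == k
  end.

Definition avoids (V : eqType) (adj : rel V) (c : V -> C) (forb : seq atom -> Prop) :=
  forall cl, forb cl -> forall t, ~~ all (asat adj c t) cl.

Lemma asat_inj (V W : eqType) (adjV : rel V) (adjW : rel W) c (phi : V -> W) t a :
  injective phi -> (forall u v, adjV u v -> adjW (phi u) (phi v)) ->
  asat adjV (c \o phi) t a -> asat adjW c (phi \o t) a.
Proof. by move=> I H; case: a => [n m|n m|n m|n k] /=; [exact: H|rewrite (inj_eq I)..|]. Qed.

Variable forb : seq atom -> Prop.
Let k := #|C|.

Definition small_bad m (R : {ffun 'I_m * 'I_m -> bool}) (col : {ffun 'I_m -> 'I_k}) : Prop :=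
  [/\ 0 < m, forall u v, R (u, v) = R (v, u), forall u, R (u, u) = false &
   exists2 cl, forb cl & exists t, all (asat (fun u v => R (u, v)) (enum_val \o col) t) cl].

Definition small_graph m (R : {ffun 'I_m * 'I_m -> bool}) (col : {ffun 'I_m -> 'I_k}) : cgraph k :=
  {| cg_n := m; cg_adj := fun u v => R (u, v); cg_col := col |}.

(** A violation involves at most [#|NM|] vertices, so graphs up to that size suffice and the family
    is finite whatever [forb] is; whether a graph belongs to it is decided classically. *)
Definition small_graphs : seq (cgraph k) :=
  List.flat_map (fun m => List.flat_map
    (fun F : {ffun 'I_m * 'I_m -> bool} * {ffun 'I_m -> 'I_k} =>
       if excluded_middle_informative (small_bad F.1 F.2) then [:: small_graph F.1 F.2] else [::])
    (enum [set: {ffun 'I_m * 'I_m -> bool} * {ffun 'I_m -> 'I_k}])) (iota 0 #|NM|.+1).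

Lemma in_In (T : eqType) (x : T) s : x \in s -> List.In x s.
Proof. by elim: s => //= a s IH; rewrite inE => /orP[/eqP->|/IH]; [left|right]. Qed.

Lemma small_graphsP F : List.In F small_graphs -> exists m R col,
  small_bad R col /\ F = @small_graph m R col.
Proof.
move=> /List.in_flat_map[m [_ /List.in_flat_map[[R col] [_]]]] /=.
by case: excluded_middle_informative => // H [] // <-; exists m, R, col.
Qed.

Lemma In_small_graphs m R col : m <= #|NM| -> @small_bad m R col ->
  List.In (small_graph R col) small_graphs.
Proof.
move=> mN H; apply/List.in_flat_map; exists m; split.
  by apply: in_In; rewrite mem_iota add0n ltnS.
apply/List.in_flat_map; exists (R, col); split; first by apply: in_In; rewrite mem_enum inE.
by case: excluded_middle_informative => //= _; left.
Qed.

Lemma small_graphs_wf F : List.In F small_graphs -> cgraph_wf F.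
Proof. by move=> /small_graphsP[m [R [col [[m0 s i _] ->]]]]. Qed.

Lemma gr_adj_sym x (u v : 'I_(gr_n x)) : gr_adj u v = gr_adj v u.
Proof. by rewrite /gr_adj eq_sym maxnC minnC. Qed.

(** A violated clause yields the graph induced on the vertices that it names. Conversely a copy of a
    small graph carries its violation along, injectivity being what preserves [ANeq]. *)
Lemma free_coloring_avoids (n0 : NM) x : free_coloring small_graphs x <->
  exists c : 'I_(gr_n x) -> C, avoids (@gr_adj x) c forb.
Proof.
split=> [[c Hc]|[c Hc]].
  exists (enum_val \o c) => cl fcl t; apply/negP => Ht.
  pose A := [set t n | n in NM].
  have tA n : t n \in A by apply: imset_f.
  pose phi := @enum_val _ (mem A); pose t' n := enum_rank_in (tA n0) (t n).
  have pt n : phi (t' n) = t n by apply: enum_rankK_in.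
  have I : injective phi by apply: enum_val_inj.
  pose R := [ffun p : 'I_#|A| * 'I_#|A| => gr_adj (phi p.1) (phi p.2)].
  pose col := [ffun u => c (phi u)].
  apply: (Hc (small_graph R col)).
    apply: In_small_graphs; first exact: leq_imset_card.
    split.
    - by apply/card_gt0P; exists (t n0).
    - by move=> u v; rewrite !ffunE /= gr_adj_sym.
    - by move=> u; rewrite !ffunE /= /gr_adj eqxx.
    exists cl => //; exists t'; apply: sub_all Ht => -[n m|n m|n m|n q] /=.
    - by rewrite ffunE /= !pt.
    - by rewrite -(inj_eq I) !pt.
    - by rewrite -(inj_eq I) !pt.
    - by rewrite ffunE /= pt.
  exists phi; split=> //; split=> [u v /=|u /=]; by rewrite ffunE.
exists (fun u => enum_rank (c u)) => F /small_graphsP[m [R [col [[m0 s i [cl fcl [t Ht]]]] ->]]].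
move=> [phi [I [H1 H2]]]; have /negP := Hc cl fcl (phi \o t); apply.
apply: sub_all Ht => a Ha; apply: asat_inj I H1 _.
rewrite /= in H2; have E u : enum_val (col u) = c (phi u) by rewrite -H2 enum_rankK.
by case: a Ha => //= n q; rewrite E.
Qed.

End Patterns.

(** * Tableaux of computations *)

Section Tableau.
Variable M : TM.
Notation Q := (tm_Q M).
Notation G := (tm_G M).
Notation bl := (@tm_blank M).

(* The symbol is [None] at positions that the list representation of the tape does not yet
   contain: [read_bits] stops there even if the blank symbol decodes to a bit. *)
Definition tcell : finType := (option G * option Q)%type.

Definition wsym (s : option bool) : option G := omap (@tm_bit M) s.

Definition acfg : Type := (Q * nat * (nat -> option G))%type.

(** The outer update makes an unlisted position explicit when the head arrives, just as [head] with
    its default does on lists. *)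
Definition astep (c : acfg) : acfg :=
  let: (q, k, F) := c in
  if @tm_halt M q then c else
  let: (q', g, d) := @tm_delta M q (odflt bl (F k)) in
  let F1 := upd F k (Some g) in
  (q', mvpos k d, upd F1 (mvpos k d) (Some (odflt bl (F1 (mvpos k d))))).

(** Only the part from the head to the right is exact: the output is read there and stops where the
    list ends. To the left, listed and unlisted blanks are not told apart. *)
Definition oview (tp : seq G * G * seq G) (k : nat) (F : nat -> option G) : Prop :=
  let: (l, h, r) := tp in
  (forall i, i < k -> odflt bl (F (k.-1 - i)) = nth bl l i) /\
  (forall i, F (k + i) = onth (h :: r) i).

Lemma astep_tm_step q tp k F : 0 < k -> oview tp k F ->
  let: (q', k', F') := astep (q, k, F) in
  exists2 tp', tm_step (q, tp) = (q', tp') & oview tp' k' F'.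
Proof.
case: tp => [[l h] r] k0 [Hl Hr]; have Hk : F k = Some h by have := Hr 0; rewrite addn0.
rewrite /astep /tm_step; case: ifP => [_|_]; first by exists (l, h, r).
rewrite Hk /=; case: tm_delta => [[q' g] d]; case: d => /=.
- exists (behead l, head bl l, g :: r) => //; split.
    move=> i ik; rewrite nth_behead -Hl; last by lia.
    by congr odflt; rewrite /upd !ifN; [congr F; lia|apply/eqP; lia|apply/eqP; lia].
  case=> [|[|i]].
  + by rewrite addn0 /upd eqxx /= ifN -?nth0 -?Hl ?subn0 //; apply/eqP; lia.
  + by rewrite /upd ifN; [rewrite ifT //; apply/eqP; lia|apply/eqP; lia].
  + rewrite /upd !ifN; [|apply/eqP; lia..].
    by have := Hr i.+1; rewrite /= => <-; congr F; lia.
- exists (g :: l, head bl r, behead r) => //; split.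
    case=> [|i] ik /=; first by rewrite subn0 /upd ifN ?eqxx //; apply/eqP; lia.
    by rewrite -Hl; [congr odflt; rewrite /upd !ifN; [congr F; lia|apply/eqP; lia..]|lia].
  case=> [|i].
  + rewrite addn0 /upd eqxx ifN /=; last by apply/eqP; lia.
    by have := Hr 1; rewrite addn1 => ->; case: (r).
  + rewrite /upd !ifN; [|apply/eqP; lia..].
    have -> : k.+1 + i.+1 = k + i.+2 by lia.
    by rewrite Hr /=; case: (r) => //=; case: (i).
- exists (l, g, r) => //; split.
    by move=> i ik; rewrite -Hl // /upd !ifN //; apply/eqP; lia.
  case=> [|i]; first by rewrite addn0 /upd eqxx.
  by rewrite /upd !ifN ?Hr //; apply/eqP; lia.
Qed.

(** The state carried by a head that leaves the cell [c] to the right, or to the left if [toR] is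
    false. *)
Definition arrive (toR : bool) (c : tcell) : option Q :=
  if c.2 is Some q then
    if @tm_halt M q then None else
    match @tm_delta M q (odflt bl c.1) with
    | (q', _, MoveR) => if toR then Some q' else None
    | (q', _, MoveL) => if toR then None else Some q'
    | (_, _, Stay) => None
    end
  else None.

(** The local rule of the tableau: the head is either in the cell, or enters from one side, or is
    not near. *)
Definition rho (l c r : tcell) : tcell :=
  if c.2 is Some q then
    if @tm_halt M q then c else
    let: (q', g, d) := @tm_delta M q (odflt bl c.1) in
    (Some g, if d is Stay then Some q' else None)
  else if arrive true l is Some q' then (Some (odflt bl c.1), Some q')
  else if arrive false r is Some q' then (Some (odflt bl c.1), Some q')
  else c.

Lemma rho_idle l c r : l.2 = None -> c.2 = None -> r.2 = None -> rho l c r = c.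
Proof. by rewrite /rho /arrive => -> -> ->. Qed.

Definition cellat (c : acfg) (f : nat) : tcell :=
  let: (q, k, F) := c in (F f, if f == k then Some q else None).

Lemma cellat_step c f : 0 < c.1.2 -> 0 < f ->
  cellat (astep c) f = rho (cellat c f.-1) (cellat c f) (cellat c f.+1).
Proof.
case: c => [[q k] F] /= k0 f0; rewrite /rho /arrive /=.
have [Hh|Hh] := boolP (@tm_halt M q).
  by rewrite /cellat; case: (f == k) => /=; rewrite ?Hh //; case: (f.-1 == k); case: (f.+1 == k); rewrite /= ?Hh.
case E : (@tm_delta M q (odflt bl (F k))) => [[q' g] d]; case: (eqVneq f k) => [->|/eqP fk].
  have N1 : (k == k.-1) = false by apply/eqP; lia.
  have N2 : (k == k.+1) = false by apply/eqP; lia.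
  by rewrite (negbTE Hh) E; case: d E => E /=; rewrite /upd ?eqxx ?N1 ?N2 //= eqxx.
case: (eqVneq f.-1 k) => [fk1|/eqP fk1].
  rewrite /= (negbTE Hh) fk1 E; case: d E => E /=; rewrite /upd.
  + case: (f == k.-1) /eqP => ?; first by lia.
    case: (f.+1 == k) /eqP => ?; first by lia.
    by rewrite ifN //; apply/eqP.
  + have -> : f = k.+1 by lia.
    by rewrite eqxx ifN //; apply/eqP; lia.
  + case: (f.+1 == k) /eqP => ?; first by lia.
    by rewrite (introF eqP fk).
case: (eqVneq f.+1 k) => [fk2|/eqP fk2].
  rewrite /= (negbTE Hh) fk2 E; case: d E => E /=; rewrite /upd.
  + have -> : f = k.-1 by lia.
    by rewrite eqxx ifN //; apply/eqP; lia.
  + case: (f == k.+1) /eqP => ?; first by lia.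
    by rewrite (introF eqP fk).
  + by rewrite (introF eqP fk).
case: d E => E /=; rewrite /upd (introF eqP fk) //.
+ by case: (f == k.-1) /eqP => ? //; lia.
+ by case: (f == k.+1) /eqP => ? //; lia.
Qed.

Lemma astep_far c f : f != c.1.2 -> f != (astep c).1.2 -> (astep c).2 f = c.2 f.
Proof.
case: c => [[q k] F]; rewrite /astep /=; case: ifP => //= _; case: tm_delta => [[q' g] d] /=.
by rewrite /upd => /negbTE-> /negbTE->.
Qed.

Lemma astep_pos c : (astep c).1.2 <= c.1.2.+1 /\ c.1.2 <= (astep c).1.2.+1.
Proof.
case: c => [[q k] F]; rewrite /astep /=; case: ifP => //= _; case: tm_delta => [[q' g] []] /=; lia.
Qed.

Variables (w : seq bool) (F0 tau W : nat).

Definition wat (f : nat) : option bool := if F0 <= f then onth w (f - F0) else None.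

Definition arun (t : nat) : acfg := iter t astep (@tm_start M, F0, fun f => wsym (wat f)).

(** The rows of the tableau are laid end to end, so that time is the shift by [W] and space the
    shift by 1, both visible as additions to a code. *)
Definition CT (phi : nat) : tcell := cellat (arun (phi %/ W)) (phi %% W).

Hypotheses (w0 : 0 < size w) (tauF : tau + 2 <= F0) (tauW : F0 + tau + 2 < W)
  (wW : F0 + size w < W) (halt_tau : tm_halted (tm_run M tau w)).

Lemma arun_pos t : (arun t).1.2 <= F0 + t /\ F0 <= (arun t).1.2 + t.
Proof.
elim: t => [|t IH] /=; first by lia.
have := astep_pos (arun t); rewrite -/(arun t); lia.
Qed.

Lemma arun_run t : t <= tau ->
  exists2 tp, tm_run M t w = ((arun t).1.1, tp) & oview tp (arun t).1.2 (arun t).2.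
Proof.
elim: t => [_|t IH tT].
  exists ([::], head bl (map (@tm_bit M) w), behead (map (@tm_bit M) w)) => //; split=> [i iF|i] /=.
    by rewrite nth_nil /wat ifN //; lia.
  rewrite /wat leq_addr addKn /wsym -onth_map.
  by case: (w) w0.
have [tp E V] := IH (ltnW tT); have [P1 P2] := arun_pos t.
rewrite /tm_run iterS -/(tm_run M t w) E /=.
have := @astep_tm_step (arun t).1.1 tp (arun t).1.2 (arun t).2; rewrite -!surjective_pairing.
case A : (astep (arun t)) => [[q' k'] F'] H.
have [|tp' E' V'] := H _ V; first by lia.
by exists tp'.
Qed.

Lemma arun_halt t : arun t = arun (minn t tau).
Proof.
case: (leqP t tau) => // tT; rewrite -(subnK (ltnW tT)) /arun iterD -/(arun tau).
have [tp E _] := arun_run (leqnn tau); move: halt_tau; rewrite /tm_halted E /=.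
case: (arun tau) => [[q k] F] /= H; elim: (t - tau) => //= m ->.
by rewrite /astep H.
Qed.

Lemma arun_bounds t : 2 <= (arun t).1.2 /\ (arun t).1.2 + 2 < W.
Proof. by rewrite arun_halt; have := arun_pos (minn t tau); lia. Qed.

Lemma arun_edge t f : f < 2 \/ W <= f + 2 -> (arun t).2 f = wsym (wat f).
Proof.
move=> H; elim: t => [//|t IH]; rewrite -IH; apply: (@astep_far (arun t)).
  by have B := arun_bounds t; apply/eqP => E; move: B; rewrite -E; lia.
by have := arun_bounds t.+1; rewrite [arun _]iterS => B; apply/eqP => E; move: B; rewrite -E; lia.
Qed.

Lemma cellat_edge t f : f < 2 \/ W <= f + 2 -> cellat (arun t) f = (wsym (wat f), None).
Proof.
move=> H; have := arun_edge t H; have := arun_bounds t; case: (arun t) => [[q k] F] /= B ->.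
by rewrite ifN //; apply/eqP; lia.
Qed.

Lemma CT_init phi : phi < W -> CT phi = (wsym (wat phi), if phi == F0 then Some (@tm_start M) else None).
Proof. by move=> H; rewrite /CT divn_small // modn_small. Qed.

(** Position 0 has no left neighbour, so the step rule does not reach position [W]; its content has
    to be prescribed. *)
Lemma CT_first : CT W = (None, None).
Proof.
have W0 : 0 < W by lia.
rewrite /CT divnn W0 modnn cellat_edge; last by left.
by rewrite /wat ifN //; lia.
Qed.

Lemma CT_row t f : f < W -> CT (t * W + f) = cellat (arun t) f.
Proof.
by move=> fW; rewrite /CT divnMDl ?modnMDl ?divn_small ?modn_small ?addn0 //; lia.
Qed.

(** At the end of a row the rule looks into a neighbouring row. This is harmless: the head stays at
    least two cells away from both edges, so an edge cell and its neighbours hold no head, and the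
    rule leaves such a cell unchanged. Patterns thus need not know where rows end. *)
Lemma CT_step phi : 0 < phi -> CT (phi + W) = rho (CT phi.-1) (CT phi) (CT phi.+1).
Proof.
move=> p0; have W0 : 0 < W by lia.
set t := phi %/ W; set f := phi %% W.
have Ep : phi = t * W + f by apply: divn_eq.
have fW : f < W by rewrite ltn_mod.
have wl : wsym (wat W.-1) = None.
  by rewrite /wat; case: ifP => // _; rewrite onth_default //; lia.
have -> : phi + W = t.+1 * W + f by rewrite mulSn; lia.
have -> : CT phi = cellat (arun t) f by rewrite Ep CT_row.
rewrite CT_row //; case: (posnP f) => f0.
  have t0 : 0 < t by rewrite lt0n; apply/eqP => t0; move: p0; rewrite Ep t0 f0.
  have -> : phi.-1 = t.-1 * W + W.-1 by rewrite Ep f0 -{1}(prednK t0) mulSn; lia.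
  have -> : phi.+1 = t * W + 1 by rewrite Ep f0; lia.
  rewrite !CT_row; [|lia..].
  by rewrite f0 rho_idle ?cellat_edge //; by [left|right; lia].
have -> : phi.-1 = t * W + f.-1 by rewrite Ep; lia.
rewrite CT_row; last by lia.
case: (ltnP f.+1 W) => f1.
  have -> : phi.+1 = t * W + f.+1 by rewrite Ep; lia.
  by rewrite CT_row // -cellat_step //; have := arun_bounds t; lia.
have -> : phi.+1 = t.+1 * W + 0 by rewrite Ep mulSn; lia.
rewrite CT_row // rho_idle ?cellat_edge //; by [left|right; lia].
Qed.

Definition osym_bit (s : option G) : option bool := obind (@tm_decode M) s.

(** The output is [[:: true]] if the scanned symbol is that bit and the next symbol is no bit. Pairs
    that do not start at the head impose nothing, so acceptance becomes local. *)
Definition acc_ok (c c' : tcell) : bool :=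
  c.2 ==> ((osym_bit c.1 == Some true) && (osym_bit c'.1 == None)).

Lemma CT_accept t : tau <= t ->
  (tm_output (tm_run M tau w) = [:: true] <->
   forall f, f.+1 < W -> acc_ok (CT (t * W + f)) (CT (t * W + f.+1))).
Proof.
move=> tt; have W0 : 0 < W by lia.
have [[[l h] r] E [_ V]] := arun_run (leqnn tau).
have Et : arun t = arun tau by rewrite arun_halt (minn_idPr tt).
have [B1 B2] := arun_bounds tau.
have EC f : f < W -> CT (t * W + f) = cellat (arun tau) f.
  by move=> fW; rewrite CT_row // Et.
have -> : (forall f, f.+1 < W -> acc_ok (CT (t * W + f)) (CT (t * W + f.+1))) <->
   (osym_bit ((arun tau).2 (arun tau).1.2) == Some true) &&
   (osym_bit ((arun tau).2 (arun tau).1.2.+1) == None).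
  split=> [H|H f fW].
    have := H (arun tau).1.2; rewrite !EC; [|lia..].
    by rewrite /acc_ok; case: (arun tau) B2 => [[q k] F] /= B2; rewrite eqxx; apply; lia.
  rewrite !EC; [|lia..].
  by rewrite /acc_ok; move: H; case: (arun tau) => [[q k] F] /=; case: (f =P k) => [->|] //.
have V0 := V 0; have V1 := V 1; rewrite addn0 /= in V0; rewrite addn1 /= in V1.
rewrite V0 V1 E /= /osym_bit /=.
case: (tm_decode h) => [[]|] //=; [|by split..].
case: r {V V1 E} => [|g r] /=; first by split.
by case: (tm_decode g) => [b|] //=; split.
Qed.

End Tableau.

(** * Digits *)

(** Iterated division instead of division by [B ^ j]: for variable [j] this power has no polynomial
    bound. *)
Definition dgt (B e j : nat) : nat := iter j (fun c => c %/ B) e %% B.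

Fixpoint cod (B K : nat) (d : nat -> nat) : nat :=
  if K is K'.+1 then d 0 + B * cod B K' (fun j => d j.+1) else 0.

Lemma dgtS B e j : dgt B e j.+1 = dgt B (e %/ B) j.
Proof. by rewrite /dgt iterSr. Qed.

Lemma dgt_lt B e j : 0 < B -> dgt B e j < B.
Proof. by move=> B0; rewrite /dgt ltn_mod. Qed.

Lemma iter_divn B e j : iter j (fun c => c %/ B) e = e %/ B ^ j.
Proof.
elim: j e => [|j IH] e; first by rewrite divn1.
by rewrite iterSr IH -divnMA -expnS.
Qed.

Lemma dgt_drop B e m j : dgt B e (m + j) = dgt B (e %/ B ^ m) j.
Proof. by rewrite /dgt addnC iterD (iter_divn B e m). Qed.

Lemma cod_ext B K d d' : (forall j, j < K -> d j = d' j) -> cod B K d = cod B K d'.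
Proof.
elim: K d d' => //= K IH d d' H; rewrite H // (IH _ (fun j => d' j.+1)) // => j jK.
exact: H.
Qed.

Lemma cod_lt B K d : (forall j, j < K -> d j < B) -> cod B K d < B ^ K.
Proof.
elim: K d => //= K IH d H; rewrite expnS.
have := IH (fun j => d j.+1) (fun j jK => H j.+1 jK); have := H 0 isT.
set c := cod _ _ _; move: (B ^ K) => X dB cX.
by apply: (@leq_trans (B + B * c)); [lia|rewrite -mulnS leq_mul2l cX orbT].
Qed.

Lemma dgt_cod B K d j : (forall j, j < K -> d j < B) -> j < K -> dgt B (cod B K d) j = d j.
Proof.
elim: K d j => //= K IH d j H jK; have dB := H 0 isT.
case: j jK => [_|j jK]; first by rewrite /dgt /= addnC mulnC modnMDl modn_small.
rewrite dgtS addnC mulnC divnMDl; last by lia.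
by rewrite divn_small // addn0 IH // => i iK; apply: H.
Qed.

Lemma cod_dgt B K e : e < B ^ K -> cod B K (dgt B e) = e.
Proof.
elim: K e => [|K IH] e; first by rewrite expn0 ltnS leqn0 => /eqP.
rewrite expnS => H; have B0 : 0 < B by case: (B) H.
rewrite /= (@cod_ext _ _ (fun j => dgt B e j.+1) (dgt B (e %/ B))); last by move=> j _; rewrite dgtS.
rewrite IH; last by rewrite ltn_divLR // mulnC.
by rewrite /dgt /= mulnC addnC -divn_eq.
Qed.

(** Addition of [B ^ lo] where the carry stops at digit [r]. *)
Definition link (B lo r K : nat) (d d' : nat -> nat) : Prop := forall j, j < K ->
  if j < lo then d' j = d j else
  if j < r then d j = B.-1 /\ d' j = 0 else
  if j == r then d' j = (d j).+1 else d' j = d j.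

Lemma link_cod B lo r K d d' : 0 < B -> lo <= r < K -> link B lo r K d d' ->
  cod B K d' = cod B K d + B ^ lo.
Proof.
move=> B0; elim: K lo r d d' => [|K IH] lo r d d' /andP[lr rK] H; first by [].
have H0 := H 0 isT; rewrite /=.
case: lo lr H H0 => [|lo] lr H H0.
  case: r lr rK H H0 => [|r] lr rK H /= H0.
    rewrite H0 (@cod_ext _ _ (fun j => d' j.+1) (fun j => d j.+1)); first by rewrite expn0; lia.
    by move=> j jK; have := H j.+1 jK.
  case: H0 => -> ->; rewrite (IH 0 r (fun j => d j.+1) (fun j => d' j.+1)) //.
    by rewrite expn0 mulnDr muln1; lia.
  by move=> j jK; have := H j.+1 jK; rewrite /= ltnS eqSS.
case: r lr rK H H0 => [|r] // lr rK H /= H0.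
rewrite H0 (IH lo r (fun j => d j.+1) (fun j => d' j.+1)); first by rewrite mulnDr addnA -expnS.
  by lia.
by move=> j jK; have := H j.+1 jK; rewrite /= !ltnS eqSS.
Qed.

(** The carry stops below digit [K] because the sum does not overflow. *)
Lemma link_ex B lo K e : 1 < B -> e + B ^ lo < B ^ K ->
  exists2 r, lo <= r < K & link B lo r K (dgt B e) (dgt B (e + B ^ lo)).
Proof.
move=> B1; have B0 : 0 < B by lia.
elim: K lo e => [|K IH] lo e; first by rewrite expn0 ltnS leqn0 addn_eq0 expn_eq0; lia.
have Ee := divn_eq e B; have em : e %% B < B by rewrite ltn_mod.
case: lo => [|lo] H.
  rewrite expn0 addn1; case: (ltnP (e %% B).+1 B) => Hm.
    exists 0 => //; move=> [|j] jK /=.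
      by rewrite /dgt /= {1}Ee -addnS modnMDl modn_small.
    by rewrite !dgtS {1}Ee -addnS divnMDl // (divn_small Hm) addn0.
  have Eb : e %% B = B.-1 by lia.
  have E1 : e.+1 = (e %/ B).+1 * B by rewrite {1}Ee Eb mulSn; lia.
  have [|r rK Hr] := IH 0 (e %/ B).
    by rewrite expn0 addn1 -(ltn_pmul2r B0) -E1 mulnC -expnS; rewrite expn0 addn1 in H.
  exists r.+1 => // -[|j] jK /=; first by rewrite /dgt /= Eb E1 modnMl.
  rewrite !dgtS E1 mulnK //; have := Hr j jK.
  by rewrite /= expn0 addn1 eqSS ltnS.
have E1 : e + B ^ lo.+1 = (e %/ B + B ^ lo) * B + e %% B by rewrite {1}Ee expnS mulnDl; lia.
have [|r rK Hr] := IH lo (e %/ B).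
  by rewrite -(ltn_pmul2r B0) [X in _ < X]mulnC -expnS; apply: leq_ltn_trans H; rewrite E1 leq_addr.
exists r.+1 => // -[|j] jK /=; first by rewrite /dgt /= E1 modnMDl modn_mod.
rewrite !dgtS E1 divnMDl // (divn_small em) addn0; have := Hr j jK.
by rewrite /= eqSS !ltnS.
Qed.

(** * Intervals of codes described by their digits *)

Section Ranges.
Variables (B : nat).
Hypothesis B1 : 1 < B.
Let B0 : 0 < B. Proof. by apply: ltnW. Qed.

Lemma dgt_eq_all K e e' : e < B ^ K -> e' < B ^ K ->
  (forall j, j < K -> dgt B e j = dgt B e' j) -> e = e'.
Proof. by move=> H H' E; rewrite -(cod_dgt H) -(cod_dgt H'); apply: cod_ext. Qed.

Lemma dgt_zero j : dgt B 0 j = 0.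
Proof. by rewrite /dgt iter_divn div0n mod0n. Qed.

Lemma dgt_max K j : j < K -> dgt B (B ^ K).-1 j = B.-1.
Proof.
elim: K j => // K IH j jK; have X0 : 0 < B ^ K by rewrite expn_gt0 B0.
have E : (B ^ K.+1).-1 = (B ^ K).-1 * B + B.-1.
  rewrite expnS; case: (B ^ K) X0 => // X _ /=; rewrite mulnS; lia.
case: j jK => [_|j jK]; first by rewrite E /dgt /= modnMDl modn_small //; lia.
by rewrite dgtS E divnMDl // divn_small ?addn0 ?IH //; lia.
Qed.

Lemma dgt_high0 m K e : m <= K -> e < B ^ K ->
  (forall j, m <= j < K -> dgt B e j = 0) <-> e < B ^ m.
Proof.
move=> mK eK; have Bm : 0 < B ^ m by rewrite expn_gt0 B0.
split=> [H|H j /andP[mj jK]]; last by rewrite -(subnKC mj) dgt_drop divn_small // dgt_zero.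
suff E : e %/ B ^ m = 0 by rewrite ltnNge -divn_gt0 // E.
apply: (@dgt_eq_all (K - m)).
- by rewrite ltn_divLR // -expnD subnK.
- by rewrite expn_gt0 B0.
- by move=> j jK; rewrite dgt_zero -dgt_drop H //; lia.
Qed.

Lemma dgt_highM m K e : m <= K -> e < B ^ K ->
  (forall j, m <= j < K -> dgt B e j = B.-1) <-> B ^ K - B ^ m <= e.
Proof.
move=> mK eK; have Bm : 0 < B ^ m by rewrite expn_gt0 B0.
have Bk : 0 < B ^ (K - m) by rewrite expn_gt0 B0.
have EK : B ^ K = B ^ (K - m) * B ^ m by rewrite -expnD subnK.
have Q : (B ^ K - B ^ m <= e) = (e %/ B ^ m == (B ^ (K - m)).-1).
  have L : e %/ B ^ m < B ^ (K - m) by rewrite ltn_divLR // -EK.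
  have -> : (e %/ B ^ m == (B ^ (K - m)).-1) = ((B ^ (K - m)).-1 <= e %/ B ^ m) by lia.
  by rewrite leq_divRL // -subn1 mulnBl mul1n -EK.
rewrite Q; split=> [H|/eqP H j /andP[mj jK]].
  apply/eqP; apply: (@dgt_eq_all (K - m)).
  - by rewrite ltn_divLR // -EK.
  - by lia.
  - by move=> j jK; rewrite dgt_max // -dgt_drop H //; lia.
by rewrite -(subnKC mj) dgt_drop H dgt_max //; lia.
Qed.

Lemma dgt_mod m e j : j < m -> dgt B (e %% B ^ m) j = dgt B e j.
Proof.
move=> jm; rewrite /dgt !iter_divn {2}(divn_eq e (B ^ m)).
have -> : B ^ m = B ^ (m - j).-1 * B * B ^ j by rewrite -expnSr prednK ?subn_gt0 // -expnD subnK // ltnW.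
rewrite mulnA divnMDl ?expn_gt0 ?B0 // mulnA modnMDl //.
Qed.

(** Here [e] ranges over one row. Patterns see only which digits are first or last numbers, and this
    is an interval away from both ends of the row that such information can delimit. *)
Lemma dgt_zone z m e : z <= m -> e < B ^ m.+1 ->
  (dgt B e m = B.-1 /\ forall j, z <= j < m -> dgt B e j = 0) <->
  B.-1 * B ^ m <= e < B.-1 * B ^ m + B ^ z.
Proof.
move=> zm eb; have Bm : 0 < B ^ m by rewrite expn_gt0 B0.
have zB : B ^ z <= B ^ m by rewrite leq_exp2l.
have Et : dgt B e m = e %/ B ^ m.
  by rewrite -{1}[m]addn0 dgt_drop /dgt /= modn_small // ltn_divLR // -expnS.
have Hl : (forall j, z <= j < m -> dgt B e j = 0) <-> e %% B ^ m < B ^ z.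
  rewrite -(dgt_high0 zm) ?ltn_mod //.
  by split=> H j /andP[zj jm]; [rewrite dgt_mod|rewrite -(dgt_mod _ jm)]; rewrite ?H // zj.
rewrite Et Hl; have D := divn_eq e (B ^ m); have M := ltn_pmod e Bm.
split=> [[E H]|/andP[H1 H2]].
  by rewrite D E leq_addr ltn_add2l.
have E : e %/ B ^ m = B.-1.
  apply/eqP; rewrite eqn_leq leq_divRL // H1 andbT -ltnS prednK // ltn_divLR //.
  by rewrite -expnS.
by split=> //; move: H2; rewrite {1}D E ltn_add2l.
Qed.

Lemma dgt_zone1 m e : 0 < m -> B.-1 * B ^ m <= e < B.-1 * B ^ m + B ->
  dgt B e 0 = e - B.-1 * B ^ m.
Proof.
case: m => // m _ /andP[H1 H2]; rewrite /dgt /= -{1}(subnKC H1) expnSr mulnA modnMDl modn_small //.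
by rewrite -mulnA -expnSr; lia.
Qed.

End Ranges.

(** * The forbidden patterns of the reduction *)

(* A sort below 18 belongs to a number and packs its kind (0: first, 1: inner, 2: last), its
   position modulo 3 and an input bit; sort [18 + j] is that of the ports for digit [j], and
   [18 + K] that of cells. *)
Definition kd (s : nat) : nat := s %/ 6.
Definition ta (s : nat) : nat := s %/ 2 %% 3.
Definition bt (s : nat) : bool := s %% 2 == 1.

Definition cmp (s s' : nat) : bool :=
  [&& kd s != 2, kd s' != 0 & ta s' == (ta s).+1 %% 3].

Section Hubs.
Variable K : nat.

Definition nsorts : nat := 19 + K.
(** Hub 0 marks the ordinary vertices and hub [s.+1] the sort [s]. Two spare hubs make the clique of
    hubs larger than [nsorts + 2], the bound of [gx_clique] on cliques through an ordinary
    vertex. *)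
Definition nhubs : nat := nsorts + 3.
Definition ngad : nat := nhubs + (nhubs.*2).+1.

(* A clique of hubs and a clique of [2 * nhubs + 1] other vertices, the first [i] of which are
   joined to hub [i]: degrees tell the hubs apart. *)
Definition gadj (i j : nat) : bool :=
  if i < nhubs then (if j < nhubs then i != j else j - nhubs < i)
  else (if j < nhubs then i - nhubs < j else i != j).

Variables (N : nat) (adj : rel nat).

Definition emb (e : nat -> nat) : bool :=
  all (fun i => all (fun j => (gadj i j ==> adj (e i) (e j)) && ((i != j) ==> (e i != e j)))
    (iota 0 ngad)) (iota 0 ngad).

Variable a : nat -> nat.

(** Hubs are adjacent to each other and would otherwise have sorts themselves; the last clause
    excludes them. *)
Definition srt (u s : nat) : bool :=
  [&& adj u (a 0), adj u (a s.+1) & all (fun i => u != a i) (iota 0 nhubs)].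

Definition knd (k u : nat) : bool := has (fun s => (kd s == k) && srt u s) (iota 0 18).

(* Positions modulo 3 orient the edges of the path of numbers. *)
Definition suc (u v : nat) : bool := adj u v &&
  has (fun s => has (fun s' => [&& cmp s s', srt u s & srt v s']) (iota 0 18)) (iota 0 18).

(* The number [u] is the [j]-th digit of the cell [v]. *)
Definition dig (v j u : nat) : bool :=
  [&& srt v (18 + K), has (srt u) (iota 0 18) &
      has (fun p => [&& srt p (18 + j), adj v p & adj p u]) (iota 0 N)].

End Hubs.

Lemma all_flatten_map (S T : Type) (P : pred T) (F : S -> seq T) s :
  all P (flatten [seq F i | i <- s]) = all (fun i => all P (F i)) s.
Proof. by elim: s => //= i s IH; rewrite all_cat IH. Qed.

Section Clauses.
Variables (K lob : nat) (Blk : finType).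
Variables (ok1 : (nat -> nat) -> Blk -> bool) (ok2 : (nat -> nat) -> (nat -> nat) -> Blk -> Blk -> bool).
Variables (ok3 : Blk -> Blk -> Blk -> Blk -> bool) (ok4 : (nat -> nat) -> Blk -> Blk -> bool).

Notation nS := (nsorts K).
Notation nH := (nhubs K).
Notation nG := (ngad K).

(** The components are the role of a vertex (gadget, cell, port, number), the copy of the gadget or
    cell to which it belongs, and its index there. No pattern needs more than four cells. *)
Definition name : finType := ('I_4 * 'I_4 * 'I_(nG + K).+1)%type.
(* [None] leaves a vertex unused, [Some None] claims that the chain of cells is broken. *)
Definition colour : finType := option (option Blk).
Notation Star := (None : colour).
Notation Esc := (Some None : colour).
Notation Comp k := (Some (Some k) : colour).
Notation atom := (atom name colour).

Definition nm (k a j : nat) : name := (inord k, inord a, inord j).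
Notation hubn := (nm 0).
Notation celln c := (nm 1 c 0).
Notation portn := (nm 2).
Notation numn := (nm 3).

(** This and the following lists are locked lest simplification unfold them. *)
Definition gadA (e : nat) : seq atom := locked (
  flatten [seq flatten [seq (if gadj K i j then [:: AAdj colour (hubn e i) (hubn e j)] else [::]) ++
     (if i != j then [:: ANeq colour (hubn e i) (hubn e j)] else [::]) | j <- iota 0 nG] | i <- iota 0 nG]).

Definition srtA (v : name) (s : nat) : seq atom := locked (
  [:: AAdj colour v (hubn 0 0); AAdj colour v (hubn 0 s.+1)] ++
  [seq ANeq colour v (hubn 0 i) | i <- iota 0 nH]).

Definition cellA (c : nat) (sv : nat -> nat) : seq atom := locked (
  srtA (celln c) (18 + K) ++
  flatten [seq srtA (portn c j) (18 + j) ++ srtA (numn c j) (sv j) ++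
    [:: AAdj colour (celln c) (portn c j); AAdj colour (portn c j) (numn c j)] | j <- iota 0 K]).

Definition linkA (lo r c c' : nat) : seq atom := locked (
  flatten [seq if lo <= j < r then [::] else
    if j == r then [:: AAdj colour (numn c j) (numn c' j)] else [:: AEq colour (numn c j) (numn c' j)]
    | j <- iota 0 K]).

(** Fixing the values beyond [K] makes vectors that agree on all digits equal as functions. *)
Definition svok (sv : nat -> nat) : Prop := forall j, sv j < 18 /\ (K <= j -> sv j = 0).

(** The share of [link] that sorts can express: the digits passed by the carry go from last to first
    numbers, and digit [r] advances. The equalities and the edge are left to [linkA]. *)
Definition linkS (lo r : nat) (sv sv' : nat -> nat) : Prop :=
  lo <= r < K /\ forall j, j < K ->
    (lo <= j < r -> kd (sv j) = 2 /\ kd (sv' j) = 0) /\ (j = r -> cmp (sv j) (sv' j)).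

(* The first cell is not [Star], both other kinds of colours propagate along the chain of
   cells, and the last cell is not [Esc]: a complete chain must carry blocks throughout, whereas
   a broken one can be coloured [Esc] up to its first gap. *)
Definition okc1 (sv : nat -> nat) (c : colour) : bool :=
  [&& all (fun j => kd (sv j) == 0) (iota 0 K) ==> (c != Star),
      all (fun j => kd (sv j) == 2) (iota 0 K) ==> (c != Esc) &
      if c is Some (Some k) then ok1 sv k else true].

Definition okc2 (sv sv' : nat -> nat) (c c' : colour) : bool :=
  match c, c' with
  | None, _ => true
  | Some None, Some None => true
  | Some (Some k), Some (Some k') => ok2 sv sv' k k'
  | _, _ => false
  end.

(** The first six shapes mention no colour and forbid structural ambiguity, using [celln] for
    vertices of any role. The others constrain the colours of one cell, of consecutive cells, of a
    cell and the one below it, and of a window of the step rule. *)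
Inductive forb : seq atom -> Prop :=
| forb_hub i : i < nH -> forb (gadA 0 ++ gadA 1 ++ [:: ANeq colour (hubn 0 i) (hubn 1 i)])
| forb_sort s s' : s < nS -> s' < nS -> s <> s' ->
    forb (gadA 0 ++ srtA (celln 0) s ++ srtA (celln 0) s')
| forb_zero s s' : s < 18 -> s' < 18 -> kd s = 0 -> kd s' = 0 ->
    forb (gadA 0 ++ srtA (celln 0) s ++ srtA (celln 1) s' ++ [:: ANeq colour (celln 0) (celln 1)])
| forb_suc s1 s2 t1 t2 : s1 < 18 -> s2 < 18 -> t1 < 18 -> t2 < 18 -> cmp s1 t1 -> cmp s2 t2 ->
    forb (gadA 0 ++ srtA (celln 0) s1 ++ srtA (celln 0) s2 ++ srtA (celln 1) t1 ++ srtA (celln 2) t2 ++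
      [:: AAdj colour (celln 0) (celln 1); AAdj colour (celln 0) (celln 2);
          ANeq colour (celln 1) (celln 2)])
| forb_dig j s s' : j < K -> s < 18 -> s' < 18 ->
    forb (gadA 0 ++ srtA (celln 0) (18 + K) ++ srtA (celln 1) s ++ srtA (celln 2) s' ++
      srtA (portn 0 0) (18 + j) ++ srtA (portn 1 0) (18 + j) ++
      [:: AAdj colour (celln 0) (portn 0 0); AAdj colour (portn 0 0) (celln 1);
          AAdj colour (celln 0) (portn 1 0); AAdj colour (portn 1 0) (celln 2);
          ANeq colour (celln 1) (celln 2)])
| forb_cell sv : svok sv -> forb (gadA 0 ++ cellA 0 sv ++ cellA 1 sv ++
    [seq AEq colour (numn 0 j) (numn 1 j) | j <- iota 0 K] ++ [:: ANeq colour (celln 0) (celln 1)])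
| forb_one sv c : svok sv -> ~~ okc1 sv c -> forb (gadA 0 ++ cellA 0 sv ++ [:: ACol (celln 0) c])
| forb_two r sv sv' c c' : svok sv -> svok sv' -> linkS 0 r sv sv' -> ~~ okc2 sv sv' c c' ->
    forb (gadA 0 ++ cellA 0 sv ++ cellA 1 sv' ++ linkA 0 r 0 1 ++
      [:: ACol (celln 0) c; ACol (celln 1) c'])
| forb_down r sv sv' k k' : svok sv -> svok sv' -> linkS lob r sv sv' -> ~~ ok4 sv k k' ->
    forb (gadA 0 ++ cellA 0 sv ++ cellA 1 sv' ++ linkA lob r 0 1 ++
      [:: ACol (celln 0) (Comp k); ACol (celln 1) (Comp k')])
| forb_step r1 r2 r3 sv0 sv1 sv2 sv3 k0 k1 k2 k3 :
    svok sv0 -> svok sv1 -> svok sv2 -> svok sv3 ->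
    linkS 0 r1 sv0 sv1 -> linkS 0 r2 sv1 sv2 -> linkS lob r3 sv1 sv3 -> ~~ ok3 k0 k1 k2 k3 ->
    forb (gadA 0 ++ cellA 0 sv0 ++ cellA 1 sv1 ++ cellA 2 sv2 ++ cellA 3 sv3 ++
      linkA 0 r1 0 1 ++ linkA 0 r2 1 2 ++ linkA lob r3 1 3 ++
      [:: ACol (celln 0) (Comp k0); ACol (celln 1) (Comp k1); ACol (celln 2) (Comp k2);
          ACol (celln 3) (Comp k3)]).

Variables (N : nat) (adj : rel nat).
Hypotheses (N0 : 0 < N) (adj_lt : forall u v, adj u v -> (u < N) && (v < N)).


Definition COL : Prop := exists c : nat -> colour, forall cl, forb cl ->
  forall t : name -> nat, (forall n, t n < N) -> ~~ all (asat adj c t) cl.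

Notation emb := (emb K adj).
Notation srt := (srt K adj).
Notation knd := (knd K adj).
Notation suc := (suc K adj).
Notation dig := (dig K N adj).

Section Sat.
Variables (c : nat -> colour) (t : name -> nat).
Notation sat := (all (asat adj c t)).
Let hub e i := t (hubn e i).

Lemma sat_gadA e : sat (gadA e) = emb (hub e).
Proof.
rewrite /gadA -lock all_flatten_map; apply: eq_all => i; rewrite all_flatten_map.
by apply: eq_all => j /=; rewrite all_cat; case: gadj; case: (i != j); rewrite /= ?andbT.
Qed.

Lemma sat_srtA v s : sat (srtA v s) = srt (hub 0) (t v) s.
Proof.
rewrite /srtA -lock all_cat /= andbT -andbA all_map; congr [&& _, _ & _].
Qed.

Lemma sat_cellA cc sv : sat (cellA cc sv) =
  srt (hub 0) (t (celln cc)) (18 + K) &&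
  all (fun j => [&& srt (hub 0) (t (portn cc j)) (18 + j), srt (hub 0) (t (numn cc j)) (sv j),
      adj (t (celln cc)) (t (portn cc j)) & adj (t (portn cc j)) (t (numn cc j))]) (iota 0 K).
Proof.
rewrite /cellA -lock all_cat sat_srtA all_flatten_map; congr (_ && _).
by apply: eq_all => j; rewrite all_cat sat_srtA all_cat sat_srtA /= andbT.
Qed.

Lemma sat_linkA lo r cc cc' : sat (linkA lo r cc cc') =
  all (fun j => (lo <= j < r) || (if j == r then adj (t (numn cc j)) (t (numn cc' j))
     else t (numn cc j) == t (numn cc' j))) (iota 0 K).
Proof.
rewrite /linkA -lock all_flatten_map; apply: eq_all => j /=.
by case: ifP => //= _; case: eqP => //= _; rewrite andbT.
Qed.

End Sat.

(** Values outside the graph are redirected to vertex 0, so that every such assignment is legal; on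
    the names that a pattern uses they are vertices anyway. *)
Definition asg (A : nat -> nat -> nat) (V : nat -> nat) (P U : nat -> nat -> nat) (n : name) : nat :=
  let: (k, cc, j) := n in
  let x := match val k with 0 => A cc j | 1 => V cc | 2 => P cc j | _ => U cc j end in
  if x < N then x else 0.

Arguments asg : simpl never.
Arguments nm : simpl never.

Lemma asg_lt A V P U n : asg A V P U n < N.
Proof. by case: n => [[k cc] j]; rewrite /asg; case: ifP. Qed.

Lemma asg_nm A V P U k cc j : k < 4 -> cc < 4 -> j <= nG + K ->
  asg A V P U (nm k cc j) =
  let x := match k with 0 => A cc j | 1 => V cc | 2 => P cc j | _ => U cc j end in
  if x < N then x else 0.
Proof. by move=> k4 c4 jD; rewrite /asg /nm /= inordK // [X in A X]inordK // !inordK. Qed.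

Lemma emb_ext e e' : (forall i, i < nG -> e i = e' i) -> emb e = emb e'.
Proof.
move=> H; apply: eq_in_all => i; rewrite mem_iota add0n => /andP[_ iG].
by apply: eq_in_all => j; rewrite mem_iota add0n => /andP[_ jG]; rewrite !H.
Qed.

Lemma srt_ext a a' u s : (forall i, i < nH -> a i = a' i) -> s < nS -> srt a u s = srt a' u s.
Proof.
move=> H sS; rewrite /srt !H ?/nhubs //; last by lia.
congr [&& _, _ & _]; apply: eq_in_all => i; rewrite mem_iota add0n => /andP[_ iG].
by rewrite H.
Qed.

Lemma nS_le s : s <= 18 + K -> s < nS. Proof. by rewrite /nsorts; lia. Qed.

(** Every vertex of the gadget has a neighbour in it, and edges only join vertices below [N]. *)
Lemma emb_lt e i : emb e -> i < nG -> e i < N.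
Proof.
(* The neighbour lies in the same clique: its first vertex, or the second one if [i] is the
   first. *)
move=> /allP H iG; pose j := if i < nH then nat_of_bool (i == 0) else nH + (i == nH).
have jG : j < nG by rewrite /j /ngad /nhubs /nsorts; case: ifP => _; case: eqP => /=; lia.
have := H i; rewrite mem_iota add0n iG => /(_ isT) /allP /(_ j).
rewrite mem_iota add0n jG => /(_ isT) /andP[/implyP G _].
suff Ga : gadj K i j by have /andP[] := adj_lt (G Ga).
rewrite /gadj /j; have [iH|iH] := boolP (i < nH).
  by rewrite ifT; [case: (i =P 0) => [->|/eqP]|rewrite /nhubs; case: eqP => /=; lia].
by rewrite ifN; case: eqP => /= ?; lia.
Qed.

Lemma forb_gad cl : forb cl -> exists s, cl = gadA 0 ++ s.
Proof. by case=> *; eexists. Qed.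

Lemma no_emb_COL : (forall e, ~~ emb e) -> COL.
Proof.
move=> H; exists (fun=> Star) => cl fc t tN; apply/negP => S.
have [s E] := forb_gad fc; move: S; rewrite E all_cat sat_gadA.
by rewrite (negbTE (H _)).
Qed.

Lemma COL_hubs e e' i : COL -> emb e -> emb e' -> i < nH -> e i = e' i.
Proof.
move=> [c H] He He' iH; apply/eqP; apply: contraT => ne.
have hH : nH <= nG by rewrite /ngad leq_addr.
have := H _ (forb_hub iH) (asg (fun k => if k == 0 then e else e') id (fun _ => id) (fun _ => id)) (asg_lt _ _ _ _).
have E k j : k < 2 -> j < nG -> asg (fun k => if k == 0 then e else e') id (fun _ => id) (fun _ => id) (hubn k j) =
    if k == 0 then e j else e' j.
  move=> k2 jG; rewrite asg_nm /=; [|lia..].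
  by case: (k == 0); rewrite ifT //; apply: emb_lt.
have iG : i < nG by apply: leq_trans hH.
move: (asg _ _ _ _) E => t E /negP; case; rewrite !all_cat; apply/and3P; split.
- by rewrite sat_gadA (@emb_ext _ e) // => j jG; rewrite E.
- by rewrite sat_gadA (@emb_ext _ e') // => j jG; rewrite E.
- by rewrite all_seq1 /asat !E // ne.
Qed.

Lemma nS_num s : s < 18 -> s < nS. Proof. by move=> H; apply: nS_le; lia. Qed.

Lemma nS_port j : j < K -> 18 + j < nS. Proof. by move=> H; apply: nS_le; lia. Qed.

(** * Patterns in graphs whose hubs are unique *)

Section UniqueHubs.
Variable a : nat -> nat.
Hypotheses (K0 : 0 < K) (emba : emb a) (uniqa : forall e, emb e -> forall i, i < nH -> e i = a i).

Let hG : nH <= nG. Proof. by rewrite /ngad leq_addr. Qed.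

Lemma srt_lt u s : srt a u s -> u < N.
Proof. by case/and3P => /adj_lt/andP[]. Qed.

(** What the colourless patterns come to once the hubs are known: a property of the graph alone,
    which can be decided without colours. *)
Definition regular : Prop :=
  [/\ forall u s s', s < nS -> s' < nS -> srt a u s -> srt a u s' -> s = s',
      forall u v, knd a 0 u -> knd a 0 v -> u = v,
      forall u v v', suc a u v -> suc a u v' -> v = v',
      forall j v u u', j < K -> dig a v j u -> dig a v j u' -> u = u' &
      forall v v' (u : nat -> nat), (forall j, j < K -> dig a v j (u j) && dig a v' j (u j)) -> v = v'].

Definition cel (v : nat) (u sv : nat -> nat) : Prop :=
  svok sv /\ forall j, j < K -> dig a v j (u j) && srt a (u j) (sv j).

Definition LK lo r v v' u u' sv sv' : Prop :=
  [/\ cel v u sv, cel v' u' sv', linkS lo r sv sv' & forall j, j < K ->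
    (lo <= j < r) || (if j == r then adj (u j) (u' j) else u j == u' j)].

Definition good (c : nat -> colour) : Prop :=
  [/\ forall v u sv, cel v u sv -> okc1 sv (c v),
      forall r v v' u u' sv sv', LK 0 r v v' u u' sv sv' -> okc2 sv sv' (c v) (c v'),
      forall r v v' u u' sv sv' k k', LK lob r v v' u u' sv sv' ->
        c v = Comp k -> c v' = Comp k' -> ok4 sv k k' &
      forall r1 r2 r3 v0 v1 v2 v3 u0 u1 u2 u3 sv0 sv1 sv2 sv3 k0 k1 k2 k3,
        LK 0 r1 v0 v1 u0 u1 sv0 sv1 -> LK 0 r2 v1 v2 u1 u2 sv1 sv2 ->
        LK lob r3 v1 v3 u1 u3 sv1 sv3 ->
        c v0 = Comp k0 -> c v1 = Comp k1 -> c v2 = Comp k2 -> c v3 = Comp k3 -> ok3 k0 k1 k2 k3].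

Lemma sat_hubs c t s : all (asat adj c t) (gadA 0 ++ s) ->
  (forall i, i < nH -> t (hubn 0 i) = a i) /\ all (asat adj c t) s.
Proof. by rewrite all_cat (sat_gadA c t 0) => /andP[/uniqa]. Qed.

Lemma sat_srt c t v s : (forall i, i < nH -> t (hubn 0 i) = a i) -> s < nS ->
  all (asat adj c t) (srtA v s) = srt a (t v) s.
Proof. by move=> H sS; rewrite sat_srtA (srt_ext _ H). Qed.

Lemma sat_cel c t cc sv : (forall i, i < nH -> t (hubn 0 i) = a i) -> (forall n, t n < N) ->
  svok sv -> all (asat adj c t) (cellA cc sv) -> cel (t (celln cc)) (fun j => t (numn cc j)) sv.
Proof.
move=> H tN so; rewrite sat_cellA (srt_ext _ H) ?nS_le // => /andP[Hc /allP HK].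
split=> // j jK; have := HK j; rewrite mem_iota add0n jK => /(_ isT) /and4P[H1 H2 H3 H4].
have sj := (so j).1.
rewrite (srt_ext _ H) in H2; last by apply: nS_le; lia.
rewrite H2 andbT /dig Hc andTb; apply/andP; split; first by apply/hasP; exists (sv j); rewrite ?mem_iota ?add0n.
apply/hasP; exists (t (portn cc j)); first by rewrite mem_iota add0n tN.
by rewrite H3 H4 !andbT -(srt_ext _ H) //; apply: nS_le; lia.
Qed.

Lemma sat_LK c t lo r cc cc' sv sv' : (forall i, i < nH -> t (hubn 0 i) = a i) ->
  (forall n, t n < N) -> svok sv -> svok sv' -> linkS lo r sv sv' ->
  all (asat adj c t) (cellA cc sv) -> all (asat adj c t) (cellA cc' sv') ->
  all (asat adj c t) (linkA lo r cc cc') ->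
  LK lo r (t (celln cc)) (t (celln cc')) (fun j => t (numn cc j)) (fun j => t (numn cc' j)) sv sv'.
Proof.
move=> H tN so so' l /(sat_cel H tN so) C1 /(sat_cel H tN so') C2; rewrite sat_linkA => /allP L.
by split=> // j jK; apply: L; rewrite mem_iota add0n.
Qed.

Lemma good_avoids c : regular -> good c ->
  forall cl, forb cl -> forall t : name -> nat, (forall n, t n < N) -> ~~ all (asat adj c t) cl.
Proof.
move=> [R1 R2 R3 R4 R5] [G1 G2 G3 G4] cl fc t tN; apply/negP; case: fc => {cl}.
- move=> i iH; rewrite !all_cat => /and3P[S0 S1]; rewrite all_seq1 /asat.
  rewrite sat_gadA in S0; rewrite sat_gadA in S1; have E1 := uniqa S0; have E2 := uniqa S1.
  by rewrite (E1 i iH) (E2 i iH) eqxx.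
- move=> s s' sS sS' ne /sat_hubs[H]; rewrite all_cat !(sat_srt _ _ H) // => /andP[S1 S2].
  exact: ne (R1 _ _ _ sS sS' S1 S2).
- move=> s s' s18 s18' k0 k0' /sat_hubs[H]; rewrite !all_cat all_seq1 !(sat_srt _ _ H) ?nS_le //; try lia.
  move=> /and3P[S1 S2 /= /eqP]; apply; apply: R2; rewrite /knd; apply/hasP.
  + by exists s; rewrite ?mem_iota ?add0n ?k0 ?S1.
  + by exists s'; rewrite ?mem_iota ?add0n ?k0' ?S2.
- move=> s1 s2 t1 t2 l1 l2 l3 l4 c1 c2 /sat_hubs[H]; rewrite !all_cat !(sat_srt _ _ H) ?nS_le //; try lia.
  move=> /and5P[S1 S2 S3 S4 /= /and4P[A1 A2 /eqP ne _]]; apply: ne; apply: (R3 (t (celln 0))).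
  + rewrite /suc A1 andTb; apply/hasP; exists s1; rewrite ?mem_iota ?add0n //.
    by apply/hasP; exists t1; rewrite ?mem_iota ?add0n ?c1 ?S1.
  + rewrite /suc A2 andTb; apply/hasP; exists s2; rewrite ?mem_iota ?add0n //.
    by apply/hasP; exists t2; rewrite ?mem_iota ?add0n ?c2 ?S2.
- move=> j s s' jK l1 l2 /sat_hubs[H]; rewrite !all_cat !(sat_srt _ _ H) ?nS_le //; try lia.
  move=> /and5P[S1 S2 S3 S4 /andP[S5 /= /and5P[A1 A2 A3 A4 /andP[/eqP ne _]]]]; apply: ne.
  apply: (R4 j (t (celln 0))) => //; rewrite /dig S1 andTb; apply/andP; split; apply/hasP.
  + by exists s; rewrite ?mem_iota ?add0n.
  + by exists (t (portn 0 0)); rewrite ?mem_iota ?add0n ?tN ?S4 ?A1.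
  + by exists s'; rewrite ?mem_iota ?add0n.
  + by exists (t (portn 1 0)); rewrite ?mem_iota ?add0n ?tN ?S5 ?A3.
- move=> sv so /sat_hubs[H]; rewrite !all_cat all_seq1 all_map.
  move=> /and4P[/(sat_cel H tN so)[_ C1] /(sat_cel H tN so)[_ C2] /allP E /= /eqP]; apply.
  apply: (R5 _ _ (fun j => t (numn 0 j))) => j jK.
  have /andP[-> _] := C1 j jK; have /andP[] := C2 j jK.
  by have := E j; rewrite mem_iota add0n jK => /(_ isT) /= /eqP <- ->.
- move=> sv k so nk /sat_hubs[H]; rewrite all_cat all_seq1 => /andP[/(sat_cel H tN so) C /eqP E].
  by move: nk; rewrite -E (G1 _ _ _ C).
- move=> r sv sv' k k' so so' l nk /sat_hubs[H]; rewrite !all_cat => /and4P[C1 C2 L].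
  move=> /= /and3P[/eqP E1 /eqP E2 _].
  by move: nk; rewrite -E1 -E2 (G2 _ _ _ _ _ _ _ (sat_LK H tN so so' l C1 C2 L)).
- move=> r sv sv' k k' so so' l nk /sat_hubs[H]; rewrite !all_cat => /and4P[C1 C2 L].
  move=> /= /and3P[/eqP E1 /eqP E2 _].
  by move: nk; rewrite (G3 _ _ _ _ _ _ _ _ _ (sat_LK H tN so so' l C1 C2 L) E1 E2).
- move=> r1 r2 r3 sv0 sv1 sv2 sv3 k0 k1 k2 k3 s0 s1 s2 s3 l1 l2 l3 nk /sat_hubs[H].
  rewrite !all_cat => /and5P[C0 C1 C2 C3 /and4P[L1 L2 L3]] /= /and5P[/eqP E0 /eqP E1 /eqP E2 /eqP E3 _].
  have K1 := sat_LK H tN s0 s1 l1 C0 C1 L1; have K2 := sat_LK H tN s1 s2 l2 C1 C2 L2.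
  have K3 := sat_LK H tN s1 s3 l3 C1 C3 L3.
  by move: nk; rewrite (G4 _ _ _ _ _ _ _ _ _ _ _ _ _ _ _ _ _ _ _ K1 K2 K3 E0 E1 E2 E3).
Qed.

Lemma srt_sat c t v s u : (forall i, i < nH -> t (hubn 0 i) = a i) -> t v = u -> s < nS ->
  srt a u s -> all (asat adj c t) (srtA v s).
Proof. by move=> H <- sS; rewrite sat_srt. Qed.

Section Avoid.
Variable c : nat -> colour.
Hypothesis av : forall cl, forb cl -> forall t : name -> nat, (forall n, t n < N) -> ~~ all (asat adj c t) cl.

Lemma avoid_asg V P U s : forb (gadA 0 ++ s) -> ~~ all (asat adj c (asg (fun _ => a) V P U)) s.
Proof.
move=> /av /(_ _ (asg_lt (fun _ => a) V P U)).
have E i : i < nG -> asg (fun _ => a) V P U (hubn 0 i) = a i.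
  by move=> iG; rewrite asg_nm /= ?(emb_lt emba) //; lia.
move: (asg _ _ _ _) E => t E; rewrite all_cat (sat_gadA c t 0).
by rewrite (@emb_ext _ a) ?emba.
Qed.

Lemma asg_hub V P U i : i < nH -> asg (fun _ => a) V P U (hubn 0 i) = a i.
Proof.
by move=> iH; rewrite asg_nm /= ?(emb_lt emba) //; move: hG; lia.
Qed.

Lemma asg_cell V P U cc : cc < 4 -> V cc < N -> asg (fun _ => a) V P U (celln cc) = V cc.
Proof. by move=> c4 VN; rewrite asg_nm //= VN. Qed.

Lemma asg_port V P U cc j : cc < 4 -> j <= K -> P cc j < N -> asg (fun _ => a) V P U (portn cc j) = P cc j.
Proof. by move=> c4 jK PN; rewrite asg_nm //= ?PN //; lia. Qed.

Lemma asg_num V P U cc j : cc < 4 -> j <= K -> U cc j < N -> asg (fun _ => a) V P U (numn cc j) = U cc j.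
Proof. by move=> c4 jK PN; rewrite asg_nm //= ?PN //; lia. Qed.

(** A digit only comes with the existence of a port, whereas an assignment must name one. *)
Definition port v j u := find (fun p => [&& srt a p (18 + j), adj v p & adj p u]) (iota 0 N).

Lemma portP v j u : dig a v j u ->
  [/\ port v j u < N, srt a (port v j u) (18 + j), adj v (port v j u) & adj (port v j u) u].
Proof.
move=> /and3P[_ _ H]; have := H; rewrite has_find size_iota => L.
by have := nth_find 0 H; rewrite nth_iota // add0n => /and3P[].
Qed.

Lemma sat_asg_cel V P U cc sv : cc < 4 -> cel (V cc) (U cc) sv ->
  (forall j, P cc j = port (V cc) j (U cc j)) ->
  all (asat adj c (asg (fun _ => a) V P U)) (cellA cc sv).
Proof.
move=> c4 [so C] HP.
have H := asg_hub V P U.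
have /andP[/and3P[C0 _ _] _] := C 0 K0.
have tc : asg (fun _ => a) V P U (celln cc) = V cc by apply: asg_cell => //; apply: srt_lt C0.
have tp0 j := @asg_port V P U cc j c4; have tn0 j := @asg_num V P U cc j c4.
move: (asg _ _ _ _) H tc tp0 tn0 => t H tc tp0 tn0.
rewrite sat_cellA (srt_ext _ H) ?nS_le // tc C0 /=; apply/allP => j; rewrite mem_iota add0n => /andP[_ jK].
have /andP[D S] := C j jK; have [p1 p2 p3 p4] := portP D; have sj := (so j).1.
have tp : t (portn cc j) = port (V cc) j (U cc j) by rewrite tp0 ?HP // ltnW.
have tn : t (numn cc j) = U cc j by apply: tn0 => //; [apply: ltnW|apply: srt_lt S].
by rewrite (srt_ext _ H (nS_port jK)) (srt_ext _ H (nS_num sj)) tp tn p2 S p3.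
Qed.

Lemma sat_asg_link V P U lo r cc cc' : cc < 4 -> cc' < 4 ->
  (forall j, j < K -> U cc j < N /\ U cc' j < N) ->
  (forall j, j < K -> (lo <= j < r) || (if j == r then adj (U cc j) (U cc' j) else U cc j == U cc' j)) ->
  all (asat adj c (asg (fun _ => a) V P U)) (linkA lo r cc cc').
Proof.
move=> c4 c4' UN H; rewrite sat_linkA; apply/allP => j; rewrite mem_iota add0n => /andP[_ jK].
by have [U1 U2] := UN j jK; rewrite !asg_num ?H // ltnW.
Qed.

Lemma avoid_asg_ex V P (U : nat -> nat -> nat) : exists t : name -> nat,
  [/\ forall s, forb (gadA 0 ++ s) -> ~~ all (asat adj c t) s,
      forall i, i < nH -> t (hubn 0 i) = a i,
      forall cc, cc < 4 -> V cc < N -> t (celln cc) = V cc &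
      forall cc j, cc < 4 -> j <= K -> P cc j < N -> t (portn cc j) = P cc j].
Proof.
exists (asg (fun _ => a) V P U); split.
- by move=> s; apply: avoid_asg.
- exact: asg_hub.
- by move=> cc; apply: asg_cell.
- by move=> cc j; apply: asg_port.
Qed.

Lemma cel_lt v u sv : cel v u sv -> v < N /\ forall j, j < K -> u j < N.
Proof.
move=> [_ C]; split=> [|j jK]; last by have /andP[_ /srt_lt] := C j jK.
by have /andP[/and3P[/srt_lt]] := C 0 K0.
Qed.

Lemma avoid_good : good c.
Proof.
pose sel (T : Type) (x0 x1 x2 x3 : T) (i : nat) := match i with 0 => x0 | 1 => x1 | 2 => x2 | _ => x3 end.
pose P (V : nat -> nat) (U : nat -> nat -> nat) i j := port (V i) j (U i j).
split.
- move=> v u sv C; apply: contraT => nk; have [vN uN] := cel_lt C.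
  pose V (_ : nat) := v; pose U (_ : nat) := u.
  have /negP := avoid_asg V (P V U) U (forb_one C.1 nk); case.
  by rewrite all_cat sat_asg_cel // all_seq1 /= asg_cell.
- move=> r v v' u u' sv sv' [C C' l H]; apply: contraT => nk.
  have [vN uN] := cel_lt C; have [vN' uN'] := cel_lt C'.
  pose V := sel _ v v' 0 0; pose U := sel _ u u' u u.
  have /negP := avoid_asg V (P V U) U (forb_two C.1 C'.1 l nk); case.
  rewrite !all_cat !sat_asg_cel // sat_asg_link //; last by move=> j jK; split; [apply: uN|apply: uN'].
  by rewrite /= !asg_cell // !eqxx.
- move=> r v v' u u' sv sv' k k' [C C' l H] E E'; apply: contraT => nk.
  have [vN uN] := cel_lt C; have [vN' uN'] := cel_lt C'.
  pose V := sel _ v v' 0 0; pose U := sel _ u u' u u.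
  have /negP := avoid_asg V (P V U) U (forb_down C.1 C'.1 l nk); case.
  rewrite !all_cat !sat_asg_cel // sat_asg_link //; last by move=> j jK; split; [apply: uN|apply: uN'].
  by rewrite /= !asg_cell // E E' !eqxx.
- move=> r1 r2 r3 v0 v1 v2 v3 u0 u1 u2 u3 sv0 sv1 sv2 sv3 k0 k1 k2 k3.
  move=> [C0 C1 l1 H1] [_ C2 l2 H2] [_ C3 l3 H3] E0 E1 E2 E3; apply: contraT => nk.
  have [v0N u0N] := cel_lt C0; have [v1N u1N] := cel_lt C1.
  have [v2N u2N] := cel_lt C2; have [v3N u3N] := cel_lt C3.
  pose V := sel _ v0 v1 v2 v3; pose U := sel _ u0 u1 u2 u3.
  have /negP := avoid_asg V (P V U) U (forb_step C0.1 C1.1 C2.1 C3.1 l1 l2 l3 nk); case.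
  rewrite !all_cat !sat_asg_cel // !sat_asg_link //; try by move=> j jK; split; auto.
  by rewrite /= !asg_cell // E0 E1 E2 E3 !eqxx.
Qed.

Lemma avoid_regular : regular.
Proof.
pose sel (x0 x1 x2 x3 : nat) (i : nat) := match i with 0 => x0 | 1 => x1 | 2 => x2 | _ => x3 end.
split.
- move=> u s s' sS sS' S1 S2; apply/eqP; apply: contraT => /eqP ne; have uN := srt_lt S1.
  pose V (_ : nat) := u; pose U (_ _ : nat) := 0.
  have [t [F H Hc _]] := avoid_asg_ex V U U; have /negP := F _ (forb_sort sS sS' ne); case.
  by rewrite all_cat !(sat_srt _ _ H) // Hc // S1.
- move=> u v /hasP[s]; rewrite mem_iota add0n => /andP[_ l1] /andP[/eqP k1 S1].
  move=> /hasP[s']; rewrite mem_iota add0n => /andP[_ l2] /andP[/eqP k2 S2].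
  apply/eqP; apply: contraT => ne; have uN := srt_lt S1; have vN := srt_lt S2.
  pose V := sel u v 0 0; pose U (_ _ : nat) := 0.
  have [t [F H Hc _]] := avoid_asg_ex V U U; have /negP := F _ (forb_zero l1 l2 k1 k2); case.
  have c0 := Hc 0 isT uN; have c1 := Hc 1 isT vN.
  rewrite !all_cat; apply/and3P; split.
  + exact: (srt_sat _ H c0 (nS_num l1) S1).
  + exact: (srt_sat _ H c1 (nS_num l2) S2).
  + by rewrite /= c0 c1 andbT.
- move=> u v v' /andP[A1 /hasP[s]]; rewrite mem_iota add0n => /andP[_ l1] /hasP[s'].
  rewrite mem_iota add0n => /andP[_ l2] /and3P[c1 S1 T1].
  move=> /andP[A2 /hasP[q]]; rewrite mem_iota add0n => /andP[_ l3] /hasP[q'].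
  rewrite mem_iota add0n => /andP[_ l4] /and3P[c2 S2 T2].
  apply/eqP; apply: contraT => ne; have uN := srt_lt S1; have vN := srt_lt T1; have vN' := srt_lt T2.
  pose V := sel u v v' 0; pose U (_ _ : nat) := 0.
  have [t [F H Hc _]] := avoid_asg_ex V U U; have /negP := F _ (forb_suc l1 l3 l2 l4 c1 c2); case.
  have d0 := Hc 0 isT uN; have d1 := Hc 1 isT vN; have d2 := Hc 2 isT vN'.
  rewrite !all_cat; apply/and5P; split.
  + exact: (srt_sat _ H d0 (nS_num l1) S1).
  + exact: (srt_sat _ H d0 (nS_num l3) S2).
  + exact: (srt_sat _ H d1 (nS_num l2) T1).
  + exact: (srt_sat _ H d2 (nS_num l4) T2).
  + by rewrite /= d0 d1 d2 A1 A2 ne.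
- move=> j v u u' jK /and3P[S1 /hasP[s]]; rewrite mem_iota add0n => /andP[_ l1] S2.
  move=> /hasP[p]; rewrite mem_iota add0n => /andP[_ pN] /and3P[S3 A1 A2].
  move=> /and3P[_ /hasP[s']]; rewrite mem_iota add0n => /andP[_ l2] S4.
  move=> /hasP[p']; rewrite mem_iota add0n => /andP[_ pN'] /and3P[S5 A3 A4].
  apply/eqP; apply: contraT => ne; have vN := srt_lt S1; have uN := srt_lt S2; have uN' := srt_lt S4.
  pose V := sel v u u' 0; pose P (i _ : nat) := sel p p' 0 0 i; pose U (_ _ : nat) := 0.
  have [t [F H Hc Hp]] := avoid_asg_ex V P U; have /negP := F _ (forb_dig jK l1 l2); case.
  have d0 := Hc 0 isT vN; have d1 := Hc 1 isT uN; have d2 := Hc 2 isT uN'.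
  have p0 := Hp 0 0 isT (leq0n _) pN; have p1 := Hp 1 0 isT (leq0n _) pN'.
  rewrite !all_cat; apply/and5P; split; last (apply/andP; split).
  + exact: (srt_sat _ H d0 (nS_le (leqnn _)) S1).
  + exact: (srt_sat _ H d1 (nS_num l1) S2).
  + exact: (srt_sat _ H d2 (nS_num l2) S4).
  + exact: (srt_sat _ H p0 (nS_port jK) S3).
  + exact: (srt_sat _ H p1 (nS_port jK) S5).
  + by rewrite /= d0 d1 d2 p0 p1 A1 A2 A3 A4 ne.
- move=> v v' u H; apply/eqP; apply: contraT => ne.
  (* The pattern has to name the sorts of the common digits; the least sort of each will do, with 0
     beyond [K] as [svok] demands. *)
  pose sv j := if j < K then find (srt a (u j)) (iota 0 18) else 0.
  have C w : (forall j, j < K -> dig a w j (u j)) -> cel w u sv.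
    move=> D; split=> j.
      split; last by rewrite /sv ltnNge => ->.
      rewrite /sv; case: ifP => // jK; have /and3P[_ X _] := D j jK.
      by move: X; rewrite has_find size_iota.
    move=> jK; rewrite D //= /sv jK; have /and3P[_ X _] := D j jK.
    by have := nth_find 0 X; rewrite nth_iota //; move: X; rewrite has_find size_iota.
  have C1 : cel v u sv by apply: C => j /H/andP[].
  have C2 : cel v' u sv by apply: C => j /H/andP[].
  have [vN uN] := cel_lt C1; have [vN' _] := cel_lt C2.
  pose V := sel v v' 0 0; pose U (_ : nat) := u; pose P i j := port (V i) j (U i j).
  have /negP := avoid_asg V P U (forb_cell C1.1); case.
  rewrite !all_cat !sat_asg_cel // all_seq1 /= !asg_cell // ne andbT all_map.
  by apply/allP => j; rewrite mem_iota add0n => /andP[_ jK] /=; rewrite !asg_num ?uN // ltnW.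
Qed.

End Avoid.

Lemma COL_good : COL <-> regular /\ exists c, good c.
Proof.
split=> [[c av]|[R [c G]]]; last by exists c; apply: good_avoids.
by split; [apply: avoid_regular av|exists c; apply: avoid_good].
Qed.

End UniqueHubs.
End Clauses.

(** * The chain of cells *)

Section Chain.
Variables (K lob : nat) (Blk : finType).
Variables (ok1 : (nat -> nat) -> Blk -> bool) (ok2 : (nat -> nat) -> (nat -> nat) -> Blk -> Blk -> bool).
Variables (ok3 : Blk -> Blk -> Blk -> Blk -> bool) (ok4 : (nat -> nat) -> Blk -> Blk -> bool).
Variables (N : nat) (adj : rel nat) (a : nat -> nat).
Hypotheses (K0 : 0 < K) (lobK : lob < K).
Hypothesis reg : regular K N adj a.

Notation srt := (srt K adj a).
Notation knd := (knd K adj a).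
Notation suc := (suc K adj a).
Notation dig := (dig K N adj a).
Notation cel := (cel K N adj a).
Notation LK := (LK K N adj a).
Notation good := (good K lob ok1 ok2 ok3 ok4 N adj a).

Definition perfect (B : nat) (nu : nat -> nat) : Prop :=
  [/\ 1 < B, knd 0 (nu 0), forall i, i.+1 < B -> suc (nu i) (nu i.+1), knd 2 (nu B.-1) &
      forall e, e < B ^ K -> exists v, forall j, j < K -> dig v j (nu (dgt B e j))].

Lemma kndP k u : reflect (exists2 s, s < 18 & kd s = k /\ srt u s) (knd k u).
Proof.
apply: (iffP hasP) => [[s]|[s s18 [kk S]]].
  by rewrite mem_iota add0n => /andP[_ s18] /andP[/eqP kk S]; exists s.
by exists s; [rewrite mem_iota add0n|rewrite kk eqxx].
Qed.

Lemma sucP u v : reflect (exists s s', [/\ s < 18, s' < 18, cmp s s', srt u s & srt v s'] /\ adj u v) (suc u v).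
Proof.
apply: (iffP andP) => [[A /hasP[s]]|[s [s' [[s18 s18' c S S'] A]]]].
  rewrite mem_iota add0n => /andP[_ s18] /hasP[s'].
  by rewrite mem_iota add0n => /andP[_ s18'] /and3P[c S S']; exists s, s'.
split=> //; apply/hasP; exists s; first by rewrite mem_iota add0n.
by apply/hasP; exists s'; rewrite ?mem_iota ?add0n ?c ?S.
Qed.

Lemma num_lt s : s < 18 -> s < nsorts K. Proof. by rewrite /nsorts; lia. Qed.

Lemma sort_uniq u s s' : s < 18 -> s' < 18 -> srt u s -> srt u s' -> s = s'.
Proof. by move=> /num_lt l /num_lt l'; case: reg => H _ _ _ _; apply: H. Qed.

Lemma knd_srt k u s : s < 18 -> srt u s -> knd k u -> kd s = k.
Proof. by move=> l S /kndP[s' l' [<- S']]; rewrite (sort_uniq l l' S S'). Qed.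

Lemma suc_not2 u v : suc u v -> ~~ knd 2 u.
Proof.
move=> /sucP[s [s' [[l l' /and3P[n2 _ _] S S'] _]]]; apply/negP => H.
by move: n2; rewrite (knd_srt l S H).
Qed.

Lemma suc_not0 u v : suc u v -> ~~ knd 0 v.
Proof.
move=> /sucP[s [s' [[l l' /and3P[_ n0 _] S S'] _]]]; apply/negP => H.
by move: n0; rewrite (knd_srt l' S' H).
Qed.

(** The colouring condition freed from the graph: blocks indexed by codes, which see the graph only
    through the sorts of digits. *)
Definition TAB (B : nat) (sv : nat -> nat -> nat) : Prop := exists blk : nat -> Blk,
  [/\ forall e, e < B ^ K -> ok1 (sv e) (blk e),
      forall e, e.+1 < B ^ K -> ok2 (sv e) (sv e.+1) (blk e) (blk e.+1),
      forall e, e + B ^ lob < B ^ K -> ok4 (sv e) (blk e) (blk (e + B ^ lob)) &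
      forall e, 0 < e -> e + B ^ lob < B ^ K -> ok3 (blk e.-1) (blk e) (blk e.+1) (blk (e + B ^ lob))].

Section OnChain.
Variables (B : nat) (nu : nat -> nat).
Hypotheses (B1 : 1 < B) (nu0 : knd 0 (nu 0)) (nuS : forall i, i.+1 < B -> suc (nu i) (nu i.+1))
  (nuM : knd 2 (nu B.-1)).

Lemma nu_knd2 i : i < B -> knd 2 (nu i) = (i == B.-1).
Proof.
move=> iB; apply/idP/eqP => [H|-> //]; apply/eqP; apply: contraTT H => ne.
by apply: suc_not2 (nuS _); lia.
Qed.

Lemma nu_knd0 i : i < B -> knd 0 (nu i) = (i == 0).
Proof.
move=> iB; apply/idP/eqP => [H|-> //]; apply/eqP; apply: contraTT H => ne.
have -> : i = i.-1.+1 by lia.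
by apply: suc_not0 (nuS _); lia.
Qed.

(** Successors are unique, so a repetition could be shifted along the path until the later index is
    the last; the earlier one would then be a last number inside the path. *)
Lemma nu_inj i j : i < B -> j < B -> nu i = nu j -> i = j.
Proof.
wlog ij : i j / i < j.
  by move=> H iB jB E; case: (ltngtP i j) => // L; [apply: H|apply/esym/H].
move=> iB jB E; have H k : j + k < B -> nu (i + k) = nu (j + k).
  elim: k => [|k IH] L; first by rewrite !addn0.
  case: reg => _ _ R _ _; apply: (R (nu (j + k))).
    by rewrite -IH ?addnS; [apply: nuS; lia|lia].
  by rewrite addnS; apply: nuS; lia.
have L : j + (B.-1 - j) < B by lia.
have := nu_knd2 L; rewrite -H // nu_knd2; last by lia.
by rewrite subnKC; lia.
Qed.

Lemma nu_srt i : i < B -> exists2 s, s < 18 & srt (nu i) s.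
Proof.
move=> iB; case: (ltnP i.+1 B) => L; first by have /sucP[s [s' [[? ? _ ? _] _]]] := nuS L; exists s.
have E : i = B.-1 by lia.
by move: nuM; rewrite -E => /kndP[s l [_ S]]; exists s.
Qed.

Definition ns (i : nat) : nat := find (srt (nu i)) (iota 0 18).

Lemma nsP i : i < B -> ns i < 18 /\ srt (nu i) (ns i).
Proof.
move=> iB; have [s l S] := nu_srt iB.
have H : has (srt (nu i)) (iota 0 18) by apply/hasP; exists s; rewrite ?mem_iota ?add0n.
have L := H; rewrite has_find size_iota in L; split=> //.
by have := nth_find 0 H; rewrite nth_iota.
Qed.

Lemma ns_kd0 i : i < B -> (kd (ns i) == 0) = (i == 0).
Proof.
move=> iB; have [l S] := nsP iB; rewrite -(nu_knd0 iB); apply/eqP/idP => [k|]; last exact: knd_srt.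
by apply/kndP; exists (ns i).
Qed.

Lemma ns_kd2 i : i < B -> (kd (ns i) == 2) = (i == B.-1).
Proof.
move=> iB; have [l S] := nsP iB; rewrite -(nu_knd2 iB); apply/eqP/idP => [k|]; last exact: knd_srt.
by apply/kndP; exists (ns i).
Qed.

Definition atcode (v e : nat) : Prop := forall j, j < K -> dig v j (nu (dgt B e j)).

Definition sve (e j : nat) : nat := if j < K then ns (dgt B e j) else 0.

Let dB e j : dgt B e j < B. Proof. by apply: dgt_lt; lia. Qed.

Lemma cel_atcode v e : atcode v e -> cel v (fun j => nu (dgt B e j)) (sve e).
Proof.
move=> H; split=> j; rewrite /sve; last by move=> jK; rewrite jK H //=; case: (nsP (dB e j)).
by case: (ltnP j K) => jK; split=> //; case: (nsP (dB e j)).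
Qed.

Lemma atcode_cel v e u sv : atcode v e -> cel v u sv ->
  (forall j, j < K -> u j = nu (dgt B e j)) /\ sv = sve e.
Proof.
move=> H [so C].
have Hu j : j < K -> u j = nu (dgt B e j).
  move=> jK; have /andP[D _] := C j jK; case: reg => _ _ _ R _; exact: R jK D (H j jK).
split=> //; apply: functional_extensionality => j; rewrite /sve; have [l0 l1] := so j.
case: (ltnP j K) => jK; last by rewrite l1.
have /andP[_ S] := C j jK; rewrite Hu // in S; have [l' S'] := nsP (dB e j).
exact: sort_uniq S S'.
Qed.

Lemma atcode_inj v v' e : atcode v e -> atcode v' e -> v = v'.
Proof.
move=> H H'; case: reg => _ _ _ _ R; apply: (R _ _ (fun j => nu (dgt B e j))) => j jK.
by rewrite H ?H'.
Qed.

Lemma atcode_uniq v e e' : e < B ^ K -> e' < B ^ K -> atcode v e -> atcode v e' -> e = e'.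
Proof.
move=> l l' H H'; apply: (dgt_eq_all l l') => j jK; apply: nu_inj => //.
case: reg => _ _ _ R _; exact: R jK (H j jK) (H' j jK).
Qed.

(* The digits of a linked cell are read off the link, hence so is its code. *)
Lemma LK_code lo r v v' u u' sv sv' e : e < B ^ K -> atcode v e -> LK lo r v v' u u' sv sv' ->
  e + B ^ lo < B ^ K /\ atcode v' (e + B ^ lo).
Proof.
move=> eB H [C C' [/andP[lr rK] l] A]; have [Hu Hs] := atcode_cel H C; case: C' => so' C'.
have HB : 0 < B by lia.
have D j : j < K -> exists i, [/\ i < B, u' j = nu i & if j < lo then i = dgt B e j else
    if j < r then dgt B e j = B.-1 /\ i = 0 else if j == r then i = (dgt B e j).+1 else i = dgt B e j].
  move=> jK; have Aj := A j jK; have [l1 l2] := l j jK; have [s18 _] := so' j.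
  have /andP[_ S'] := C' j jK.
  case: (ltnP j lo) => jlo.
    exists (dgt B e j); split=> //; rewrite -Hu //; move: Aj; rewrite leqNgt jlo /=.
    by rewrite ifN; [move/eqP|apply/eqP; lia].
  case: (ltnP j r) => jr.
    have [|k2 k0] := l1; first by rewrite jlo.
    exists 0; split=> //.
      case: reg => _ R _ _ _; apply: R => //; apply/kndP; exists (sv' j) => //.
    split=> //; move: k2; rewrite Hs /sve jK => /eqP; rewrite ns_kd2 // => /eqP //.
  case: eqP => E; last first.
    exists (dgt B e j); split=> //; rewrite -Hu //; move: Aj; rewrite ltnNge jr andbF /=.
    by rewrite (introF eqP E) => /eqP.
  have cm := l2 E; rewrite Hs /sve jK in cm; have [n18 nS] := nsP (dB e j).
  have sc : suc (nu (dgt B e j)) (u' j).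
    apply/sucP; exists (ns (dgt B e j)), (sv' j); split=> //.
    by move: Aj; rewrite E eqxx ltnn andbF /= -E Hu.
  have L : (dgt B e j).+1 < B.
    have := suc_not2 sc; rewrite nu_knd2 //; have := dB e j; lia.
  exists (dgt B e j).+1; split=> //; case: reg => _ _ R _ _; apply: R sc (nuS L).
have /ClassicalEpsilon.constructive_indefinite_description[d Hd] :
    exists d : nat -> nat, forall j, j < K -> [/\ d j < B, u' j = nu (d j) & if j < lo then d j = dgt B e j else
    if j < r then dgt B e j = B.-1 /\ d j = 0 else if j == r then d j = (dgt B e j).+1 else d j = dgt B e j].
  exists (fun j => if excluded_middle_informative (j < K) is left jK
     then proj1_sig (constructive_indefinite_description _ (D j jK)) else 0) => j jK.
  case: excluded_middle_informative => // jK'; exact: proj2_sig (constructive_indefinite_description _ (D j jK')).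
have dl : forall j, j < K -> d j < B by move=> j /Hd[].
have lnk : link B lo r K (dgt B e) d by move=> j /Hd[_ _].
have E : cod B K d = e + B ^ lo by rewrite (link_cod HB _ lnk) ?lr // cod_dgt.
split; first by rewrite -E; apply: cod_lt.
move=> j jK; rewrite -E dgt_cod //; have [_ <- _] := Hd j jK.
by have /andP[] := C' j jK.
Qed.

Lemma code_LK lo v v' e : e + B ^ lo < B ^ K -> atcode v e -> atcode v' (e + B ^ lo) ->
  exists r, LK lo r v v' (fun j => nu (dgt B e j)) (fun j => nu (dgt B (e + B ^ lo) j)) (sve e) (sve (e + B ^ lo)).
Proof.
move=> eB H H'; have [r rK L] := link_ex B1 eB; exists r; split; try exact: cel_atcode.
- split=> // j jK; have := L j jK; rewrite /sve jK => Lj; split=> [/andP[l1 l2]|E].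
    move: Lj; rewrite ltnNge l1 /= l2 => -[-> ->]; split; apply/eqP.
      by rewrite ns_kd2 //; lia.
    by rewrite ns_kd0 //; lia.
  move: Lj; rewrite E; have -> : r < lo = false by lia.
  rewrite ltnn eqxx => Lj; have dl := dB (e + B ^ lo) r; rewrite Lj in dl *.
  have /sucP[s [s' [[l1 l2 c S S'] _]]] := nuS dl.
  have [l3 S3] := nsP (dB e r); have [l4 S4] := nsP dl.
  by rewrite -(sort_uniq l1 l3 S S3) -(sort_uniq l2 l4 S' S4).
- move=> j jK; have := L j jK; case: (ltnP j lo) => jlo /=.
    by move=> ->; rewrite ifN //; apply/eqP; lia.
  case: (ltnP j r) => jr //=; case: eqP => [->|_ ->]; last by [].
  move=> Lj; have dl := dB (e + B ^ lo) r; rewrite Lj in dl *.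
  by have /sucP[s [s' [_ ->]]] := nuS dl.
Qed.

Lemma sve_all k e : e < B ^ K -> all (fun j => kd (sve e j) == k) (iota 0 K) =
  all (fun j => kd (ns (dgt B e j)) == k) (iota 0 K).
Proof.
by move=> _; apply: eq_in_all => j; rewrite mem_iota add0n => /andP[_ jK]; rewrite /sve jK.
Qed.

Lemma sve_first e : e < B ^ K -> all (fun j => kd (sve e j) == 0) (iota 0 K) = (e == 0).
Proof.
move=> eB; rewrite sve_all //; apply/allP/eqP => [H|-> j]; last first.
  by rewrite mem_iota add0n => /andP[_ jK]; rewrite ns_kd0 // dgt_zero.
apply: (dgt_eq_all eB) => [|j jK]; first by rewrite expn_gt0; lia.
by rewrite dgt_zero; apply/eqP; rewrite -ns_kd0 // H // mem_iota add0n.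
Qed.

Lemma sve_last e : e < B ^ K -> all (fun j => kd (sve e j) == 2) (iota 0 K) = (e == (B ^ K).-1).
Proof.
move=> eB; rewrite sve_all //; apply/allP/eqP => [H|-> j]; last first.
  by rewrite mem_iota add0n => /andP[_ jK]; rewrite ns_kd2 // dgt_max.
apply: (dgt_eq_all eB) => [|j jK]; first by lia.
by rewrite dgt_max //; apply/eqP; rewrite -ns_kd2 // H // mem_iota add0n.
Qed.

Hypothesis full : forall e, e < B ^ K -> exists v, atcode v e.

Let BK0 : 0 < B ^ K. Proof. by rewrite expn_gt0; lia. Qed.

Lemma good_TAB : (exists c, good c) -> TAB B sve.
Proof.
move=> [c [G1 G2 G3 G4]].
have next v v' e : e.+1 < B ^ K -> atcode v e -> atcode v' e.+1 -> okc2 ok2 (sve e) (sve e.+1) (c v) (c v').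
  move=> eB H H'; have := @code_LK 0 v v' e; rewrite expn0 addn1 => /(_ eB H H') [r L].
  exact: G2 L.
have first v : atcode v 0 -> c v <> None.
  move=> H; have := G1 _ _ _ (cel_atcode H); rewrite /okc1 sve_first // eqxx /=.
  by move=> /andP[/eqP].
have noEsc v : atcode v 0 -> c v <> Some None.
  move=> H0 E0.
  have Ha e : e < B ^ K -> forall v, atcode v e -> c v = Some None.
    elim: e => [|e IH] eB w Hw; first by rewrite (atcode_inj Hw H0).
    have [w' Hw'] := full (ltnW eB); have := next _ _ _ eB Hw' Hw.
    by rewrite (IH (ltnW eB) _ Hw') /=; case: (c w) => [[]|].
  have eB : (B ^ K).-1 < B ^ K by lia.
  have [w Hw] := full eB; have := G1 _ _ _ (cel_atcode Hw).
  by rewrite /okc1 sve_last // eqxx (Ha _ eB _ Hw) /= andbF.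
have comp e : e < B ^ K -> forall v, atcode v e -> exists k, c v = Some (Some k).
  elim: e => [|e IH] eB w Hw.
    by case E : (c w) => [[k|]|]; [exists k|case: (noEsc _ Hw)|case: (first _ Hw)].
  have [w' Hw'] := full (ltnW eB); have [k E] := IH (ltnW eB) _ Hw'.
  have := next _ _ _ eB Hw' Hw; rewrite E /=; case: (c w) => [[k'|]|] // _; by exists k'.
pose kap e := if excluded_middle_informative (e < B ^ K) is left H
  then proj1_sig (constructive_indefinite_description _ (full H)) else 0.
have kapP e : e < B ^ K -> atcode (kap e) e.
  move=> H; rewrite /kap; case: excluded_middle_informative => // H'.
  exact: proj2_sig (constructive_indefinite_description _ (full H')).
have [k0 _] := comp 0 BK0 _ (kapP 0 BK0).
exists (fun e => if c (kap e) is Some (Some k) then k else k0).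
have ck e : e < B ^ K -> c (kap e) = Some (Some (if c (kap e) is Some (Some k) then k else k0)).
  by move=> eB; have [k ->] := comp e eB _ (kapP e eB).
split=> e.
- move=> eB; have := G1 _ _ _ (cel_atcode (kapP e eB)); rewrite /okc1 {3}(ck e eB) => /and3P[_ _] //.
- move=> eB; have := next _ _ _ eB (kapP _ (ltnW eB)) (kapP _ eB).
  by rewrite (ck _ eB) (ck _ (ltnW eB)).
- move=> eB; have eB' : e < B ^ K by lia.
  have [r L] := code_LK eB (kapP _ eB') (kapP _ eB).
  exact: G3 L (ck _ eB') (ck _ eB).
- move=> e0 eB; have eB' : e < B ^ K by lia.
  have lo0 : 0 < B ^ lob by rewrite expn_gt0; lia.
  have eB1 : e.+1 < B ^ K by lia.
  have eB2 : e.-1.+1 < B ^ K by lia.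
  have [r3 L3] := code_LK eB (kapP _ eB') (kapP _ eB).
  have := @code_LK 0 (kap e) (kap e.+1) e; rewrite expn0 addn1 => /(_ eB1 (kapP _ eB') (kapP _ eB1)) [r2 L2].
  have := @code_LK 0 (kap e.-1) (kap e.-1.+1) e.-1.
  rewrite expn0 addn1 => /(_ eB2 (kapP _ (ltnW eB2)) (kapP _ eB2)) [r1 L1].
  rewrite prednK // in L1.
  by apply: G4 L1 L2 L3 (ck _ _) (ck _ _) (ck _ _) (ck _ _) => //; lia.
Qed.

Lemma TAB_good : TAB B sve -> exists c, good c.
Proof.
move=> [blk [T1 T2 T3 T4]].
pose c v : colour Blk := if excluded_middle_informative (exists e, e < B ^ K /\ atcode v e) is left H
  then Some (Some (blk (proj1_sig (constructive_indefinite_description _ H)))) else None.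
have cP v e : e < B ^ K -> atcode v e -> c v = Some (Some (blk e)).
  move=> eB H; rewrite /c; case: excluded_middle_informative => [H'|[]]; last by exists e.
  have [l1 l2] := proj2_sig (constructive_indefinite_description _ H').
  by rewrite (atcode_uniq l1 eB l2 H).
have cN v k : c v = Some k -> exists2 e, e < B ^ K & atcode v e /\ k = Some (blk e).
  move=> E; move: (E); rewrite /c; case: excluded_middle_informative => // -[e [l H]] _.
  by exists e => //; split=> //; move: E; rewrite (cP _ _ l H) => -[].
exists c; split.
- move=> v u sv C; rewrite /okc1; case E : (c v) => [k|].
    have [e eB [H Ek]] := cN _ _ E; have [_ ->] := atcode_cel H C.
    by rewrite Ek !implybT T1.
  rewrite !andbT implybT andbT; apply/implyP => /allP Z; exfalso.
  have H : atcode v 0.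
    move=> j jK; rewrite dgt_zero; case: C => so C; have /andP[D S] := C j jK.
    rewrite (_ : nu 0 = u j) //; case: reg => _ R _ _ _; apply: R => //.
    apply/kndP; exists (sv j); first by case: (so j).
    by split=> //; apply/eqP/Z; rewrite mem_iota add0n.
  by rewrite (cP _ _ BK0 H) in E.
- move=> r v v' u u' sv sv' L; case E : (c v) => [k|] //.
  have [e eB [H Ek]] := cN _ _ E; have [eB' H'] := LK_code eB H L.
  rewrite expn0 addn1 in eB' H'; rewrite (cP _ _ eB' H') Ek /=.
  case: L => C C' _ _; have [_ ->] := atcode_cel H C; have [_ ->] := atcode_cel H' C'.
  exact: T2.
- move=> r v v' u u' sv sv' k k' L E E'; have [e eB [H [->]]] := cN _ _ E.
  have [eB' H'] := LK_code eB H L; rewrite (cP _ _ eB' H') in E'; case: E' => <-.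
  by case: L => C _ _ _; have [_ ->] := atcode_cel H C; apply: T3.
- move=> r1 r2 r3 v0 v1 v2 v3 u0 u1 u2 u3 sv0 sv1 sv2 sv3 k0 k1 k2 k3 L1 L2 L3 E0 E1 E2 E3.
  have [e eB [H [->]]] := cN _ _ E0.
  have [eB1 H1] := LK_code eB H L1; rewrite expn0 addn1 in eB1 H1.
  have [eB2 H2] := LK_code eB1 H1 L2; rewrite expn0 addn1 in eB2 H2.
  have [eB3 H3] := LK_code eB1 H1 L3.
  rewrite (cP _ _ eB1 H1) in E1; rewrite (cP _ _ eB2 H2) in E2; rewrite (cP _ _ eB3 H3) in E3.
  case: E1 => <-; case: E2 => <-; case: E3 => <-.
  by have := T4 e.+1 isT eB3.
Qed.

End OnChain.

(** * Broken chains of cells *)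

Inductive Reach : nat -> Prop :=
| Reach0 v u sv : cel v u sv -> (forall j, j < K -> kd (sv j) = 0) -> Reach v
| ReachS r v v' u u' sv sv' : Reach v -> LK 0 r v v' u u' sv sv' -> Reach v'.

Inductive NR : nat -> nat -> Prop :=
| NR0 u : knd 0 u -> NR 0 u
| NRS i u v : NR i u -> suc u v -> NR i.+1 v.

Lemma cel_dig v u sv j w : cel v u sv -> j < K -> dig v j w -> w = u j.
Proof.
move=> [_ C] jK D; have /andP[D' _] := C j jK; case: reg => _ _ _ R _; exact: R jK D D'.
Qed.

Lemma cel_knd v u sv j : cel v u sv -> j < K -> knd (kd (sv j)) (u j).
Proof.
move=> [so C] jK; have /andP[_ S] := C j jK; apply/kndP; exists (sv j) => //; by case: (so j).
Qed.

(** A link keeps a digit, resets it to a first number or advances it along [suc]; in each case it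
    stays reachable. *)
Lemma Reach_NR v j u : Reach v -> j < K -> dig v j u -> exists i, NR i u.
Proof.
move=> R; elim: R j u => {v} [v u sv C Z|r v v' u u' sv sv' _ IH [C C' [/andP[_ rK] l] A]] j w jK D.
  by exists 0; constructor; rewrite (cel_dig C jK D) -(Z j jK); apply: cel_knd C jK.
have Aj := A j jK; have [l1 l2] := l j jK; rewrite (cel_dig C' jK D).
have D0 : dig v j (u j) by case: C => _ C; have /andP[] := C j jK.
case: (ltngtP j r) => jr.
- have [|_ k0] := l1; first by rewrite jr.
  by exists 0; constructor; rewrite -k0; apply: cel_knd C' jK.
- have F : (0 <= j < r) = false by lia.
  move: Aj; rewrite F gtn_eqF //= => /eqP <-; exact: IH D0.
- have [i Hi] := IH _ _ jK D0; exists i.+1; apply: NRS Hi _.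
  have {}Aj : adj (u j) (u' j) by move: Aj; rewrite jr eqxx ltnn andbF.
  case: C => so C; case: C' => so' C'; have /andP[_ S] := C j jK; have /andP[_ S'] := C' j jK.
  apply/sucP; exists (sv j), (sv' j); split=> //; split=> //; try exact: l2.
  + by case: (so j).
  + by case: (so' j).
Qed.

Lemma NR_chain i u : NR i u -> exists nu : nat -> nat,
  [/\ nu i = u, knd 0 (nu 0) & forall k, k < i -> suc (nu k) (nu k.+1)].
Proof.
elim=> {i u} [u Hu|i u v _ [nu [E N0 H]] Hs]; first by exists (fun=> u).
exists (fun k => if k <= i then nu k else v); split; rewrite ?ltnn //.
move=> k ki; rewrite ltnS in ki; rewrite ki; case: (ltnP k i) => L; first exact: H.
have -> : k = i by lia.
by rewrite E.
Qed.

(** The path of numbers that leads to digit 0 of [v] fixes the base [B]. By [LK_code] each link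
    raises the code by 1, so when a cell with only last digits is reached all smaller codes have
    been passed. *)
Lemma Reach_perfect v u sv : Reach v -> cel v u sv -> (forall j, j < K -> kd (sv j) = 2) ->
  exists B nu, perfect B nu.
Proof.
move=> R C Z.
have k2 j : j < K -> knd 2 (u j) by move=> jK; rewrite -(Z j jK); apply: cel_knd C jK.
have D0 : dig v 0 (u 0) by case: C => _ C; have /andP[] := C 0 K0.
have [i Hi] := Reach_NR R K0 D0; have [nu [E n0 nS]] := NR_chain Hi.
pose B := i.+1.
(* If the path had a single number, it would be both first and last, against uniqueness of sorts. *)
have B1 : 1 < B.
  rewrite /B; case: i E {Hi B nS} => // E; have := k2 0 K0; rewrite -E => /kndP[s l [e2 S]].
  by have := knd_srt l S n0; rewrite e2.
have nM : knd 2 (nu B.-1) by rewrite /= E; apply: k2.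
have nuS k : k.+1 < B -> suc (nu k) (nu k.+1) by rewrite /B ltnS => L; apply: nS.
have BK0 : 0 < B ^ K by rewrite expn_gt0.
have H w : Reach w -> exists2 e, e < B ^ K & atcode B nu w e /\
    forall e', e' <= e -> exists w', atcode B nu w' e'.
  elim=> {w} [w uw sw Cw Zw|r w w' uw uw' sw sw' _ [e eB [At Al]] L].
    have A0 : atcode B nu w 0.
      move=> j jK; rewrite dgt_zero; case: (Cw) => _ Cw'; have /andP[D _] := Cw' j jK.
      rewrite (_ : nu 0 = uw j) //; case: reg => _ R0 _ _ _; apply: R0 => //.
      by rewrite -(Zw j jK); apply: cel_knd Cw jK.
    exists 0 => //; split=> // e'; rewrite leqn0 => /eqP ->; by exists w.
  have [eB' At'] := LK_code B1 n0 nuS nM eB At L; rewrite expn0 addn1 in eB' At'.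
  exists e.+1 => //; split=> // e'; rewrite leq_eqVlt => /orP[/eqP ->|]; first by exists w'.
  exact: Al.
have [e eB [At Al]] := H v R.
have [_ Es] := atcode_cel B1 n0 nuS nM At C.
have El : e = (B ^ K).-1.
  apply/eqP; rewrite -(sve_last B1 n0 nuS nM eB) -Es; apply/allP => j.
  by rewrite mem_iota add0n => /andP[_ jK]; rewrite Z.
exists B, nu; split=> // e' eB'; have [|w Hw] := Al e'; first by lia.
by exists w.
Qed.

(** All reachable cells escape. Links preserve reachability, and by [Reach_perfect] no cell with
    only last digits is reachable, so the escape colour is never refused. *)
Lemma not_perfect_good : ~ (exists B nu, perfect B nu) -> exists c, good c.
Proof.
move=> NP.
pose c v : colour Blk := if excluded_middle_informative (Reach v) then Some None else None.
have cS v k : c v <> Some (Some k) by rewrite /c; case: excluded_middle_informative.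
exists c; split.
- move=> v u sv C; rewrite /okc1 /c; case: excluded_middle_informative => R.
    rewrite andbT implybT /=; apply/implyP => /allP Z; case: NP.
    by apply: Reach_perfect R C _ => j jK; apply/eqP/Z; rewrite mem_iota add0n.
  rewrite !andbT implybT andbT; apply/implyP => /allP Z; case: R; apply: Reach0 C _ => j jK.
  by apply/eqP/Z; rewrite mem_iota add0n.
- move=> r v v' u u' sv sv' L; rewrite /c; case: excluded_middle_informative => // R.
  by case: excluded_middle_informative => // -[]; apply: ReachS R L.
- by move=> r v v' u u' sv sv' k k' _ /cS.
- by move=> *; exfalso; eapply cS; eassumption.
Qed.

End Chain.

(** * Colourings and accepting computations *)

Lemma onth_pair_enc x y k : onth (pair_enc x y) k =
  if k < (size x).*2 then (if odd k then onth x k./2 else Some true)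
  else if k < (size x).*2.+2 then Some false else onth y (k - (size x).*2.+2).
Proof.
elim: x k => [|b x IH] k; first by case: k => [|[|k]] //=; rewrite subn2.
case: k => [|[|k]] //=.
by rewrite [LHS](IH k) negbK !ltnS.
Qed.

Lemma size_pair_enc x y : size (pair_enc x y) = (size x).*2.+2 + size y.
Proof.
rewrite /pair_enc !size_cat /= size_flatten /shape -map_comp.
have -> : sumn [seq (size \o (fun b => [:: true; b])) i | i <- x] = (size x).*2 by elim: x => //= b x ->.
lia.
Qed.

(** Turns the guessed part of the input track into a witness string. *)
Lemma onth_prefix (g : nat -> option bool) L : (forall i, g i = None -> g i.+1 = None) -> g L = None ->
  exists2 y, size y <= L & forall i, g i = onth y i.
Proof.
elim: L g => [|L IH] g H HL.
  by exists [::] => // i; rewrite onth0n; elim: i => // i; apply: H.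
case E : (g 0) => [b|].
  have [|y yL Hy] := IH (fun i => g i.+1) _ HL; first by move=> i; apply: H.
  by exists (b :: y) => // -[|i] //=; rewrite Hy.
by exists [::] => // i; rewrite onth0n; elim: i => // i; apply: H.
Qed.

(** * Blocks of cells and the rules between them *)

Section Blocks.
Variables (M1 M2 : TM) (K m z : nat).

Definition pcell (M : TM) : finType := (tcell M * tcell M)%type.
(* A cell stands for two adjacent positions: of the input of the verifier, and of one row of the
   tableaux of the verifier [M1] and of the machine [M2] that bounds the length of the witness. *)
Definition Blk : finType := (option bool * option bool * pcell M1 * pcell M2)%type.

Definition row0 (sv : nat -> nat) : bool := all (fun j => kd (sv j) == 0) (iota m.+1 (K - m.+1)).
Definition rowl (sv : nat -> nat) : bool := all (fun j => kd (sv j) == 2) (iota m.+1 (K - m.+1)).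
(* Rows have [B ^ m.+1] cells; [zn y] holds at the [B ^ y] cells of the first row from position
   [(B - 1) * B ^ m] on, where the input of the verifier starts. *)
Definition zn (y : nat) (sv : nat -> nat) : bool :=
  [&& row0 sv, kd (sv m) == 2 & all (fun j => kd (sv j) == 0) (iota y (m - y))].

Definition iniP (M : TM) (w1 w2 : option bool) (hd : bool) : pcell M :=
  ((wsym M w1, None), (wsym M w2, if hd then Some (@tm_start M) else None)).
Definition stepP (M : TM) (p q r : pcell M) : pcell M := (rho p.2 q.1 q.2, rho q.1 q.2 r.1).
Definition quiet (M : TM) : pcell M := ((None, None), (None, None)).

(** In the first row the initial contents copy the input track, which is empty outside the zone. The
    input begins in the second half of the cell singled out by [zn 0], so the first half of that
    cell is empty. *)
Definition ok1 (sv : nat -> nat) (k : Blk) : bool :=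
  let: (w1, w2, p, q) := k in
  [&& row0 sv ==> ((p == iniP M1 w1 w2 (zn 0 sv)) && (q == iniP M2 w1 w2 (zn 0 sv))),
      (row0 sv && ~~ zn z sv) ==> ((w1 == None) && (w2 == None)),
      zn 0 sv ==> (w1 == None) &
      rowl sv ==> (acc_ok p.1 p.2 && acc_ok q.1 q.2)].

(** On the first [B] cells of the zone digit 0 runs through all numbers, whose bits spell [x]: a
    marker [true] in one cell, the letter in the next, and the separator at the last number.
    Throughout the zone nothing may follow an empty position, so what comes after [x] is a
    string. *)
Definition ok2 (sv sv' : nat -> nat) (k k' : Blk) : bool :=
  let: (w1, w2, p, q) := k in let: (w1', w2', p', q') := k' in
  [&& (zn 1 sv && zn 1 sv') ==>
        (if kd (sv' 0) == 2 then (w2 == Some false) && (w1' == Some false)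
         else (w2 == Some true) && (w1' == Some (bt (sv' 0)))),
      (zn z sv && zn z sv') ==> (((w2 == None) ==> (w1' == None)) && ((w1' == None) ==> (w2' == None))) &
      (rowl sv && rowl sv') ==> (acc_ok p.2 p'.1 && acc_ok q.2 q'.1)].

Definition ok3 (k0 k1 k2 k3 : Blk) : bool :=
  let: (_, p0, q0) := k0 in let: (_, p1, q1) := k1 in let: (_, p2, q2) := k2 in
  let: (_, p3, q3) := k3 in (p3 == stepP p0 p1 p2) && (q3 == stepP q0 q1 q2).

(** Prescribes the cell below the first one, where the step rule lacks a left neighbour. *)
Definition ok4 (sv : nat -> nat) (k k' : Blk) : bool :=
  let: (_, p, q) := k' in
  all (fun j => kd (sv j) == 0) (iota 0 K) ==> ((p == quiet M1) && (q == quiet M2)).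

Hypotheses (z1 : 0 < z) (zm : z < m) (mK : m.+1 < K).

Section Rows.
Variables (B : nat) (sve : nat -> nat -> nat) (beta : nat -> bool).
Hypotheses (B1 : 1 < B) (sve_kd0 : forall e j, j < K -> (kd (sve e j) == 0) = (dgt B e j == 0))
  (sve_kd2 : forall e j, j < K -> (kd (sve e j) == 2) = (dgt B e j == B.-1))
  (sve_bt : forall e, bt (sve e 0) = beta (dgt B e 0)).

Notation P := (B ^ m.+1).
Notation p0 := (B.-1 * B ^ m).
Notation TAB := (TAB K m.+1 ok1 ok2 ok3 ok4 B sve).

Let dB e j : dgt B e j < B. Proof. by apply: dgt_lt; lia. Qed.
Let K0 : 0 < K. Proof. by lia. Qed.
Let B0 : 0 < B. Proof. by lia. Qed.
Let BK : P <= B ^ K. Proof. by rewrite leq_exp2l // ltnW. Qed.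
Let zm' : z <= m. Proof. exact: ltnW. Qed.
Let m1 : 1 <= m. Proof. by lia. Qed.
Let Bz : B ^ z < B ^ m. Proof. by rewrite ltn_exp2l. Qed.
Let Bm : B <= B ^ m. Proof. by rewrite -{1}(expn1 B) leq_exp2l //; lia. Qed.
Let BBz : B <= B ^ z. Proof. by rewrite -{1}(expn1 B) leq_exp2l. Qed.
Let PE : P = p0 + B ^ m. Proof. by rewrite expnS -{1}(prednK B0) mulSn addnC. Qed.

Lemma svs_first e : e < B ^ K -> all (fun j => kd (sve e j) == 0) (iota 0 K) = (e == 0).
Proof.
move=> eB; apply/allP/eqP => [H|-> j]; last first.
  by rewrite mem_iota add0n => /andP[_ jK]; rewrite sve_kd0 // dgt_zero.
apply: (dgt_eq_all eB) => [|j jK]; first by rewrite expn_gt0 B0.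
by rewrite dgt_zero; apply/eqP; rewrite -sve_kd0 // H // mem_iota add0n.
Qed.

Lemma row0E e : e < B ^ K -> row0 (sve e) = (e < P).
Proof.
move=> eK; apply/allP/idP => [H|/(dgt_high0 B1 (ltnW mK) eK) H j].
  apply/(dgt_high0 B1 (ltnW mK) eK) => j /andP[j1 j2]; apply/eqP.
  by rewrite -sve_kd0 // H // mem_iota; lia.
rewrite mem_iota => jr; rewrite sve_kd0; last by lia.
by rewrite H //; lia.
Qed.

Lemma rowlE e : e < B ^ K -> rowl (sve e) = (B ^ K - P <= e).
Proof.
move=> eK; apply/allP/idP => [H|/(dgt_highM B1 (ltnW mK) eK) H j].
  apply/(dgt_highM B1 (ltnW mK) eK) => j /andP[j1 j2]; apply/eqP.
  by rewrite -sve_kd2 // H // mem_iota; lia.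
rewrite mem_iota => jr; rewrite sve_kd2; last by lia.
by rewrite H //; lia.
Qed.

Lemma znE y e : y <= m -> e < B ^ K -> zn y (sve e) = (p0 <= e < p0 + B ^ y).
Proof.
move=> ym eK; have By : B ^ y <= B ^ m by rewrite leq_exp2l.
rewrite /zn row0E //; case: (ltnP e P) => eP; last by lia.
apply/idP/idP => [/and3P[_ k2 /allP H]|/(dgt_zone B1 ym eP) [H1 H2]].
  apply/(dgt_zone B1 ym eP); split; first by apply/eqP; rewrite -sve_kd2 //; lia.
  move=> j /andP[j1 j2]; apply/eqP; rewrite -sve_kd0; last by lia.
  by rewrite H // mem_iota; lia.
apply/and3P; split=> //; first by rewrite sve_kd2 ?H1 //; apply: ltnW.
apply/allP => j; rewrite mem_iota => jr; rewrite sve_kd0; last by lia.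
by rewrite H2 //; lia.
Qed.

(** Only the inner numbers carry letters of the input. *)
Definition xof : seq bool := mkseq (fun i => beta i.+1) (B - 2).

Lemma x_step e : p0 <= e -> e.+1 < p0 + B ->
  kd (sve e.+1 0) == 2 = (e.+1 == p0 + B.-1) /\ bt (sve e.+1 0) = beta (e.+1 - p0).
Proof.
move=> H1 H2; have m0 : 0 < m by lia.
have D : dgt B e.+1 0 = e.+1 - p0 by apply: (dgt_zone1 B1 m0); lia.
rewrite sve_kd2 ?D; last by lia.
split; first by lia.
by rewrite sve_bt D.
Qed.

Variables (f1 f2 : seq bool -> seq bool) (tau1 tau2 : nat -> nat).
Hypothesis (HM1 : forall w, tm_halted (tm_run M1 (tau1 (size w)) w) /\ tm_output (tm_run M1 (tau1 (size w)) w) = f1 w).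
Hypothesis (HM2 : forall w, tm_halted (tm_run M2 (tau2 (size w)) w) /\ tm_output (tm_run M2 (tau2 (size w)) w) = f2 w).
Hypothesis (Htau : forall n, n <= (B ^ z).*2 ->
  [/\ tau1 n + 2 < B ^ m, tau2 n + 2 < B ^ m, tau1 n < B ^ (K - m.+1) & tau2 n < B ^ (K - m.+1)]).

(** With two positions per cell the input starts in the second half of cell [p0]. At least [B ^ m]
    cells of the row lie to the left of [p0], and [B ^ m] from [p0] on, which is more than the
    running times and the input need. *)
Notation F0 := (p0.*2.+1).
Notation W := (P.*2).
Notation T := (B ^ (K - m.+1)).-1.

Section OneMachine.
Variables (M : TM) (tau : nat) (w : seq bool).
Hypotheses (w0 : 0 < size w) (wz : size w < (B ^ z).*2) (tm : tau + 2 < B ^ m) (tT : tau <= T)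
  (hM : tm_halted (tm_run M tau w)).
Notation CT := (CT M w F0 W).
Notation wa := (wat w F0).

Let p0m : B ^ m <= p0. Proof. by rewrite leq_pmull //; lia. Qed.

Let h1 : tau + 2 <= F0. Proof. by lia. Qed.
Let h2 : F0 + tau + 2 < W. Proof. by rewrite PE; lia. Qed.
Let h3 : F0 + size w < W. Proof. by rewrite PE; lia. Qed.

Definition CP e : pcell M := (CT e.*2, CT e.*2.+1).

Lemma CP_init e : e < P -> CP e = iniP M (wa e.*2) (wa e.*2.+1) (e == p0).
Proof.
move=> eP; rewrite /CP !CT_init /iniP; [|lia..].
have -> : (e.*2 == F0) = false by lia.
by have -> : (e.*2.+1 == F0) = (e == p0) by lia.
Qed.

Lemma CP_first : CP P = quiet M.
Proof.
rewrite /CP (CT_first w0 h1 h2 h3 hM).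
have -> : W.+1 = 1 * W + 1 by lia.
have W1 : 1 < W by lia.
rewrite (CT_row w0 h1 h2 h3 hM 1 W1) (cellat_edge w0 h1 h2 h3 hM); last by left.
by rewrite /wat ifN //; lia.
Qed.

Lemma CP_step e : 0 < e -> CP (e + P) = stepP (CP e.-1) (CP e) (CP e.+1).
Proof.
move=> e0; rewrite /CP /stepP.
have -> : (e + P).*2.+1 = e.*2.+1 + W by lia.
rewrite doubleD !(CT_step w0 h1 h2 h3 hM) /=; [|lia..].
have -> : e.*2.-1 = e.-1.*2.+1 by lia.
by have -> : e.*2.+2 = e.+1.*2 by lia.
Qed.

(** Row [T] is the last one, and both machines have halted by then as [tau <= T]. Adjacent positions
    share a cell or lie in consecutive cells according to parity, hence two conditions. *)
Lemma CP_accept : tm_output (tm_run M tau w) = [:: true] <->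
  (forall e, B ^ K - P <= e < B ^ K -> acc_ok (CP e).1 (CP e).2) /\
  (forall e, B ^ K - P <= e -> e.+1 < B ^ K -> acc_ok (CP e).2 (CP e.+1).1).
Proof.
have EK : B ^ K = T.+1 * P by rewrite prednK ?expn_gt0 ?B0 // -expnD subnK // ltnW.
have ES : B ^ K - P = T * P by rewrite EK mulSn addKn.
have TW : T * W = (T * P).*2 by rewrite -!muln2 mulnA.
rewrite (CT_accept w0 h1 h2 h3 hM tT) ES EK TW mulSn; move: (T * P) => X.
split=> [H|[H1 H2] f fW].
  split=> e; rewrite /CP /=.
    move=> /andP[l1 l2]; have := H (e - X).*2.
    have -> : X.*2 + (e - X).*2 = e.*2 by lia.
    have -> : X.*2 + (e - X).*2.+1 = e.*2.+1 by lia.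
    by apply; lia.
  move=> l1 l2; have := H (e - X).*2.+1.
  have -> : X.*2 + (e - X).*2.+1 = e.*2.+1 by lia.
  have -> : X.*2 + (e - X).*2.+2 = e.+1.*2 by lia.
  by apply; lia.
have Ef := odd_double_half f; case O : (odd f) Ef => Ef.
  have := H2 (X + f./2); rewrite /CP /=.
  have -> : (X + f./2).*2.+1 = X.*2 + f by lia.
  have -> : (X + f./2).+1.*2 = X.*2 + f.+1 by lia.
  by apply; lia.
have := H1 (X + f./2); rewrite /CP /=.
have -> : (X + f./2).*2 = X.*2 + f by lia.
have -> : (X.*2 + f).+1 = X.*2 + f.+1 by lia.
by apply; lia.
Qed.

End OneMachine.

Lemma tau_ok n : n < (B ^ z).*2 -> [/\ tau1 n + 2 < B ^ m, tau2 n + 2 < B ^ m, tau1 n <= T & tau2 n <= T].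
Proof.
move=> /ltnW /Htau[? ? ? ?]; have : 0 < B ^ (K - m.+1) by rewrite expn_gt0 B0.
by split=> //; lia.
Qed.

(** The blocks are read off the input track and the genuine tableaux of both machines. *)
Lemma accept_TAB y : size (pair_enc xof y) < (B ^ z).*2 ->
  f1 (pair_enc xof y) = [:: true] -> f2 (pair_enc xof y) = [:: true] -> TAB.
Proof.
set w := pair_enc _ _ => wz A1 A2.
have w0 : 0 < size w by rewrite size_pair_enc.
have [t1 t2 t3 t4] := tau_ok wz; have [h1 o1] := HM1 w; have [h2 o2] := HM2 w.
have nx : size xof = B - 2 by rewrite size_mkseq.
pose wa f := if f < W then wat w F0 f else None.
exists (fun e => (wa e.*2, wa e.*2.+1, CP M1 w e, CP M2 w e)).
move: A1 A2; rewrite -o1 -o2.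
move=> /(CP_accept w0 wz t1 t3 h1) [A1 A1'] /(CP_accept w0 wz t2 t4 h2) [A2 A2'].
have waN f : F0 + size w <= f -> wa f = None.
  by move=> H; rewrite /wa; case: ifP => // _; rewrite /wat; case: ifP => // _; rewrite onth_default //; lia.
have waL f : f < F0 -> wa f = None.
  by move=> H; rewrite /wa; case: ifP => // _; rewrite /wat ifN //; lia.
have waE k : F0 + k < W -> wa (F0 + k) = onth w k.
  by move=> H; rewrite /wa H /wat leq_addr addKn.
split=> [e eK|e eK|e eK|e e0 eK].
- rewrite /ok1 (row0E eK) (rowlE eK) (znE zm' eK) (znE (leq0n m) eK).
  apply/and4P; split; apply/implyP.
  + move=> eP; rewrite (CP_init w0 wz t1 t3 h1) // (CP_init w0 wz t2 t4 h2) // /wa !ifT; [|lia..].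
    have -> : (p0 <= e < p0 + B ^ 0) = (e == p0) by rewrite expn0; lia.
    by rewrite !eqxx.
  + move=> /andP[eP nz]; case: (ltnP e p0) => L; first by rewrite !waL //; lia.
    by rewrite !waN //; lia.
  + by move=> H; rewrite waL //; move: H; rewrite expn0; lia.
  + by move=> H; rewrite A1 ?A2 // H.
- have eK0 := ltnW eK; move: eK; move E' : e.+1 => e' eK.
  rewrite /ok2 (rowlE eK) (rowlE eK0) (znE zm' eK) (znE m1 eK) (znE zm' eK0) (znE m1 eK0) -E'.
  apply/and3P; split; apply/implyP.
  + rewrite expn1 => /andP[/andP[l1 _] /andP[_ l2]]; have [-> ->] := x_step l1 l2.
    pose i := e - p0.
    have -> : e.*2.+1 = F0 + i.*2 by rewrite /i; lia.
    have -> : e.+1.*2 = F0 + i.*2.+1 by rewrite /i; lia.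
    rewrite !waE; try (rewrite /i PE; lia).
    rewrite !onth_pair_enc nx; case: eqP => E.
      have -> : (i.*2 < (B - 2).*2) = false by rewrite /i; lia.
      have -> : (i.*2.+1 < (B - 2).*2) = false by rewrite /i; lia.
      by rewrite !ifT //; rewrite /i; lia.
    have -> : i.*2 < (B - 2).*2 by rewrite /i; lia.
    have -> : i.*2.+1 < (B - 2).*2 by rewrite /i; lia.
    rewrite oddS odd_double /= uphalf_double onthE (nth_map false) ?nx; last by rewrite /i; lia.
    rewrite nth_mkseq; last by rewrite /i; lia.
    by have -> : i.+1 = e.+1 - p0 by rewrite /i; lia.
  + move=> /andP[/andP[l1 l2] /andP[l3 l4]].
    have ls : (B ^ z).*2 <= (B ^ m).*2 by lia.
    pose i := e - p0.
    have -> : e.*2.+1 = F0 + i.*2 by rewrite /i; lia.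
    have -> : e.+1.*2.+1 = F0 + i.*2.+2 by rewrite /i; lia.
    have -> : e.+1.*2 = F0 + i.*2.+1 by rewrite /i; lia.
    rewrite !waE; try (rewrite /i PE; lia).
    have X k : (onth w k == None) ==> (onth w k.+1 == None).
      apply/implyP => /eqP E; have : ~~ onth w k by rewrite E.
      by rewrite onthNE => H; rewrite onth_default // leqW.
    by rewrite !X.
  + by rewrite -E' in eK => /andP[l1 _]; rewrite A1' ?A2'.
- rewrite /ok4 svs_first; last by lia.
  apply/implyP => /eqP ->; rewrite add0n.
  by rewrite (CP_first w0 wz t1 t3 h1) (CP_first w0 wz t2 t4 h2) !eqxx.
- by rewrite /ok3 (CP_step w0 wz t1 t3 h1) // (CP_step w0 wz t2 t4 h2) // !eqxx.
Qed.

(** The sorts force the part of the input track that encodes [x], and what follows is a string by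
    monotonicity. On that input the rules leave no choice for the tableaux. *)
Lemma TAB_accept : TAB -> exists y, let w := pair_enc xof y in
  [/\ size w < (B ^ z).*2, f1 w = [:: true] & f2 w = [:: true]].
Proof.
move=> [blk [T1 T2 T4 T3]].
have nx : size xof = B - 2 by rewrite size_mkseq.
pose v1 e := (blk e).1.1.1; pose v2 e := (blk e).1.1.2.
pose q1 e := (blk e).1.2; pose q2 e := (blk e).2.
have Eb e : blk e = (v1 e, v2 e, q1 e, q2 e) by rewrite /v1 /v2 /q1 /q2 -!surjective_pairing.
pose fl f := if odd f then v2 f./2 else v1 f./2.
pose zend := (p0 + B ^ z).*2.
have zP : p0 + B ^ z <= P by rewrite PE leq_add2l ltnW.
have lK e : e < p0 + B ^ z -> e < B ^ K by move=> H; apply: leq_trans BK; apply: leq_trans zP.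
have xpart i : i.+1 < B ->
    fl (F0 + i.*2) = onth (pair_enc xof [::]) i.*2 /\ fl (F0 + i.*2.+1) = onth (pair_enc xof [::]) i.*2.+1.
  move=> iB; have eK : (p0 + i).+1 < B ^ K by apply: lK; lia.
  have := T2 _ eK; rewrite !Eb /ok2 (znE m1 eK) (znE m1 (ltnW eK)) expn1.
  move=> /and3P[/implyP H _ _]; move: H.
  have -> : (p0 <= p0 + i < p0 + B) && (p0 <= (p0 + i).+1 < p0 + B) by lia.
  have [-> ->] : (kd (sve (p0 + i).+1 0) == 2 = ((p0 + i).+1 == p0 + B.-1)) /\
     bt (sve (p0 + i).+1 0) = beta ((p0 + i).+1 - p0) by apply: x_step; lia.
  have E1 : fl (F0 + i.*2) = v2 (p0 + i).
    rewrite /fl; have -> : F0 + i.*2 = (p0 + i).*2.+1 by lia.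
    by rewrite oddS odd_double /= uphalf_double.
  have E2 : fl (F0 + i.*2.+1) = v1 (p0 + i).+1.
    rewrite /fl; have -> : F0 + i.*2.+1 = (p0 + i).+1.*2 by lia.
    by rewrite odd_double doubleK.
  rewrite E1 E2 !onth_pair_enc nx; case: eqP => E /(_ isT) /andP[/eqP -> /eqP ->].
    have -> : (i.*2 < (B - 2).*2) = false by lia.
    have -> : (i.*2.+1 < (B - 2).*2) = false by lia.
    by rewrite !ifT //; lia.
  have -> : i.*2 < (B - 2).*2 by lia.
  have -> : i.*2.+1 < (B - 2).*2 by lia.
  rewrite oddS odd_double /= uphalf_double onthE (nth_map false) ?nx; last by lia.
  rewrite nth_mkseq; last by lia.
  by have -> : (p0 + i).+1 - p0 = i.+1 by lia.
(* The first position after the encoding of [x] and the separator. Cutting [g] off at the end of the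
   zone bounds the witness. *)
pose Y0 := F0 + (B - 2).*2.+2.
pose g k := if Y0 + k < zend then fl (Y0 + k) else None.
have gS k : g k = None -> g k.+1 = None.
  rewrite /g addnS; case: ifP => [L|L _]; last by rewrite ifN //; lia.
  case: ifP => // L'; have fY : Y0 <= Y0 + k by rewrite leq_addr.
  move: (Y0 + k) L L' fY => f L L' fY; have Ef := odd_double_half f.
  have Yp : (p0 + B.-1).*2.+1 = Y0 by rewrite /Y0; lia.
  rewrite /fl oddS [_.+1./2]/=; case O : (odd f) Ef => Ef E; rewrite [~~ _]/=.
    have eK : (f./2).+1 < B ^ K by apply: lK; move: L'; rewrite /zend; lia.
    have := T2 _ eK; rewrite !Eb /ok2 (znE zm' eK) (znE zm' (ltnW eK)).
    move=> /and3P[_ /implyP H _].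
    have /H/andP[/implyP H1 _] : (p0 <= f./2 < p0 + B ^ z) && (p0 <= (f./2).+1 < p0 + B ^ z).
      by move: L'; rewrite /zend; lia.
    have -> : uphalf f = (f./2).+1 by rewrite uphalf_half O.
    by apply/eqP/H1/eqP.
  have eK : ((f./2).-1).+1 < B ^ K by apply: lK; move: L'; rewrite /zend; lia.
  have := T2 _ eK; rewrite !Eb /ok2 (znE zm' eK) (znE zm' (ltnW eK)).
  have Ep : (f./2).-1.+1 = f./2 by lia.
  rewrite Ep => /and3P[_ /implyP H _].
  have /H/andP[_ /implyP H2] : [&& (p0 <= f./2.-1) && (f./2 <= p0 + B ^ z), p0 <= f./2 & f./2 < p0 + B ^ z].
    by move: L'; rewrite /zend; lia.
  have -> : uphalf f = f./2 by rewrite uphalf_half O.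
  by apply/eqP/H2/eqP.
have [|y yL Hy] := @onth_prefix g (zend - Y0) gS; first by rewrite /g ifN //; lia.
exists y => w.
have wS : size w = (B - 2).*2.+2 + size y by rewrite size_pair_enc nx.
have wz : size w < (B ^ z).*2 by rewrite wS; move: yL; rewrite /zend /Y0; lia.
have w0 : 0 < size w by rewrite wS.
have [t1 t2 t3 t4] := tau_ok wz; have [h1 o1] := HM1 w; have [h2 o2] := HM2 w.
have flE f : f < W -> fl f = wat w F0 f.
  move=> fW; have Ef := odd_double_half f.
  have eP : f./2 < P by lia.
  have eK : f./2 < B ^ K by apply: leq_trans BK.
  have := T1 _ eK; rewrite Eb /ok1 (row0E eK) eP (znE zm' eK) (znE (leq0n m) eK) => /and4P[_ H2 H3 _].
  rewrite /wat; case: (leqP F0 f) => L; last first.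
    case: (ltnP f./2 p0) => L2.
      move: H2; have -> : (p0 <= f./2 < p0 + B ^ z) = false by lia.
      by rewrite /fl /= => /andP[/eqP -> /eqP ->]; case: odd.
    have E : f = p0.*2 by lia.
    move: H3; rewrite expn0 /fl E odd_double doubleK.
    have -> : (p0 <= p0 < p0 + 1) by lia.
    by move=> /eqP.
  case: (ltnP f zend) => Lz; last first.
    have nf : (p0 <= f./2 < p0 + B ^ z) = false by move: Lz; rewrite /zend; lia.
    move: H2; rewrite nf /= => /andP[/eqP E1 /eqP E2].
    rewrite onth_default; first by rewrite /fl E1 E2; case: odd.
    by move: Lz wz; rewrite /zend; lia.
  case: (ltnP f Y0) => LY.
    pose k := f - F0; have Ek := odd_double_half k.
    have kB : (k./2).+1 < B by move: LY; rewrite /Y0 /k in Ek *; lia.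
    have [X1 X2] := xpart _ kB; rewrite -/k.
    have Efk : f = F0 + k by rewrite /k subnKC.
    have kl : k < (B - 2).*2.+2 by move: LY; rewrite /Y0 /k; lia.
    have -> : onth w k = onth (pair_enc xof [::]) k.
      by rewrite !onth_pair_enc nx; case: ifP => // _; rewrite kl.
    rewrite Efk; case O : (odd k) Ek => /= Ek.
      have Ek' : k = (k./2).*2.+1 by lia.
      by rewrite Ek' X2.
    have Ek' : k = (k./2).*2 by lia.
    by rewrite Ek' X1.
  have := Hy (f - Y0); rewrite /g subnKC // Lz => ->.
  rewrite onth_pair_enc nx.
  have -> : (f - F0 < (B - 2).*2) = false by move: LY; rewrite /Y0; lia.
  have -> : (f - F0 < (B - 2).*2.+2) = false by move: LY; rewrite /Y0; lia.
  by rewrite /Y0 subnDA.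
have fl1 e : fl e.*2 = v1 e by rewrite /fl odd_double doubleK.
have fl2 e : fl e.*2.+1 = v2 e by rewrite /fl oddS odd_double /= uphalf_double.
(* The first row is fixed by [ok1], the cell at code [P] by [ok4], and every later cell by three
   cells of smaller code. *)
have Q e : e < B ^ K -> q1 e = CP M1 w e /\ q2 e = CP M2 w e.
  elim/ltn_ind: e => e IH eK; case: (ltnP e P) => eP.
    have := T1 _ eK; rewrite Eb /ok1 (row0E eK) eP (znE zm' eK) (znE (leq0n m) eK) => /and4P[/andP[/eqP -> /eqP ->] _ _ _].
    rewrite (CP_init w0 wz t1 t3 h1) // (CP_init w0 wz t2 t4 h2) // -!flE; [|lia..].
    rewrite fl1 fl2.
    by have -> : (p0 <= e < p0 + B ^ 0) = (e == p0) by rewrite expn0; lia.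
  have Ee : e = (e - P) + P by lia.
  have P1 : 0 < P by rewrite expn_gt0 B0.
  case: (posnP (e - P)) => L.
    have eP' : e = P by lia.
    rewrite eP' in eK *; have := T4 0; rewrite add0n (Eb P) /ok4 svs_first; last by rewrite expn_gt0 B0.
    move=> /(_ eK) /andP[/eqP -> /eqP ->].
    by rewrite (CP_first w0 wz t1 t3 h1) (CP_first w0 wz t2 t4 h2).
  have := T3 (e - P) L; rewrite -Ee !Eb /ok3 => /(_ eK) /andP[/eqP -> /eqP ->].
  have C1 := CP_step w0 wz t1 t3 h1 L; have C2 := CP_step w0 wz t2 t4 h2 L.
  rewrite -Ee in C1; rewrite -Ee in C2; rewrite C1 C2.
  have [||-> ->] := IH (e - P).-1; [lia|lia|].
  have [||-> ->] := IH (e - P); [lia|lia|].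
  by have [||-> ->] := IH (e - P).+1; [lia|lia|].
split=> //.
- rewrite -o1; apply/(CP_accept w0 wz t1 t3 h1); split=> e.
    move=> /andP[l1 l2]; have := T1 _ l2; rewrite Eb /ok1 (rowlE l2) l1 => /and4P[_ _ _ /andP[]].
    by have [-> _] := Q e l2.
  move=> l1 l2; have := T2 _ l2; rewrite !Eb /ok2 (rowlE l2) (rowlE (ltnW l2)).
  have [E1 _] := Q e (ltnW l2); have [E2 _] := Q _ l2; rewrite E1 E2.
  by rewrite l1 leqW // => /and3P[_ _ /andP[]].
- rewrite -o2; apply/(CP_accept w0 wz t2 t4 h2); split=> e.
    move=> /andP[l1 l2]; have := T1 _ l2; rewrite Eb /ok1 (rowlE l2) l1 => /and4P[_ _ _ /andP[]].
    by have [_ ->] := Q e l2.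
  move=> l1 l2; have := T2 _ l2; rewrite !Eb /ok2 (rowlE l2) (rowlE (ltnW l2)).
  have [_ E1] := Q e (ltnW l2); have [_ E2] := Q _ l2; rewrite E1 E2.
  by rewrite l1 leqW // => /and3P[_ _ /andP[]].
Qed.

End Rows.
End Blocks.

(** * Colourable graphs and the language *)

Ltac pf_var := first [exact: (PF_var 0) | exact: (PF_var 1) | exact: (PF_var 2) | exact: (PF_var 3)
  | exact: (PF_var 4) | exact: (PF_var 5) | exact: (PF_var 6) | exact: (PF_var 7)].

(** * The length of the witness and the choice of exponents *)

Section Guard.
Variables c k : nat.

(** In a pair encoding the even positions hold markers [true] up to the separator, so the number of
    leading markers is the length of the first component. *)
Definition xlen (w : seq bool) : nat := find (fun i => ~~ nth false w (i * 2)) (iota 0 (size w)).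

Definition guard (w : seq bool) : bool := size w - (xlen w * 2 + 2) <= c * xlen w ^ k + c.

Lemma nth_onth (s : seq bool) i : nth false s i = odflt false (onth s i).
Proof. by rewrite odflt_onth. Qed.

Lemma guard_pair_enc x y : guard (pair_enc x y) = (size y <= c * size x ^ k + c).
Proof.
have E : xlen (pair_enc x y) = size x.
  rewrite /xlen size_pair_enc; set P := fun i => _.
  have -> : iota 0 ((size x).*2.+2 + size y) = iota 0 (size x) ++ iota (size x) ((size x).+2 + size y).
    by rewrite -{2}[size x]add0n -iotaD; congr iota; lia.
  have NP : ~~ has P (iota 0 (size x)).
    apply/hasPn => i; rewrite mem_iota add0n => /andP[_ ix].
    by rewrite /P negbK nth_onth onth_pair_enc muln2 odd_double ltn_double ix.
  have Pn : P (size x) by rewrite /P nth_onth onth_pair_enc muln2 ltnn ltnS leqnSn.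
  by rewrite find_cat (negbTE NP) size_iota addSn /= Pn addn0.
by rewrite /guard E size_pair_enc muln2 addn2 addKn.
Qed.

Lemma PF_xlen : PF (fun x e => xlen x).
Proof.
apply: PF_find PF_size _; apply: PFb_not; apply: PF_bit; apply: PF_mul; [pf_var|exact: PF_const].
Qed.

Lemma PF_guard : PFb (fun x e => guard x).
Proof.
have H := PF_xlen; apply: PFb_leq.
  apply: PF_sub PF_size _; apply: PF_add (PF_const 2); apply: PF_mul H (PF_const 2).
apply: PF_add (PF_const c); apply: PF_mul (PF_const c) _; exact: PF_expn.
Qed.

Lemma guard_computable : poly_time_computable (fun w => [:: guard w]).
Proof.
have := PF_output (PF_const 1) PF_guard; case=> M [d [l H]]; exists M, d, l => x.
by have := H x.
Qed.

End Guard.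

Lemma params c k c1 k1 c2 k2 : exists z m, [/\ 0 < z, z < m &
  forall n, let B := n.+2 in
    (n.*2.+2 + (c * n ^ k + c) < (B ^ z).*2) /\
    forall s, s <= (B ^ z).*2 -> c1 * s ^ k1 + c1 + 2 < B ^ m /\ c2 * s ^ k2 + c2 + 2 < B ^ m].
Proof.
(* As [c < B ^ c] and [n ^ k <= B ^ k], two further factors [B >= 2] absorb the doubling and the
   summand [2 n + 2]. Inputs have length at most [2 * B ^ z <= B ^ z.+1], whence the exponent
   [z.+1 * l], and [d.*2.+2] takes care of the constants. *)
pose z := (c + k).+2; pose q d l := d.*2.+2 + z.+1 * l.
exists z, (z.+1 + (q c1 k1 + q c2 k2)); split=> //; first by lia.
move=> n B; have B0 : 0 < B by [].
have LB d : d < B ^ d by apply: leq_trans (ltn_expl d (isT : 1 < 2)) _; apply: expn_mono.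
have pos e : 0 < B ^ e by rewrite expn_gt0.
split.
  have H1 : n ^ k <= B ^ k by apply: expn_mono; rewrite /B; lia.
  have H2 : B ^ z = B * (B * (B ^ c * B ^ k)) by rewrite /z !expnS expnD.
  have H3 : c * n ^ k + c <= (c * B ^ k).*2.
    rewrite -addnn; apply: leq_add; first by rewrite leq_mul2l H1 orbT.
    by rewrite leq_pmulr.
  have H4 : c * B ^ k <= B ^ c * B ^ k by rewrite leq_mul2r (ltnW (LB c)) orbT.
  have X0 : 0 < B ^ c * B ^ k by rewrite muln_gt0 !pos.
  rewrite H2; move: (B ^ c * B ^ k) H4 X0 => X H4 X0.
  have H5 : 2 * X <= B * X by rewrite leq_mul2r; lia.
  have H6 : B * X + B * X <= B * (B * X).
    by rewrite addnn -mul2n; apply: leq_mul.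
  have H7 : B <= B * X by rewrite leq_pmulr.
  by rewrite /B in H7 *; lia.
have T d l s : s <= (B ^ z).*2 -> d * s ^ l + d + 2 < B ^ q d l.
  move=> sz; have s1 : s <= B ^ z.+1.
    by apply: leq_trans sz _; rewrite -mul2n expnS leq_mul2r; lia.
  have H : s ^ l <= B ^ (z.+1 * l) by rewrite expnM; apply: expn_mono.
  have X0 := pos (z.+1 * l); rewrite /q expnD; move: (B ^ (z.+1 * l)) H X0 => X H X0.
  have H1 : d * s ^ l <= d * X by rewrite leq_mul2l H orbT.
  apply: (@leq_trans ((d.*2.+3) * X)); last by rewrite leq_mul2r LB orbT.
  have : d <= d * X by rewrite leq_pmulr.
  have -> : d.*2.+3 * X = d * X + d * X + 3 * X by rewrite -!mulnDl; congr muln; lia.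
  by lia.
move=> s sz; split.
  by apply: leq_trans (T c1 k1 s sz) _; rewrite leq_exp2l //; lia.
by apply: leq_trans (T c2 k2 s sz) _; rewrite leq_exp2l //; lia.
Qed.

Section Main.
Variables (L : language) (V : language) (c k : nat) (M1 M2 : TM) (f1 : seq bool -> seq bool).
Variables (c1 k1 c2 k2 z m : nat).
Hypotheses (HL : forall x, L x <-> exists y, size y <= c * size x ^ k + c /\ V (pair_enc x y))
  (HV : forall w, V w <-> f1 w = [:: true])
  (HM1 : forall x, let cfg := tm_run M1 (c1 * size x ^ k1 + c1) x in
     tm_halted cfg /\ tm_output cfg = f1 x)
  (HM2 : forall x, let cfg := tm_run M2 (c2 * size x ^ k2 + c2) x in
     tm_halted cfg /\ tm_output cfg = [:: guard c k x])
  (z1 : 0 < z) (zm : z < m)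
  (Hp : forall n, let B := n.+2 in
    (n.*2.+2 + (c * n ^ k + c) < (B ^ z).*2) /\
    forall s, s <= (B ^ z).*2 -> c1 * s ^ k1 + c1 + 2 < B ^ m /\ c2 * s ^ k2 + c2 + 2 < B ^ m).

(** The lower [m.+1] digits address a cell within its row and the upper [m] digits the row, so the
    number [B ^ m] of rows exceeds both running times. *)
Notation K := (m.+1 + m).
Variables (N : nat) (adj : rel nat).
Hypotheses (N0 : 0 < N) (adj_lt : forall u v, adj u v -> (u < N) && (v < N)).

Definition theforb := @forb K m.+1 _ (@ok1 M1 M2 K m z) (@ok2 M1 M2 K m z) (@ok3 M1 M2) (@ok4 M1 M2 K).

Notation COL := (COL K m.+1 (@ok1 M1 M2 K m z) (@ok2 M1 M2 K m z) (@ok3 M1 M2) (@ok4 M1 M2 K) N adj).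

Variable a : nat -> nat.
Hypotheses (emba : emb K adj a) (uniqa : forall e, emb K adj e -> forall i, i < nhubs K -> e i = a i).

Let K0 : 0 < K. Proof. by lia. Qed.
Let mK : m.+1 < K. Proof. by lia. Qed.

Lemma COL_regular : COL -> regular K N adj a.
Proof. by move=> H; have [] := (COL_good _ _ _ _ _ N0 adj_lt K0 emba uniqa).1 H. Qed.

Lemma COL_imperfect : regular K N adj a -> ~ (exists B nu, perfect K N adj a B nu) -> COL.
Proof.
move=> R NP; apply/(COL_good _ _ _ _ _ N0 adj_lt K0 emba uniqa); split=> //.
exact: (not_perfect_good _ _ _ _ K0 mK R NP).
Qed.

Definition xdec (B : nat) (nu : nat -> nat) : seq bool := mkseq (fun i => bt (ns K adj a nu i.+1)) (B - 2).

Lemma COL_perfect B nu : regular K N adj a -> perfect K N adj a B nu -> COL <-> L (xdec B nu).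
Proof.
move=> R [B1 nu0 nuS nuM full].
have HT : COL <-> TAB K m.+1 (@ok1 M1 M2 K m z) (@ok2 M1 M2 K m z) (@ok3 M1 M2) (@ok4 M1 M2 K) B (sve K adj a B nu).
  split=> [/(COL_good _ _ _ _ _ N0 adj_lt K0 emba uniqa) [_ G]|T].
    exact: (good_TAB K0 mK R B1 nu0 nuS nuM full G).
  apply/(COL_good _ _ _ _ _ N0 adj_lt K0 emba uniqa); split=> //.
  exact: (TAB_good K0 mK R B1 nu0 nuS nuM T).
have dB e j : dgt B e j < B by apply: dgt_lt; lia.
have kd0 e j : j < K -> (kd (sve K adj a B nu e j) == 0) = (dgt B e j == 0).
  by move=> jK; rewrite /sve jK (ns_kd0 K0 mK R B1 nu0 nuS nuM (dB e j)).
have kd2 e j : j < K -> (kd (sve K adj a B nu e j) == 2) = (dgt B e j == B.-1).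
  by move=> jK; rewrite /sve jK (ns_kd2 K0 mK R B1 nu0 nuS nuM (dB e j)).
pose beta i := bt (ns K adj a nu i).
have sbt e : bt (sve K adj a B nu e 0) = beta (dgt B e 0) by rewrite /sve K0.
have EB : B = (B - 2).+2 by lia.
have [Hp1 Hp2] := Hp (B - 2); rewrite /= -EB in Hp1 Hp2.
have tau s : s <= (B ^ z).*2 -> [/\ c1 * s ^ k1 + c1 + 2 < B ^ m, c2 * s ^ k2 + c2 + 2 < B ^ m,
    c1 * s ^ k1 + c1 < B ^ (K - m.+1) & c2 * s ^ k2 + c2 < B ^ (K - m.+1)].
  by move=> /Hp2[h1 h2]; rewrite addKn; split=> //; lia.
have xs : size (xdec B nu) = B - 2 by rewrite size_mkseq.
rewrite HT HL; split.
  move=> /(TAB_accept z1 zm mK B1 kd0 kd2 sbt HM1 HM2 tau) [y [wz A1 A2]].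
  exists y; split; last by apply/HV.
  by case: A2; rewrite guard_pair_enc => ->.
move=> [y [ys /HV A1]]; apply: (accept_TAB z1 zm mK B1 kd0 kd2 sbt HM1 HM2 tau (y := y)) => //.
  by rewrite size_pair_enc xs; apply: leq_trans Hp1; rewrite ltnS leq_add2l -xs.
by rewrite guard_pair_enc ys.
Qed.

End Main.

(** * The graph of an instance *)

Lemma gadj_sym K i j : gadj K i j = gadj K j i.
Proof. by rewrite /gadj; case: ltnP => ?; case: ltnP => ? //; rewrite eq_sym. Qed.

Lemma leq_sum_eq (s : seq nat) (f g : nat -> nat) : (forall i, i \in s -> f i <= g i) ->
  \sum_(i <- s) f i = \sum_(i <- s) g i -> forall i, i \in s -> f i = g i.
Proof.
elim: s => // a s IH H; rewrite !big_cons => E.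
have Ha := H a (mem_head _ _).
have Hs : \sum_(i <- s) f i <= \sum_(i <- s) g i.
  by rewrite !big_seq; apply: leq_sum => i si; apply: H; rewrite inE si orbT.
have Es : \sum_(i <- s) f i = \sum_(i <- s) g i by lia.
move=> i; rewrite inE => /orP[/eqP ->|]; first by lia.
by apply: IH Es i => j js; apply: H; rewrite inE js orbT.
Qed.

Lemma sub_in_count (T : eqType) (a b : pred T) s :
  (forall i, i \in s -> a i -> b i) -> count a s <= count b s.
Proof.
elim: s => //= i s IH H; apply: leq_add; last by apply: IH => j js; apply: H; rewrite inE js orbT.
by case: (a i) (H i (mem_head _ _)) => // ->.
Qed.

Section Instance.
Variables (K : nat) (x : seq bool).
Hypothesis K0 : 0 < K.
Notation n := (size x).
Notation B := (size x).+2.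
Notation nS := (nsorts K).
Notation nH := (nhubs K).
Notation h := (ngad K).

(* In this order: the gadget, the numbers, the ports [18 + j] of each number, and the cells. *)
Definition nvert : nat := h + (B + K * B + B ^ K).

(** Mixed radix 3, 3, 2, as [kd], [ta] and [bt] decode it. The inner number [i] carries bit [i.-1];
    the two ends of the path account for the 2 in [B]. *)
Definition ncode (i : nat) : nat :=
  (if i == 0 then 0 else if i == B.-1 then 2 else 1) * 6 + (i %% 3 * 2 + nth false x i.-1).

Definition vsort (u : nat) : nat :=
  if u - h < B then ncode (u - h) else
  if u - h < B + K * B then 18 + (u - h - B) %/ B else 18 + K.

(** Outside the gadget every edge is listed from the lower vertex to the higher one. A port stands
    for a digit place together with a number, and all cells with that digit share it. Its sort shows
    the place, which a direct edge from cell to number could not. *)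
Definition darc (u v : nat) : bool :=
  if v < h then (u < h) && gadj K u v else
  if u < h then (u < nH) && ((u == 0) || (u == (vsort v).+1)) else
  if v - h < B then v == u.+1 else
  if v - h < B + K * B then (u - h < B) && ((v - h - B) %% B == u - h) else
  (B <= u - h < B + K * B) && (dgt B (v - h - (B + K * B)) ((u - h - B) %/ B) == (u - h - B) %% B).

Definition gx (u v : nat) : bool := [&& u < nvert, v < nvert & darc u v || darc v u].

Let hH : nH < h. Proof. by rewrite /ngad; lia. Qed.
Let B0 : 0 < B. Proof. by []. Qed.

Lemma gx_sym u v : gx u v = gx v u.
Proof. by rewrite /gx andbCA orbC. Qed.

Lemma gx_lt u v : gx u v -> (u < nvert) && (v < nvert).
Proof. by case/and3P => -> ->. Qed.

Lemma hN : h < nvert. Proof. by rewrite /nvert; lia. Qed.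

Lemma gx_gad u v : u < h -> v < h -> gx u v = gadj K u v.
Proof.
move=> uh vh; have N := hN; rewrite /gx /darc uh vh (gadj_sym K v u) orbb.
by rewrite (ltn_trans uh N) (ltn_trans vh N).
Qed.

Lemma gx_hub u v : u < h -> h <= v < nvert -> gx u v = (u < nH) && ((u == 0) || (u == (vsort v).+1)).
Proof.
move=> uh /andP[hv vN]; have N := hN; rewrite /gx (ltn_trans uh N) vN /darc uh.
by rewrite ltnNge hv /= orbF.
Qed.

Lemma gx_irr u : gx u u = false.
Proof.
case: (ltnP u h) => uh; first by rewrite gx_gad // /gadj eqxx; case: ltnP.
have nu : (u < h) = false by lia.
apply/negP => /and3P[_ _]; rewrite orbb /darc nu; case: (ltnP (u - h) B) => L; first by lia.
case: (ltnP (u - h) (B + K * B)) => L'; first by case/andP.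
by rewrite andbF.
Qed.

Lemma ncode_kd i : kd (ncode i) = if i == 0 then 0 else if i == B.-1 then 2 else 1.
Proof.
rewrite /kd /ncode divnMDl // divn_small ?addn0 //.
by have := ltn_pmod i (isT : 0 < 3); case: nth => /=; lia.
Qed.

Lemma ncode_ta i : ta (ncode i) = i %% 3.
Proof.
rewrite /ta /ncode; set t := (if _ then _ else _).
have -> : t * 6 + (i %% 3 * 2 + nth false x i.-1) = (t * 3 + i %% 3) * 2 + nth false x i.-1 by lia.
rewrite divnMDl // divn_small; last by case: nth.
by rewrite addn0 modnMDl modn_mod.
Qed.

Lemma ncode_bt i : bt (ncode i) = nth false x i.-1.
Proof.
rewrite /bt /ncode; set t := (if _ then _ else _).
have -> : t * 6 + (i %% 3 * 2 + nth false x i.-1) = (t * 3 + i %% 3) * 2 + nth false x i.-1 by lia.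
by rewrite modnMDl; case: nth.
Qed.

Lemma ncode_lt i : ncode i < 18.
Proof.
have := ltn_pmod i (isT : 0 < 3); rewrite /ncode; case: nth => /=; case: eqP => _; try case: eqP => _; lia.
Qed.

Lemma vsort_lt v : h <= v < nvert -> vsort v < nS.
Proof.
move=> _; rewrite /vsort /nsorts; case: (ltnP (v - h) B) => L; first by have := ncode_lt (v - h); lia.
case: (ltnP (v - h) (B + K * B)) => L'; last by lia.
have : (v - h - B) %/ B < K by rewrite ltn_divLR //; lia.
lia.
Qed.

Lemma vsort_num i : i < B -> vsort (h + i) = ncode i.
Proof. by move=> iB; rewrite /vsort addKn iB. Qed.

Lemma srtE u s : s < nS -> srt K gx id u s = (h <= u < nvert) && (s == vsort u).
Proof.
move=> sS; have N := hN; rewrite /srt.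
have sh : s.+1 < nH by rewrite /nhubs; lia.
case: (ltnP u h) => uh.
  rewrite andFb; case: (ltnP u nH) => uH.
    by apply/negP => /and3P[_ _ /allP H]; have := H u; rewrite mem_iota add0n uH eqxx => /(_ isT).
  have h0 : 0 < h by lia.
  have n1 : (u < nH) = false by lia.
  have n2 : 0 < nH by lia.
  by apply/negP => /and3P[A _ _]; move: A; rewrite (gx_gad uh h0) /gadj n1 n2.
case: (ltnP u nvert) => uN; last by apply/negP => /and3P[/gx_lt/andP[]]; lia.
have h0 : 0 < h by lia.
have hs : s.+1 < h by lia.
have hu : h <= u < nvert by rewrite uh.
rewrite !(gx_sym u) (gx_hub h0 hu) (gx_hub hs hu).
have -> : all (fun i => u != i) (iota 0 nH).
  by apply/allP => i; rewrite mem_iota add0n => ?; apply/eqP; lia.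
have -> : 0 < nH by lia.
by rewrite andbT sh.
Qed.

Lemma vsort_num_inv u : h <= u < nvert -> vsort u < 18 -> exists2 i, i < B & u = h + i.
Proof.
move=> /andP[hu uN]; rewrite /vsort; case: (ltnP (u - h) B) => L; first by move=> _; exists (u - h) => //; lia.
by case: (ltnP (u - h) (B + K * B)) => L'; rewrite ltnNge leq_addr.
Qed.

Lemma kndE k u : knd K gx id k u -> exists i, [/\ i < B, u = h + i & kd (ncode i) = k].
Proof.
move=> /hasP[s]; rewrite mem_iota add0n => /andP[_ s18] /andP[/eqP ks].
rewrite srtE; last by rewrite /nsorts; lia.
move=> /andP[hu /eqP E]; rewrite E in s18; have [i iB Eu] := vsort_num_inv hu s18.
by exists i; split=> //; rewrite -ks E Eu vsort_num.
Qed.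

Lemma num_range i : i < B -> h <= h + i < nvert.
Proof. by move=> iB; rewrite /nvert; lia. Qed.

Lemma srt_num i : i < B -> srt K gx id (h + i) (ncode i).
Proof.
move=> iB; rewrite srtE; last by have := ncode_lt i; rewrite /nsorts; lia.
by rewrite num_range // vsort_num ?eqxx.
Qed.

Lemma knd_num i : i < B -> knd K gx id (kd (ncode i)) (h + i).
Proof.
move=> iB; apply/hasP; exists (ncode i); first by rewrite mem_iota add0n ncode_lt.
by rewrite eqxx srt_num.
Qed.

Lemma gx_num i j : i < B -> j < B -> gx (h + i) (h + j) = (j == i.+1) || (i == j.+1).
Proof.
move=> iB jB; have /andP[_ iN] := num_range iB; have /andP[_ jN] := num_range jB.
have ni : (h + i < h) = false by lia.
have nj : (h + j < h) = false by lia.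
by rewrite /gx iN jN /darc ni nj !addKn iB jB -!addnS !eqn_add2l.
Qed.

(** The reverse of a path edge changes the position by -1, which differs from 1 modulo 3. *)
Lemma sucE u v : suc K gx id u v -> exists i, [/\ i.+1 < B, u = h + i & v = h + i.+1].
Proof.
move=> /andP[A /hasP[s]]; rewrite mem_iota add0n => /andP[_ s18] /hasP[s'].
rewrite mem_iota add0n => /andP[_ s18'] /and3P[/and3P[_ _ /eqP t]].
rewrite !srtE; [|by rewrite /nsorts; lia..].
move=> /andP[hu /eqP E] /andP[hv /eqP E']; rewrite E in s18 t; rewrite E' in s18' t.
have [i iB Eu] := vsort_num_inv hu s18; have [j jB Ev] := vsort_num_inv hv s18'.
move: t A; rewrite Eu Ev !vsort_num // !ncode_ta gx_num // => t /orP[/eqP Ej|/eqP Ei].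
  by exists i; rewrite -Ej.
by exfalso; lia.
Qed.

Lemma suc_num i : i.+1 < B -> suc K gx id (h + i) (h + i.+1).
Proof.
move=> iB; have iB' := ltnW iB; rewrite /suc gx_num // eqxx orTb andTb.
apply/hasP; exists (ncode i); first by rewrite mem_iota add0n ncode_lt.
apply/hasP; exists (ncode i.+1); first by rewrite mem_iota add0n ncode_lt.
rewrite !srt_num // !andbT /cmp !ncode_kd !ncode_ta /=.
apply/and3P; split.
- by case: (eqVneq i 0) => [//|_]; rewrite ifN //; apply/eqP; lia.
- by case: ifP.
- by apply/eqP; lia.
Qed.

Definition cellv (e : nat) : nat := h + (B + K * B + e).

Lemma digE v j u : j < K -> dig K nvert gx id v j u ->
  exists2 e, e < B ^ K & v = cellv e /\ u = h + dgt B e j.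
Proof.
move=> jK /and3P[]; rewrite srtE; last by rewrite /nsorts; lia.
move=> /andP[/andP[hv vN] /eqP Ev] /hasP[s]; rewrite mem_iota add0n => /andP[_ s18].
rewrite srtE; last by rewrite /nsorts; lia.
move=> /andP[hu /eqP Es]; rewrite Es in s18; have [i iB Eu] := vsort_num_inv hu s18.
move=> /hasP[p]; rewrite mem_iota add0n => /andP[_ pN] /and3P[].
rewrite srtE; last by rewrite /nsorts; lia.
move=> /andP[/andP[hp _] /eqP Ep] A1 A2.
have Lv : B + K * B <= v - h.
  move: Ev; rewrite /vsort; case: (ltnP (v - h) B) => L; first by have := ncode_lt (v - h); lia.
  case: (ltnP (v - h) (B + K * B)) => // L'; have : (v - h - B) %/ B < K by rewrite ltn_divLR //; lia.
  lia.
have [Lp Lp'] : B <= p - h /\ p - h < B + K * B.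
  move: Ep; rewrite /vsort; case: (ltnP (p - h) B) => L; first by have := ncode_lt (p - h); lia.
  by case: (ltnP (p - h) (B + K * B)) => // L'; lia.
have Ej : (p - h - B) %/ B = j by move: Ep; rewrite /vsort ltnNge Lp /= Lp'; lia.
have np : (p < h) = false by lia.
have nv : (v < h) = false by lia.
have nu : (u < h) = false by lia.
have nLp : (p - h < B) = false by lia.
have nLv : (v - h < B) = false by lia.
have nLv' : (v - h < B + K * B) = false by lia.
have Lu : u - h < B by rewrite Eu addKn.
exists (v - h - (B + K * B)); first by move: vN; rewrite /nvert; lia.
split; first by rewrite /cellv; lia.
move: A1 A2; rewrite /gx /darc vN pN np nv nu nLp nLv nLv' Lp' Lp Lu Ej /=.
have nup : (u == p.+1) = false by lia.
by rewrite nup => /eqP -> /andP[_ /eqP ->]; lia.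
Qed.

Lemma dig_cell e j : e < B ^ K -> j < K -> dig K nvert gx id (cellv e) j (h + dgt B e j).
Proof.
move=> eB jK; have dB : dgt B e j < B by apply: dgt_lt.
have cN : cellv e < nvert by rewrite /cellv /nvert; lia.
pose p := h + (B + (j * B + dgt B e j)).
have jB : j * B + dgt B e j < K * B.
  by apply: (@leq_trans (j.+1 * B)); [rewrite mulSn; lia|rewrite leq_mul2r jK orbT].
have pN : p < nvert by rewrite /p /nvert; lia.
have Ep : p - h - B = j * B + dgt B e j by rewrite /p; lia.
have Lp : p - h < B + K * B by rewrite /p; lia.
have nLp : (p - h < B) = false by rewrite /p; lia.
have nh : (p < h) = false by rewrite /p; lia.
have Dv : (p - h - B) %/ B = j by rewrite Ep divnMDl // divn_small ?addn0.
have Md : (p - h - B) %% B = dgt B e j by rewrite Ep modnMDl modn_small.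
have nc : (cellv e < h) = false by rewrite /cellv; lia.
have nLc : (cellv e - h < B) = false by rewrite /cellv; lia.
have nLc' : (cellv e - h < B + K * B) = false by rewrite /cellv; lia.
have Ec : cellv e - h - (B + K * B) = e by rewrite /cellv; lia.
have uN : h + dgt B e j < nvert by case/andP: (num_range dB).
apply/and3P; split.
- rewrite srtE; last by rewrite /nsorts; lia.
  by rewrite cN /vsort nLc nLc' eqxx !andbT leqNgt nc.
- apply/hasP; exists (ncode (dgt B e j)); first by rewrite mem_iota add0n ncode_lt.
  exact: srt_num.
- apply/hasP; exists p; first by rewrite mem_iota add0n.
  rewrite srtE; last by rewrite /nsorts; lia.
  rewrite pN /vsort nLp Lp Dv eqxx !andbT leqNgt nh /=; apply/andP; split.
    by rewrite /gx cN pN /darc nc nh nLc nLc' Lp nLp Ec Dv Md eqxx /= leqNgt nLp ?orbT.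
  have nu : (h + dgt B e j < h) = false by lia.
  by rewrite /gx pN uN /darc nh nu nLp Lp Md addKn dB eqxx /= ?orbT.
Qed.

Lemma gx_regular : regular K nvert gx id.
Proof.
split.
- by move=> u s s' l l'; rewrite !srtE // => /andP[_ /eqP ->] /andP[_ /eqP ->].
- move=> u v /kndE[i [iB -> k]] /kndE[j [jB -> k']]; move: k k'; rewrite !ncode_kd.
  case: (eqVneq i 0) => [-> _|_]; last by case: ifP.
  by case: (eqVneq j 0) => [-> //|_]; case: ifP.
- move=> u v v' /sucE[i [_ Ei ->]] /sucE[j [_ Ej ->]].
  by have -> : i = j by lia.
- move=> j v u u' jK /(digE jK)[e _ [Ee ->]] /(digE jK)[e' _ [Ee' ->]].
  by have -> : e = e' by move: Ee'; rewrite Ee /cellv; lia.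
- move=> v v' u H.
  have /andP[/(digE K0)[e eB [Ee _]] /(digE K0)[e' eB' [Ee' _]]] := H 0 K0.
  rewrite Ee Ee'; congr cellv; apply: (dgt_eq_all eB eB') => j jK.
  have /andP[/(digE jK)[d _ [Ed Ud]] /(digE jK)[d' _ [Ed' Ud']]] := H j jK.
  have -> : e = d by move: Ed; rewrite Ee /cellv; lia.
  have -> : e' = d' by move: Ed'; rewrite Ee' /cellv; lia.
  by move: Ud'; rewrite Ud; lia.
Qed.

Lemma gx_perfect : perfect K nvert gx id B (fun i => h + i).
Proof.
split=> //.
- by have := knd_num B0; rewrite ncode_kd.
- by move=> i iB; apply: suc_num.
- by have := @knd_num B.-1 (leqnn _); rewrite ncode_kd eqxx.
- by move=> e eB; exists (cellv e) => j jK; apply: dig_cell.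
Qed.

Lemma gx_ns i : i < B -> ns K gx id (fun i => h + i) i = ncode i.
Proof.
move=> iB; have H : has (srt K gx id (h + i)) (iota 0 18).
  by apply/hasP; exists (ncode i); [rewrite mem_iota add0n ncode_lt|apply: srt_num].
have := nth_find 0 H; rewrite nth_iota; last by move: H; rewrite has_find size_iota.
rewrite add0n srtE; first by case/andP => _ /eqP; rewrite vsort_num.
by move: H; rewrite has_find size_iota /nsorts; lia.
Qed.

Lemma gx_emb : emb K gx id.
Proof.
apply/allP => i; rewrite mem_iota add0n => /andP[_ ih].
apply/allP => j; rewrite mem_iota add0n => /andP[_ jh].
by rewrite gx_gad // implybb; case: eqP.
Qed.

(** Numbers, ports and cells have disjoint sorts, and the only edges within one of these layers join
    consecutive numbers, which differ modulo 3. *)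
Lemma gx_vsort u v : h <= u -> h <= v -> gx u v -> vsort u <> vsort v.
Proof.
wlog D : u v / darc u v.
  move=> H hu hv A; have /and3P[_ _ /orP[D|D]] := A; first exact: (H u v).
  by move=> E; apply: (H v u D) => //; rewrite gx_sym.
move=> hu hv _; have nu : (u < h) = false by lia.
have nv : (v < h) = false by lia.
move: D; rewrite /darc nu nv /vsort.
case: (ltnP (v - h) B) => Lv.
  move=> /eqP Ev; have -> : u - h < B by lia.
  move=> /(congr1 ta); rewrite !ncode_ta Ev; lia.
case: (ltnP (v - h) (B + K * B)) => Lv'.
  by move=> /andP[Lu _]; rewrite Lu; apply/eqP; rewrite neq_ltn (leq_trans (ncode_lt _)) // leq_addr.
move=> /andP[/andP[Lu Lu'] _]; have nL : (u - h < B) = false by lia.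
rewrite nL Lu' => E.
have : (u - h - B) %/ B < K by rewrite ltn_divLR //; lia.
lia.
Qed.

(** An ordinary vertex sees only two vertices of the gadget, hub 0 and the hub of its sort, and by
    [gx_vsort] the ordinary vertices of a clique have distinct sorts. *)
Lemma gx_clique (s : seq nat) u : uniq s -> {in s &, forall v w, v != w -> gx v w} ->
  u \in s -> h <= u -> size s <= nS + 2.
Proof.
move=> us cl us' hu.
have [s1|s1] := leqP (size s) 1; first by rewrite addn2; apply: leq_trans s1 _.
pose phi w := if w < h then (if w == 0 then nS else nS.+1) else vsort w.
have small w : w \in s -> w < h -> w = 0 \/ w = (vsort u).+1.
  move=> ws wh; have := cl w u ws us'; rewrite neq_ltn (leq_trans wh hu) => /(_ isT) A.
  have /andP[_ uN] := gx_lt A; move: A; rewrite gx_hub ?hu //.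
  by move=> /andP[_ /orP[/eqP|/eqP]]; [left|right].
have range w : w \in s -> h <= w < nvert \/ w < h.
  move=> ws; case: (ltnP w h) => wh; [by right|left]; rewrite /=.
  have [->|ne] := eqVneq w u; last by have /gx_lt/andP[] := cl w u ws us' ne.
  have [v vs ne] : exists2 v, v \in s & v != u.
    case: s us us' s1 {cl small ws} => [|v1 [|v2 s]] //= /andP[n1 _] _ _.
    have [E1|] := eqVneq v1 u; last by exists v1; rewrite ?inE ?eqxx.
    exists v2; first by rewrite !inE eqxx orbT.
    by apply/eqP => E2; move: n1; rewrite inE E1 E2 eqxx.
  by have /gx_lt/andP[] := cl v u vs us' ne.
have inj : {in s &, injective phi}.
  move=> v w vs ws; rewrite /phi; case: (ltnP v h) => vh; case: (ltnP w h) => wh.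
  - case: (small v vs vh) => ->; case: (small w ws wh) => -> //=.
    + by lia.
    + by lia.
  - have [/vsort_lt|] := range w ws; last by lia.
    by case: ifP => _ ? ?; lia.
  - have [/vsort_lt|] := range v vs; last by lia.
    by case: ifP => _ ? ?; lia.
  - move=> E; apply/eqP; apply: contraT => ne.
    by case: (gx_vsort vh wh (cl v w vs ws ne)).
have um : uniq (map phi s) by rewrite map_inj_in_uniq.
have sub : {subset map phi s <= iota 0 (nS + 2)}.
  move=> _ /mapP[w ws ->]; rewrite mem_iota add0n /phi; case: (ltnP w h) => wh.
    by case: ifP => _; lia.
  have [/vsort_lt|] := range w ws; last by lia.
  by lia.
by have := uniq_leq_size um sub; rewrite size_map size_iota.
Qed.

Definition gdeg (i : nat) : nat := count (gadj K i) (iota 0 h).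

(** Degrees of hubs are distinct and at most [2 * nH - 2]; in the other clique each vertex already
    has [2 * nH] neighbours, which explains the size of that clique. *)
Lemma gdegE i : i < h -> if i < nH then gdeg i = nH.-1 + i else nH.*2 <= gdeg i.
Proof.
move=> ih; have Eh : iota 0 h = iota 0 nH ++ iota nH nH.*2.+1 by rewrite -{2}[nH]add0n -iotaD.
rewrite /gdeg Eh count_cat; case: ifP => iH.
  congr addn.
    have -> : count (gadj K i) (iota 0 nH) = count (predC (pred1 i)) (iota 0 nH).
      by apply: eq_in_count => j; rewrite mem_iota add0n => /andP[_ jH]; rewrite /gadj iH jH eq_sym.
    have := count_predC (pred1 i) (iota 0 nH); rewrite size_iota count_uniq_mem ?iota_uniq //.
    by rewrite mem_iota add0n iH; lia.
  have -> : iota nH nH.*2.+1 = iota nH i ++ iota (nH + i) (nH.*2.+1 - i).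
    by rewrite -iotaD subnKC //; lia.
  rewrite count_cat.
  have -> : count (gadj K i) (iota nH i) = i.
    rewrite -[RHS](size_iota nH i); apply/eqP; rewrite -all_count; apply/allP => j.
    by rewrite mem_iota => jr; rewrite /gadj iH ifN; lia.
  rewrite (eq_in_count (a2 := pred0)) ?count_pred0 ?addn0 // => j.
  by rewrite mem_iota => jr; rewrite [RHS]/= /gadj iH ifN; lia.
apply: leq_trans (leq_addl _ _).
have -> : count (gadj K i) (iota nH nH.*2.+1) = count (predC (pred1 i)) (iota nH nH.*2.+1).
  apply: eq_in_count => j; rewrite mem_iota => jr; rewrite /gadj iH ifN; last by lia.
  by rewrite eq_sym.
have := count_predC (pred1 i) (iota nH nH.*2.+1); rewrite size_iota count_uniq_mem ?iota_uniq //.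
move: (count (predC _) _) => X; case: (i \in _) => /=; lia.
Qed.

(* No large clique contains an ordinary vertex, so an embedding permutes the gadget and
   preserves degrees, which tell the hubs apart. *)
Lemma gx_hubs e i : emb K gx e -> i < nH -> e i = i.
Proof.
move=> /allP He iH.
have eP j l : j < h -> l < h -> (gadj K j l -> gx (e j) (e l)) /\ (j != l -> e j != e l).
  move=> jh lh; have := He j; rewrite mem_iota add0n jh => /(_ isT)/allP/(_ l).
  by rewrite mem_iota add0n lh => /(_ isT)/andP[/implyP H1 /implyP H2].
have einj : {in iota 0 h &, injective e}.
  move=> j l; rewrite !mem_iota !add0n => /andP[_ jh] /andP[_ lh] E; apply/eqP; apply: contraT => ne.
  by have [_ /(_ ne)] := eP j l jh lh; rewrite E eqxx.
have side s : uniq s -> {subset s <= iota 0 h} -> {in s &, forall j l, j != l -> gadj K j l} ->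
    nS + 2 < size s -> forall j, j \in s -> e j < h.
  move=> us sub cl sz j js; rewrite ltnNge; apply/negP => hj.
  have : size (map e s) <= nS + 2.
    apply: (@gx_clique _ (e j)) => //; last by apply: map_f.
      by rewrite map_inj_in_uniq // => v w vs ws; apply: einj; apply: sub.
    move=> _ _ /mapP[v vs ->] /mapP[w ws ->] ne.
    have := sub v vs; have := sub w ws; rewrite !mem_iota !add0n => /andP[_ wh] /andP[_ vh].
    have [H _] := eP v w vh wh; apply: H; apply: cl => //; apply: contraNneq ne => -> //.
  by rewrite size_map leqNgt sz.
have s1 : forall j, j \in iota 0 nH -> e j < h.
  apply: side; first exact: iota_uniq.
  - by move=> l; rewrite !mem_iota; lia.
  - move=> v w; rewrite !mem_iota !add0n => /andP[_ vH] /andP[_ wH] ne.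
    by rewrite /gadj vH wH.
  - by rewrite size_iota /nhubs; lia.
have s2 : forall j, j \in iota nH nH.*2.+1 -> e j < h.
  apply: side; first exact: iota_uniq.
  - by move=> l; rewrite !mem_iota /ngad; lia.
  - move=> v w; rewrite !mem_iota => /andP[vr _] /andP[wr _] ne.
    have nv : (v < nH) = false by lia.
    have nw : (w < nH) = false by lia.
    by rewrite /gadj nv nw.
  - by rewrite size_iota /nhubs; lia.
have eh j : j < h -> e j < h.
  move=> jh; case: (ltnP j nH) => jH; [apply: s1|apply: s2]; rewrite mem_iota ?add0n //.
  by rewrite jH.
have pe : perm_eq (map e (iota 0 h)) (iota 0 h).
  apply: uniq_perm; rewrite ?map_inj_in_uniq ?iota_uniq //.
  apply: (uniq_min_size _ _ _).2; rewrite ?map_inj_in_uniq ?iota_uniq ?size_map //.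
  by move=> _ /mapP[v vs ->]; move: vs; rewrite !mem_iota !add0n => /andP[_ /eh].
have dle j : j \in iota 0 h -> gdeg j <= gdeg (e j).
  rewrite mem_iota add0n => /andP[_ jh].
  have -> : gdeg (e j) = count (fun l => gadj K (e j) (e l)) (iota 0 h).
    by rewrite /gdeg -(permP pe (gadj K (e j))) count_map.
  apply: sub_in_count => l; rewrite mem_iota add0n => /andP[_ lh] A.
  by have [/(_ A)] := eP j l jh lh; rewrite gx_gad ?eh.
(* No degree drops under [e], and the degrees have the same sum before and after the permutation;
   hence each is preserved. *)
have sE : \sum_(j <- iota 0 h) gdeg j = \sum_(j <- iota 0 h) gdeg (e j).
  by rewrite -(perm_big _ pe) big_map.
have ih : i < h by lia.
have := leq_sum_eq dle sE; move=> /(_ i); rewrite mem_iota add0n ih => /(_ isT) E.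
have := gdegE ih; rewrite iH => D; have := gdegE (eh i ih); case: ifP => L; lia.
Qed.

End Instance.

(** * Encoding graphs by strings *)

(** The square root as a bounded search, the form that the closure lemmas can treat. *)
Definition nsqrt (n : nat) : nat := find (fun i => n < i.+1 * i.+1) (iota 0 n.+1).

Lemma nsqrtE n : Nat.sqrt n = nsqrt n.
Proof.
have [H1 H2] := PeanoNat.Nat.sqrt_spec n (PeanoNat.Nat.le_0_l n).
set s := Nat.sqrt n in H1 H2 *; rewrite /nsqrt.
have sn : s <= n by nia.
have -> : iota 0 n.+1 = iota 0 s ++ s :: iota s.+1 (n - s).
  have -> : s :: iota s.+1 (n - s) = iota s (n - s).+1 by [].
  by rewrite -{2}[s]add0n -iotaD; congr iota; lia.
have N : ~~ has (fun i => n < i.+1 * i.+1) (iota 0 s).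
  by apply/hasPn => i; rewrite mem_iota add0n => /andP[_ si]; nia.
rewrite find_cat (negbTE N) size_iota /= ifT ?addn0 //; nia.
Qed.

Definition Nz (z : seq bool) : nat := (nsqrt (size z)).+1.

Definition adjz (z : seq bool) (u v : nat) : bool :=
  [&& u < Nz z, v < Nz z, u != v & nth false z ('C(maxn u v, 2) + minn u v)].

Lemma NzE z : gr_n z = Nz z. Proof. by rewrite /gr_n nsqrtE. Qed.

Lemma adjz_lt z u v : adjz z u v -> (u < Nz z) && (v < Nz z).
Proof. by case/and4P => -> ->. Qed.

Lemma adjz_gr z (u v : 'I_(gr_n z)) : gr_adj u v = adjz z u v.
Proof. by rewrite /gr_adj /adjz -NzE !ltn_ord /=. Qed.

Lemma avoids_nat (NM C : finType) (forb : seq (atom NM C) -> Prop) z :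
  (exists c : 'I_(gr_n z) -> C, avoids (@gr_adj z) c forb) <->
  (exists c : nat -> C, forall cl, forb cl -> forall t : NM -> nat, (forall n, t n < Nz z) ->
     ~~ all (asat (adjz z) c t) cl).
Proof.
split=> [[c H]|[c H]].
  exists (fun u => c (inord u)) => cl fc t tN.
  have tI n : t n < gr_n z by rewrite NzE.
  have := H cl fc (fun n => Ordinal (tI n)); apply: contraNN; apply: sub_all => -[u v|u v|u v|u k] //=.
  - by rewrite adjz_gr.
  - by rewrite (_ : inord (t u) = Ordinal (tI u)) //; apply: val_inj; rewrite /= inordK.
exists (fun u => c (val u)) => cl fc t.
have := H cl fc (fun n => val (t n)); rewrite -NzE => /(_ (fun n => ltn_ord (t n))).
apply: contraNN; apply: sub_all => -[u v|u v|u v|u k] //=.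
by rewrite adjz_gr.
Qed.

Definition gstring (N : nat) (g : nat -> nat -> bool) : seq bool :=
  mkseq (fun p => has (fun v => has (fun u => (p == 'C(v, 2) + u) && g u v) (iota 0 v)) (iota 0 N))
    (N.-1 ^ 2).

Lemma Nz_gstring N g : 0 < N -> Nz (gstring N g) = N.
Proof.
by move=> N0; rewrite -NzE /gr_n size_mkseq -mulnn PeanoNat.Nat.sqrt_square prednK.
Qed.

Lemma bin2_mono v w : v <= w -> 'C(v, 2) <= 'C(w, 2).
Proof. by move=> H; apply: leq_bin2l. Qed.

(** The combinatorial number system: for fixed [v] the indices of pairs with [u < v] fill the gap
    between two consecutive binomials. *)
Lemma bin2_inj u v u' v' : u < v -> u' < v' -> 'C(v, 2) + u = 'C(v', 2) + u' -> v = v' /\ u = u'.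
Proof.
have H a b c d : a < b -> c < d -> b < d -> 'C(b, 2) + a < 'C(d, 2) + c.
  move=> ab cd bd; have := bin2_mono bd; rewrite binS bin1; lia.
move=> uv uv' E; case: (ltngtP v v') => L.
- by have := H _ _ _ _ uv uv' L; lia.
- by have := H _ _ _ _ uv' uv L; lia.
- by split=> //; move: E; rewrite L; lia.
Qed.

Lemma adjz_gstring N (g : nat -> nat -> bool) : 1 < N -> (forall u v, g u v -> (u < N) && (v < N)) ->
  (forall u v, g u v = g v u) -> (forall u, g u u = false) -> adjz (gstring N g) = g.
Proof.
move=> N1 glt gs gi; apply: functional_extensionality => u; apply: functional_extensionality => v.
rewrite /adjz Nz_gstring; last by lia.
wlog uv : u v / u < v.
  move=> H; have [L|L] := boolP (u < v); first exact: H.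
  have [L'|L'] := boolP (v < u); last first.
    have -> : u = v by lia.
    by rewrite gi eqxx !andbF.
  by rewrite gs -(H v u L') maxnC minnC (eq_sym u v) andbCA.
case: (ltnP u N) => uN /=; last by apply/esym/negP => /glt; lia.
case: (ltnP v N) => vN /=; last by apply/esym/negP => /glt; lia.
have -> : maxn u v = v by lia.
have -> : minn u v = u by lia.
have -> /= : u != v by lia.
(* The largest index is at most ['C(N.-1, 2) + N.-2], so a string of length [N.-1 ^ 2] holds all
   edges. *)
have pL : 'C(v, 2) + u < N.-1 ^ 2.
  have : 'C(v, 2) <= 'C(N.-1, 2) by apply: bin2_mono; lia.
  have E : N.-1 = N.-2.+1 by lia.
  rewrite E binS bin1 -mulnn => b; have b2 : 'C(N.-2, 2) * 2 <= N.-2 * N.-2.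
    rewrite bin2 muln2; move: (N.-2) => q; apply: (@leq_trans (q * q.-1)).
      by have := odd_double_half (q * q.-1); lia.
    by rewrite leq_mul2l leq_pred orbT.
  have uk : u <= N.-2 by lia.
  move: (N.-2) ('C(N.-2, 2)) b b2 uk => q w b b2 uk; nia.
rewrite nth_mkseq //; apply/hasP/idP => [[w]|gg].
  rewrite mem_iota add0n => /andP[_ wN] /hasP[t]; rewrite mem_iota add0n => /andP[_ tw] /andP[/eqP E G].
  by have [-> ->] := bin2_inj uv tw E.
exists v; first by rewrite mem_iota add0n.
by apply/hasP; exists u; rewrite ?mem_iota ?add0n ?eqxx.
Qed.

Lemma PF_dgt b c j : PF b -> PF c -> PF j -> PF (fun x e => dgt (b x e) (c x e) (j x e)).
Proof.
move=> Hb Hc Hj; apply: (PF_modn _ Hb).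
apply: (@PF_iter (fun x a e => a %/ b x e) _ _ c) => //; last first.
  move=> x e i _; elim: i => //= i IH; exact: leq_trans (leq_div _ _) IH.
- exact: PF_bnd.
- by apply: PF_divn; [pf_var|exact: PF_behead Hb].
Qed.

Lemma PFb_imply P Q : PFb P -> PFb Q -> PFb (fun x e => P x e ==> Q x e).
Proof. by move=> HP HQ; apply: PFb_ext (PFb_or (PFb_not HP) HQ) => x e; rewrite implybE. Qed.

Lemma PF_lift k f : PF f -> PF (fun x e => f x (iter k behead e)).
Proof. by move=> Hf; elim: k => [//|k IH]; apply: PF_ext (PF_behead IH) => x e; rewrite -iterSr. Qed.

Ltac pf_lift := match goal with
  | H : PF ?u |- PF (fun x e => ?u x (@?t x e)) =>
      first [exact (PF_lift 1 H) | exact (PF_lift 2 H) | exact (PF_lift 3 H) | exact (PF_lift 4 H)]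
  end.

(** Computability follows the syntax of the expression. [ext] treats the functions defined along the
    way, [pf_lift] hypotheses whose environment was shortened by binders. *)
Ltac pf_step ext := cbv beta; lazymatch goal with
  | |- PF (fun _ _ => ?c) => exact (PF_const c)
  | |- PFb (fun _ _ => ?c) => exact (PFb_const c)
  | |- PF (fun _ e => head _ _) => pf_var
  | |- PF (fun x _ => size x) => exact PF_size
  | |- PF (fun x e => nat_of_bool (@?P x e)) => change (PFb P)
  | |- PF (fun x e => addn (@?f x e) (@?g x e)) => apply (@PF_add f g)
  | |- PF (fun x e => subn (@?f x e) (@?g x e)) => apply (@PF_sub f g)
  | |- PF (fun x e => muln (@?f x e) (@?g x e)) => apply (@PF_mul f g)
  | |- PF (fun x e => divn (@?f x e) (@?g x e)) => apply (@PF_divn f g)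
  | |- PF (fun x e => modn (@?f x e) (@?g x e)) => apply (@PF_modn f g)
  | |- PF (fun x e => expn (@?f x e) ?k) => apply (@PF_expn f k)
  | |- PF (fun x e => binomial (@?f x e) 2) => apply (@PF_bin2 f)
  | |- PF (fun x e => dgt (@?b x e) (@?c x e) (@?j x e)) => apply (@PF_dgt b c j)
  | |- PF (fun x e => S (@?f x e)) => apply (@PF_succ f)
  | |- PF (fun x e => Nat.pred (@?f x e)) => apply (@PF_pred f)
  | |- PF (fun x e => find (@?Q x e) (iota 0 (@?n x e))) => apply (@PF_find (fun x i e => Q x e i) n)
  | |- PFb (fun x e => andb (@?P x e) (@?Q x e)) => apply (@PFb_and P Q)
  | |- PFb (fun x e => orb (@?P x e) (@?Q x e)) => apply (@PFb_or P Q)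
  | |- PFb (fun x e => implb (@?P x e) (@?Q x e)) => apply (@PFb_imply P Q)
  | |- PFb (fun x e => negb (@?P x e)) => apply (@PFb_not P)
  | |- PFb (fun x e => leq (@?f x e) (@?g x e)) => apply (@PFb_leq f g)
  | |- PFb (fun x e => @eq_op _ (@?f x e) (@?g x e)) => apply (@PFb_eq f g)
  | |- PFb (fun x e => nth false x (@?f x e)) => apply (@PF_bit f)
  | |- PFb (fun x e => has (@?Q x e) (iota 0 (@?n x e))) => apply (@PFb_has (fun x i e => Q x e i) n)
  | |- PFb (fun x e => all (@?Q x e) (iota 0 (@?n x e))) => apply (@PFb_all (fun x i e => Q x e i) n)
  | |- PF _ => first [assumption | ext | pf_lift | apply: PF_if]
  | |- PFb _ => first [assumption | ext | pf_lift | apply: PFb_if]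
  end.

Ltac pf ext := repeat pf_step ext.

Section Gx.
Variable K : nat.

Lemma PFb_gadj u v : PF u -> PF v -> PFb (fun x e => gadj K (u x e) (v x e)).
Proof. by move=> Hu Hv; rewrite /gadj; pf fail. Qed.

Lemma PF_nvert : PF (fun x e => nvert K x).
Proof. by rewrite /nvert; pf fail. Qed.

Lemma PF_ncode i : PF i -> PF (fun x e => ncode x (i x e)).
Proof. by move=> Hi; rewrite /ncode; pf fail. Qed.

Lemma PF_vsort u : PF u -> PF (fun x e => vsort K x (u x e)).
Proof. by move=> Hu; rewrite /vsort; pf ltac:(apply: PF_ncode). Qed.

Lemma PFb_darc u v : PF u -> PF v -> PFb (fun x e => darc K x (u x e) (v x e)).
Proof.
by move=> Hu Hv; rewrite /darc; pf ltac:(first [apply: PF_vsort | apply: PFb_gadj]).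
Qed.

Lemma PFb_gx u v : PF u -> PF v -> PFb (fun x e => gx K x (u x e) (v x e)).
Proof.
by move=> Hu Hv; rewrite /gx; pf ltac:(first [exact: PF_nvert | apply: PFb_darc]).
Qed.

Definition freduce (x : seq bool) : seq bool := gstring (nvert K x) (gx K x).

Lemma freduce_computable : poly_time_computable freduce.
Proof.
apply: (@PF_output (fun x e => (nvert K x).-1 ^ 2)
  (fun x e => has (fun v => has (fun u => (head 0 e == 'C(v, 2) + u) && gx K x u v)
   (iota 0 v)) (iota 0 (nvert K x)))).
  by pf ltac:(exact: PF_nvert).
by pf ltac:(first [exact: PF_nvert | apply: PFb_gx]).
Qed.

End Gx.

(** * Recovering an instance from a graph *)

Lemma find_iota (P : pred nat) N k : k < N -> P k -> (forall i, i < k -> ~~ P i) -> find P (iota 0 N) = k.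
Proof.
move=> kN Pk H.
have -> : iota 0 N = iota 0 k ++ k :: iota k.+1 (N - k.+1).
  have -> : k :: iota k.+1 (N - k.+1) = iota k (N - k.+1).+1 by [].
  by rewrite -{2}[k]add0n -iotaD; congr iota; lia.
have Nh : ~~ has P (iota 0 k) by apply/hasPn => i; rewrite mem_iota add0n => /andP[_ /H].
by rewrite find_cat (negbTE Nh) size_iota /= Pk addn0.
Qed.

Lemma all_iotaP (P : pred nat) N : reflect (forall i, i < N -> P i) (all P (iota 0 N)).
Proof.
apply: (iffP allP) => H i; first by move=> iN; apply: H; rewrite mem_iota.
by rewrite mem_iota add0n => /andP[_]; apply: H.
Qed.

Lemma has_iotaP (P : pred nat) N : reflect (exists2 i, i < N & P i) (has P (iota 0 N)).
Proof.
apply: (iffP hasP) => -[i]; first by rewrite mem_iota add0n => /andP[_ iN] H; exists i.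
by move=> iN H; exists i; rewrite ?mem_iota.
Qed.

Lemma find_iotaP (P : pred nat) N i : i < N -> P i -> find P (iota 0 N) < N /\ P (find P (iota 0 N)).
Proof.
move=> iN Pi; have H : has P (iota 0 N) by apply/has_iotaP; exists i.
have L := H; rewrite has_find size_iota in L; split=> //.
by have := nth_find 0 H; rewrite nth_iota.
Qed.

Section Decide.
Variables (K N : nat) (adj : rel nat) (a : nat -> nat).
Hypotheses (K0 : 0 < K) (adj_lt : forall u v, adj u v -> (u < N) && (v < N)).

Notation srt := (srt K adj a).
Notation knd := (knd K adj a).
Notation suc := (suc K adj a).
Notation dig := (dig K N adj a).
Notation nS := (nsorts K).

Definition regularb : bool :=
  [&& all (fun u => all (fun s => all (fun s' => srt u s && srt u s' ==> (s == s'))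
        (iota 0 nS)) (iota 0 nS)) (iota 0 N),
      all (fun u => all (fun v => knd 0 u && knd 0 v ==> (u == v)) (iota 0 N)) (iota 0 N),
      all (fun u => all (fun v => all (fun v' => suc u v && suc u v' ==> (v == v'))
        (iota 0 N)) (iota 0 N)) (iota 0 N),
      all (fun j => all (fun v => all (fun u => all (fun u' => dig v j u && dig v j u' ==> (u == u'))
        (iota 0 N)) (iota 0 N)) (iota 0 N)) (iota 0 K) &
      all (fun v => all (fun v' => all (fun j => has (fun u => dig v j u && dig v' j u) (iota 0 N))
        (iota 0 K) ==> (v == v')) (iota 0 N)) (iota 0 N)].

Lemma srt_ltN u s : srt u s -> u < N.
Proof. by case/and3P => /adj_lt/andP[]. Qed.

Lemma knd_ltN k u : knd k u -> u < N.
Proof. by case/kndP => s _ [_ /srt_ltN]. Qed.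

Lemma suc_ltN u v : suc u v -> u < N /\ v < N.
Proof. by case/andP => /adj_lt/andP. Qed.

Lemma dig_ltN v j u : dig v j u -> v < N /\ u < N.
Proof. by case/and3P => /srt_ltN vN /has_iotaP[s _ /srt_ltN uN] _. Qed.

Lemma regularP : reflect (regular K N adj a) regularb.
Proof.
apply: (iffP and5P).
  move=> [/all_iotaP R1 /all_iotaP R2 /all_iotaP R3 /all_iotaP R4 /all_iotaP R5]; split.
  - move=> u s s' sS sS' S1 S2; have := R1 u (srt_ltN S1) => /all_iotaP /(_ s sS) /all_iotaP /(_ s' sS').
    by rewrite S1 S2 => /eqP.
  - move=> u v S1 S2; have := R2 u (knd_ltN S1) => /all_iotaP /(_ v (knd_ltN S2)).
    by rewrite S1 S2 => /eqP.
  - move=> u v v' S1 S2; have [uN vN] := suc_ltN S1; have [_ vN'] := suc_ltN S2.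
    have := R3 u uN => /all_iotaP /(_ v vN) /all_iotaP /(_ v' vN').
    by rewrite S1 S2 => /eqP.
  - move=> j v u u' jK S1 S2; have [vN uN] := dig_ltN S1; have [_ uN'] := dig_ltN S2.
    have := R4 j jK => /all_iotaP /(_ v vN) /all_iotaP /(_ u uN) /all_iotaP /(_ u' uN').
    by rewrite S1 S2 => /eqP.
  - move=> v v' u H; have /andP[/dig_ltN[vN _] /dig_ltN[vN' _]] := H 0 K0.
    have := R5 v vN => /all_iotaP /(_ v' vN') /implyP E; apply/eqP/E/all_iotaP => j jK.
    by apply/has_iotaP; exists (u j); [have /andP[/dig_ltN[]] := H j jK|exact: H].
move=> [R1 R2 R3 R4 R5]; split.
- apply/all_iotaP => u _; apply/all_iotaP => s sS; apply/all_iotaP => s' sS'.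
  by apply/implyP => /andP[S1 S2]; apply/eqP; exact: R1 S1 S2.
- apply/all_iotaP => u _; apply/all_iotaP => v _.
  by apply/implyP => /andP[S1 S2]; apply/eqP; exact: R2 S1 S2.
- apply/all_iotaP => u _; apply/all_iotaP => v _; apply/all_iotaP => v' _.
  by apply/implyP => /andP[S1 S2]; apply/eqP; exact: R3 S1 S2.
- apply/all_iotaP => j jK; apply/all_iotaP => v _; apply/all_iotaP => u _; apply/all_iotaP => u' _.
  by apply/implyP => /andP[S1 S2]; apply/eqP; exact: R4 jK S1 S2.
- apply/all_iotaP => v _; apply/all_iotaP => v' _; apply/implyP => /all_iotaP H.
  apply/eqP/(R5 _ _ (fun j => find (fun u => dig v j u && dig v' j u) (iota 0 N))) => j jK.
  have /has_iotaP[u uN D] := H j jK.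
  by case: (@find_iotaP (fun u => dig v j u && dig v' j u) _ _ uN D).
Qed.

Definition nxt (u : nat) : nat := find (suc u) (iota 0 N).
(** Each step takes the least successor; a dead end yields [N], which is no vertex. *)
Definition chain (i : nat) : nat := iter i nxt (find (knd 0) (iota 0 N)).
Definition last_num : nat := find (fun i => knd 2 (chain i)) (iota 0 N).

(** Since [K] is fixed and [last_num] is at most [N], running through all codes is polynomial. *)
Definition perfectb : bool :=
  [&& knd 0 (chain 0), 0 < last_num, last_num < N,
      all (fun i => suc (chain i) (chain i.+1)) (iota 0 last_num) &
      all (fun e => has (fun v => all (fun j => dig v j (chain (dgt last_num.+1 e j)))
        (iota 0 K)) (iota 0 N)) (iota 0 (last_num.+1 ^ K))].

Lemma perfectb_perfect : perfectb -> perfect K N adj a last_num.+1 chain.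
Proof.
move=> /and5P[H0 l0 lN /all_iotaP HS /all_iotaP Hc]; split=> //.
- have := lN; rewrite /last_num -{2}(size_iota 0 N) -has_find => /(nth_find 0).
  by rewrite nth_iota.
- by move=> e /Hc /has_iotaP[v _ /all_iotaP D]; exists v.
Qed.

(** Regularity leaves no choice of first number or successor, so the greedy chain is any given path
    [nu]; as [nu] is injective, its length is at most [N] and the bounded search finds its end. *)
Lemma perfect_perfectb B nu : regular K N adj a -> perfect K N adj a B nu -> perfectb.
Proof.
move=> reg [B1 nu0 nuS nuM full].
have [_ R2 R3 _ _] := reg.
have E i : i < B -> chain i = nu i.
  elim: i => [|i IH] iB.
    by have [_ H] := @find_iotaP (knd 0) _ _ (knd_ltN nu0) nu0; exact: R2.
  rewrite /chain iterS -/(chain i) IH; last by lia.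
  have S := nuS i iB; have [_ vN] := suc_ltN S.
  by have [_ H] := @find_iotaP (suc (nu i)) _ _ vN S; exact: R3 H S.
have nuN i : i < B -> nu i < N.
  case: i => [_|i iB]; first exact: knd_ltN nu0.
  by have [] := suc_ltN (nuS i iB).
have BN : B <= N.
  have U : uniq [seq nu i | i <- iota 0 B].
    rewrite map_inj_in_uniq ?iota_uniq // => i j; rewrite !mem_iota !add0n => /andP[_ iB] /andP[_ jB].
    exact: (nu_inj K0 K0 reg B1 nu0 nuS nuM).
  have /(uniq_leq_size U) : {subset [seq nu i | i <- iota 0 B] <= iota 0 N}.
    by move=> u /mapP[i]; rewrite mem_iota add0n => /andP[_ iB] ->; rewrite mem_iota nuN.
  by rewrite size_map !size_iota.
have L : last_num = B.-1.
  apply: find_iota; first by lia.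
    by rewrite E //; lia.
  by move=> i iB; rewrite E ?(nu_knd2 K0 K0 reg B1 nu0 nuS nuM); lia.
rewrite /perfectb L; apply/and5P; split; [by rewrite E //; lia|by lia|by lia| |].
  by apply/all_iotaP => i iB; rewrite !E; [apply: nuS; lia|lia|lia].
have EB : B.-1.+1 = B by lia.
rewrite EB; apply/all_iotaP => e eB; have [v D] := full e eB.
apply/has_iotaP; exists v; first by have [] := dig_ltN (D 0 K0).
by apply/all_iotaP => j jK; rewrite E; [apply: D|apply: dgt_lt; lia].
Qed.

Lemma chain_le i : chain i <= N.
Proof. by case: i => [|i]; rewrite -[leqRHS](size_iota 0 N); exact: find_size. Qed.

End Decide.

(** * From graphs to instances of the language *)

Section Strings.
Variables (K : nat) (yes no : seq bool).

(** A map from the gadget to the graph is a number whose digits in base [Nz z] are its values. The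
    gadget has constant size, so all of them can be tried in polynomial time. *)
Definition code0 (z : seq bool) : nat :=
  find (fun c => emb K (adjz z) (dgt (Nz z) c)) (iota 0 (Nz z ^ ngad K)).
Definition hub (z : seq bool) (i : nat) : nat := dgt (Nz z) (code0 z) i.

Definition embeddable (z : seq bool) : bool := code0 z < Nz z ^ ngad K.

Definition ambiguous (z : seq bool) : bool :=
  has (fun c => emb K (adjz z) (dgt (Nz z) c) &&
    has (fun i => dgt (Nz z) c i != hub z i) (iota 0 (nhubs K))) (iota 0 (Nz z ^ ngad K)).

(** The strings [yes] and [no] are to be a fixed member and a fixed non-member of the language. *)
Definition greduce (z : seq bool) : seq bool :=
  if ~~ embeddable z then yes
  else if ambiguous z || ~~ regularb K (Nz z) (adjz z) (hub z) then no
  else if ~~ perfectb K (Nz z) (adjz z) (hub z) then yes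
  else mkseq (fun i => bt (ns K (adjz z) (hub z) (chain K (Nz z) (adjz z) (hub z)) i.+1))
    ((last_num K (Nz z) (adjz z) (hub z)).+1 - 2).

Lemma PF_Nz : PF (fun x e => Nz x).
Proof. by rewrite /Nz /nsqrt; pf fail. Qed.

Ltac ext0 := idtac; lazymatch goal with
  | |- PF (fun x _ => Nz x) => exact PF_Nz
  | |- PFb (fun x e => gadj K (@?u x e) (@?v x e)) => apply (@PFb_gadj K u v)
  end.

Lemma PFb_adjz u v : PF u -> PF v -> PFb (fun x e => adjz x (u x e) (v x e)).
Proof. by move=> Hu Hv; rewrite /adjz /maxn /minn; pf ext0. Qed.

Ltac ext1 := idtac; lazymatch goal with
  | |- PFb (fun x e => adjz x (@?u x e) (@?v x e)) => apply (@PFb_adjz u v)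
  | |- _ => ext0
  end.

Lemma PFb_emb c : PF c -> PFb (fun x e => emb K (adjz x) (dgt (Nz x) (c x e))).
Proof. by move=> Hc; rewrite /emb; pf ext1. Qed.

Lemma PF_code0 : PF (fun x e => code0 x).
Proof.
by rewrite /code0; pf ltac:(first [ext1 | apply: PFb_emb]).
Qed.

Lemma PF_hub i : PF i -> PF (fun x e => hub x (i x e)).
Proof. by move=> Hi; rewrite /hub; pf ltac:(first [ext1 | exact PF_code0]). Qed.

Lemma PFb_ambiguous : PFb (fun x e => ambiguous x).
Proof.
by rewrite /ambiguous; pf ltac:(first [ext1 | apply: PFb_emb | apply: PF_hub]).
Qed.

Lemma PFb_embeddable : PFb (fun x e => embeddable x).
Proof.
by rewrite /embeddable; pf ltac:(first [ext1 | exact PF_code0]).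
Qed.

Ltac ext2 := idtac; lazymatch goal with
  | |- PF (fun x e => hub x (@?u x e)) => apply (@PF_hub u)
  | |- _ => ext1
  end.

Lemma PFb_srt u s : PF u -> PF s -> PFb (fun x e => srt K (adjz x) (hub x) (u x e) (s x e)).
Proof. by move=> Hu Hs; rewrite /srt; pf ext2. Qed.

Ltac ext3 := idtac; lazymatch goal with
  | |- PFb (fun x e => srt K (adjz x) (hub x) (@?u x e) (@?s x e)) => apply (@PFb_srt u s)
  | |- _ => ext2
  end.

Lemma PFb_knd k u : PF u -> PFb (fun x e => knd K (adjz x) (hub x) k (u x e)).
Proof. by move=> Hu; rewrite /knd /kd; pf ext3. Qed.

Lemma PFb_suc u v : PF u -> PF v -> PFb (fun x e => suc K (adjz x) (hub x) (u x e) (v x e)).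
Proof. by move=> Hu Hv; rewrite /suc /cmp /kd /ta; pf ext3. Qed.

Lemma PFb_dig v j u : PF v -> PF j -> PF u ->
  PFb (fun x e => dig K (Nz x) (adjz x) (hub x) (v x e) (j x e) (u x e)).
Proof. by move=> Hv Hj Hu; rewrite /dig; pf ext3. Qed.

Ltac ext4 := idtac; lazymatch goal with
  | |- PFb (fun x e => knd K (adjz x) (hub x) ?k (@?u x e)) => apply (@PFb_knd k u)
  | |- PFb (fun x e => suc K (adjz x) (hub x) (@?u x e) (@?v x e)) => apply (@PFb_suc u v)
  | |- PFb (fun x e => dig K (Nz x) (adjz x) (hub x) (@?v x e) (@?j x e) (@?u x e)) =>
      apply (@PFb_dig v j u)
  | |- _ => ext3
  end.

Lemma PFb_regularb : PFb (fun x e => regularb K (Nz x) (adjz x) (hub x)).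
Proof. by rewrite /regularb; pf ext4. Qed.

Lemma PF_chain i : PF i -> PF (fun x e => chain K (Nz x) (adjz x) (hub x) (i x e)).
Proof.
move=> Hi; apply: (@PF_iter (fun x a e => nxt K (Nz x) (adjz x) (hub x) a) _ _ (fun x e => Nz x)) => //.
- by pf ext4.
- by rewrite /nxt; pf ext4.
- exact: PF_bnd PF_Nz.
- by move=> x e j _; exact: chain_le.
Qed.

Ltac ext5 := idtac; lazymatch goal with
  | |- PF (fun x e => chain K (Nz x) (adjz x) (hub x) (@?i x e)) => apply (@PF_chain i)
  | |- _ => ext4
  end.

Lemma PF_last_num : PF (fun x e => last_num K (Nz x) (adjz x) (hub x)).
Proof. by rewrite /last_num; pf ext5. Qed.

Lemma PFb_perfectb : PFb (fun x e => perfectb K (Nz x) (adjz x) (hub x)).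
Proof. by rewrite /perfectb; pf ltac:(first [ext5 | exact PF_last_num]). Qed.

Lemma greduce_computable : poly_time_computable greduce.
Proof.
pose pz := fun x => perfectb K (Nz x) (adjz x) (hub x).
pose bad := fun x => ambiguous x || ~~ regularb K (Nz x) (adjz x) (hub x).
(* The case distinction is moved into both the length and the bits, as [PF_output] requires. *)
have -> : greduce = fun x => mkseq (fun i =>
    if ~~ embeddable x then nth false yes i else if bad x then nth false no i else
    if ~~ pz x then nth false yes i else
    find (srt K (adjz x) (hub x) (chain K (Nz x) (adjz x) (hub x) i.+1)) (iota 0 18) %% 2 == 1)
    (if ~~ embeddable x then size yes else if bad x then size no else
     if ~~ pz x then size yes else (last_num K (Nz x) (adjz x) (hub x)).+1 - 2).
  apply: functional_extensionality => x; rewrite /greduce /bad /pz.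
  by do 3 (case: ifP => _; first by rewrite mkseq_nth).
have HB : PFb (fun x e => bad x).
  by rewrite /bad; pf ltac:(first [exact PFb_ambiguous | exact PFb_regularb]).
apply: (@PF_output (fun x e =>
     if ~~ embeddable x then size yes else if bad x then size no else
     if ~~ pz x then size yes else (last_num K (Nz x) (adjz x) (hub x)).+1 - 2)
  (fun x e => if ~~ embeddable x then nth false yes (head 0 e) else
    if bad x then nth false no (head 0 e) else
    if ~~ pz x then nth false yes (head 0 e) else
    find (srt K (adjz x) (hub x) (chain K (Nz x) (adjz x) (hub x) (head 0 e).+1)) (iota 0 18) %% 2 == 1)).
  by pf ltac:(first [exact PFb_embeddable | exact HB | exact PFb_perfectb | exact PF_last_num]).
by pf ltac:(first [exact PFb_embeddable | exact HB | exact PFb_perfectb | ext5 | apply: PFb_nth_const]).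
Qed.

Variable z : seq bool.
Notation N := (Nz z).
Notation adj := (adjz z).

Lemma emb_code e : emb K adj e ->
  exists c, [/\ c < N ^ ngad K, emb K adj (dgt N c) & forall i, i < ngad K -> dgt N c i = e i].
Proof.
move=> He; have eN i : i < ngad K -> e i < N by apply: (emb_lt (N := N) _ (@adjz_lt z) He).
have E i : i < ngad K -> dgt N (cod N (ngad K) e) i = e i by move=> iG; apply: dgt_cod.
by exists (cod N (ngad K) e); split=> //; [apply: cod_lt|rewrite (emb_ext _ E)].
Qed.

Lemma embeddable_hub : embeddable z -> emb K adj (hub z).
Proof.
rewrite /embeddable /hub /code0 => lt; have H := lt.
rewrite -{2}(size_iota 0 (N ^ _)) -has_find in H.
by have := nth_find 0 H; rewrite nth_iota ?add0n.
Qed.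

Lemma not_embeddable e : ~~ embeddable z -> ~~ emb K adj e.
Proof.
move=> H; apply/negP => /emb_code[c [cN He _]]; case/negP: H.
by have [] := @find_iotaP (fun c => emb K adj (dgt N c)) _ _ cN He.
Qed.

Lemma ambiguousP : ambiguous z -> exists e i, [/\ emb K adj e, i < nhubs K & e i <> hub z i].
Proof.
rewrite /ambiguous => /has_iotaP[c _ /andP[He /has_iotaP[i iH /eqP ne]]].
by exists (dgt N c), i; split; [exact: He|exact: iH|exact: ne].
Qed.

Lemma not_ambiguous e i : ~~ ambiguous z -> emb K adj e -> i < nhubs K -> e i = hub z i.
Proof.
move=> H /emb_code[c [cN He E]] iH; apply/eqP; apply: contraNT H => ne.
rewrite /ambiguous; apply/has_iotaP; exists c => //; rewrite He; apply/has_iotaP; exists i => //.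
by rewrite E // /ngad; lia.
Qed.

End Strings.

(** * Polynomial equivalence *)

Lemma id_computable : poly_time_computable id.
Proof.
have -> : @id (seq bool) = fun x => mkseq (fun i => nth false x i) (size x).
  by apply: functional_extensionality => x; rewrite mkseq_nth.
by apply: (@PF_output (fun x e => size x) (fun x e => nth false x (head 0 e))); pf fail.
Qed.

Lemma equivalent_same (L1 L2 : language) : (forall x, L1 x <-> L2 x) -> poly_equivalent L1 L2.
Proof.
by move=> H; split; exists id; split=> [|x]; try exact: id_computable; rewrite H.
Qed.

Lemma Nz_gt0 z : 0 < Nz z. Proof. by []. Qed.

Theorem theorem4p1 :
  forall L : language, in_NP L ->
  exists (k : nat) (Fs : seq (cgraph k)),
    (forall F, List.In F Fs -> cgraph_wf F) /\
    poly_equivalent L (free_coloring Fs).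
Proof.
move=> L [V [c [k [[f1 [[M1 [c1 [k1 HM1]]] HV]] HL]]]].
(* The reduction back needs a member and a non-member. For an empty language zero colours do: every
   encoded graph has a vertex, so none has a colouring. *)
have [[yes Hyes]|Nyes] := classic (exists x, L x); last first.
  exists 0, [::]; split=> //; apply: equivalent_same => x; split=> [H|[col _]]; first by case: Nyes; exists x.
  by case: (col (Ordinal (ltn0Sn _ : 0 < gr_n x))).
(* For the language of all strings one colour and no forbidden graph do. *)
have [[no Hno]|Nno] := classic (exists x, ~ L x); last first.
  exists 1, [::]; split=> //; apply: equivalent_same => x; split=> [_|_]; first by exists (fun=> ord0).
  by apply: NNPP => H; apply: Nno; exists x.
have [M2 [c2 [k2 HM2]]] := guard_computable c k.
have [z [m [z1 zm Hp]]] := params c k c1 k1 c2 k2.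
pose K := m.+1 + m; have K0 : 0 < K by [].
pose COLS N adj := COL K m.+1 (@ok1 M1 M2 K m z) (@ok2 M1 M2 K m z) (@ok3 M1 M2) (@ok4 M1 M2 K) N adj.
exists _, (small_graphs (@theforb M1 M2 z m)); split; first exact: small_graphs_wf.
have FC w : free_coloring (small_graphs (@theforb M1 M2 z m)) w <-> COLS (Nz w) (adjz w).
  by rewrite (free_coloring_avoids _ (nm K 0 0 0)) avoids_nat.
split.
- exists (freduce K); split; first exact: freduce_computable.
  move=> x; rewrite FC /freduce.
  have N1 : 1 < nvert K x by have := @hN K x; rewrite /ngad /nhubs /nsorts; lia.
  rewrite Nz_gstring; last by lia.
  rewrite (adjz_gstring N1 (@gx_lt K x) (@gx_sym K x) (gx_irr x K0)).
  rewrite /COLS (COL_perfect HL HV HM1 HM2 z1 zm Hp _ (@gx_lt K x) (gx_emb x K0) _ (gx_regular x K0) (gx_perfect x K0)).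
  + have -> // : xdec m (gx K x) id (size x).+2 (fun i => ngad K + i) = x.
    rewrite /xdec subn2 -[RHS](mkseq_nth false); apply: (@eq_from_nth _ false); rewrite !size_mkseq // => i ix.
    by rewrite !nth_mkseq // (gx_ns K0) ?(ncode_bt _ K0) //; lia.
  + by lia.
  + by move=> e He i iH; apply: (gx_hubs K0 He).
exists (greduce K yes no); split; first exact: greduce_computable.
move=> w; rewrite FC /greduce.
case: ifPn => [Ne|/negPn Em].
  by split=> // _; apply: no_emb_COL => e; apply: not_embeddable.
have Hh := embeddable_hub Em.
case: ifPn => [|]; last rewrite negb_or => /andP[Na /negPn /(regularP _ K0 (@adjz_lt w)) reg].
  move=> H; split=> // Hc; case/orP: H => [/ambiguousP[e [i [He iH ne]]]|].
    by case: ne; apply: (COL_hubs (Nz_gt0 w) (@adjz_lt w) Hc He Hh iH).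
  (* Irregularity refutes colourings only relative to unique hubs, so ambiguous hubs are ruled out
     again here. *)
  have [|] := boolP (ambiguous K w) => [/ambiguousP[e [i [He iH ne]]] _|Na].
    by case: ne; apply: (COL_hubs (Nz_gt0 w) (@adjz_lt w) Hc He Hh iH).
  case/negP; apply/(regularP _ K0 (@adjz_lt w)).
  by apply: (COL_regular z1 zm (Nz_gt0 w) (@adjz_lt w) Hh _ Hc) => e He i; apply: not_ambiguous.
have U e : emb K (adjz w) e -> forall i, i < nhubs K -> e i = hub K w i.
  by move=> He i; apply: not_ambiguous.
case: ifPn => [Np|/negPn /perfectb_perfect P].
  split=> // _; apply: (COL_imperfect _ _ z1 zm (Nz_gt0 w) (@adjz_lt w) Hh U reg) => -[B [nu P]].
  by case/negP: Np; apply: (perfect_perfectb K0 (@adjz_lt w) reg P).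
exact: (COL_perfect HL HV HM1 HM2 z1 zm Hp (Nz_gt0 w) (@adjz_lt w) Hh U reg P).
Qed.
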